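(* Let $F$ be a non-archimedean local field of arbitrary characteristic (including $2$), $E/F$ a separable quadratic field extension and $T=T_{E/F}\subset SL(2)$ the associated anisotropic torus. Put $\kappa=\varepsilon_{E/F}$. There exist functions $\Gamma_1,\Gamma_{\nu}$ on the set of regular elements $T(F)\setminus\{\pm1\}$ and a constant $c\in\mathbb C$ (independent of $f$, depending on the choice of measures) such that for every $f\in C_c^\infty(SL(2,F))$ there is a neighbourhood $V$ of $1$ in $T(F)$ with $$\mathcal O(t,f)=\Gamma_1(t)\,f(1)+\Gamma_{\nu}(t)\,\mathcal O^{1}(\boldsymbol\nu,f)+c\,\Delta^{\mathcal E}(t)^{-1}\,\mathcal O^{\kappa}(\boldsymbol\nu,f)$$ for all regular $t\in V$.
   Context: $x\mapsto\overline x$ is the nontrivial element of $\mathrm{Gal}(E/F)$, $\varepsilon_{E/F}:F^\times\to\{\pm1\}$ is the character with kernel $N_{E/F}E^\times$. Fix $\tau\in E\setminus F$; multiplication on $E$ in the basis $\{1,\tau\}$ embeds $E^\times$ in $GL(2,F)$, and $T_{E/F}(F)$ is the image of the norm-one elements, contained in $SL(2,F)$. For regular $t\in T(F)$, $$\mathcal O(t,f)=\int_{T(F)\backslash SL(2,F)}f(x^{-1}tx)\,dx .$$ If $t$ corresponds to $\gamma\in E^\times$, the transfer factor is $$\Delta^{\mathcal E}(t)=\lambda\cdot\varepsilon_{E/F}\Big(\frac{\gamma-\overline\gamma}{\tau-\overline\tau}\Big)|N_{E/F}(\gamma-\overline\gamma)|_F^{1/2},$$ $\lambda$ being a fixed nonzero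 constant (a fourth root of unity). With $K=SL(2,\mathfrak O_F)$ and for a character $\chi$ of $F^\times$ with $\chi^2=1$, the unipotent $\chi$-orbital integral is $$\mathcal O^{\chi}(\boldsymbol\nu,f)=\int_K\int_F\chi(n)\,f\Big(k^{-1}\begin{pmatrix}1&n\\0&1\end{pmatrix}k\Big)\,dn\,dk,\qquad \boldsymbol\nu=\begin{pmatrix}1&1\\0&1\end{pmatrix}$$ ($\chi=1$ gives $\mathcal O^1$). Haar measures are fixed. *)

(* Defs.v *)
From HB Require Import structures.
From mathcomp Require Import all_boot all_order all_algebra all_field.
From mathcomp Require Import complex.
From mathcomp Require Import all_classical all_reals all_analysis.

Set Implicit Arguments.
Unset Strict Implicit.
Unset Printing Implicit Defensive.

Import Order.TTheory GRing.Theory Num.Theory.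

Local Open Scope classical_set_scope.
Local Open Scope ring_scope.
Local Open Scope complex_scope.

#[short(type="topComNzRingType")]
HB.structure Definition TopComNzRing :=
  {A of GRing.ComNzRing A & Topological A}.

(* [absv] is the normalized absolute value |.|_F: the inverse of the cardinality
   of the residue field (of which [s] is a system of representatives) is the
   largest value smaller than 1. The uniform structure is the one of [absv]. *)
HB.mixin Record isNALocalField (R : realType) F
    & GRing.Field F & Uniform F := {
  absv : F -> R ;
  absv_ge0 : forall x, 0 <= absv x ;
  absv_eq0 : forall x, absv x = 0 -> x = 0 ;
  absvM : forall x y, absv (x * y) = absv x * absv y ;
  absv_ultra : forall x y, absv (x + y) <= Num.max (absv x) (absv y) ;
  entourage_absv :
    entourage = entourage_ (fun x e => [set y : F | absv (x - y) < e]) ;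
  absv_complete : forall G : set_system F,
    ProperFilter G -> cauchy G -> exists x : F, G --> x ;
  absv_normalized : exists (p : F) (s : seq F),
    [/\ uniq s,
        forall a, a \in s -> absv a <= 1,
        forall a b, a \in s -> b \in s -> absv (a - b) < 1 -> a = b &
        forall x, absv x <= 1 -> exists2 a, a \in s & absv (x - a) < 1] /\
    [/\ 0 < absv p < 1,
        forall x, absv x < 1 -> absv x <= absv p &
        absv p = (size s)%:R^-1]
}.

#[short(type="naLocalFieldType")]
HB.structure Definition NALocalField (R : realType) :=
  {F of isNALocalField R F & GRing.Field F & Uniform F}.

HB.instance Definition _ (R : realType) (F : naLocalFieldType R) :=
  isPointed.Build F 0.

Section complete_instance.
Context (R : realType) (F : naLocalFieldType R).
Lemma naLocalField_cvg (G : set_system F) :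
  ProperFilter G -> cauchy G -> cvg G.
Proof. by move=> GF /absv_complete[x Gx]; apply/cvg_ex; exists x. Qed.
HB.instance Definition _ := Uniform_isComplete.Build F naLocalField_cvg.
End complete_instance.


Section absv_theory.
Context (R : realType) (F : naLocalFieldType R).

Lemma absv0 : absv (0 : F) = 0.
Proof.
have [p [_ [_ [/andP[_ p1] _ _]]]] := @absv_normalized R F.
have h : absv (0 : F) * (1 - absv p) = 0 by rewrite mulrBr mulr1 -absvM mul0r subrr.
by move/eqP: h; rewrite mulf_eq0 => /orP[/eqP//|]; rewrite subr_eq0 eq_sym lt_eqF.
Qed.

Lemma absv1 : absv (1 : F) = 1.
Proof.
have n0 : absv (1 : F) != 0.
  by apply/eqP => /absv_eq0/eqP; rewrite oner_eq0.
by apply: (mulfI n0); rewrite -absvM !mulr1.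
Qed.

Lemma absvN1 : absv (-1 : F) = 1.
Proof.
have h : absv (-1 : F) ^+ 2 = 1 by rewrite expr2 -absvM mulrNN mulr1 absv1.
by apply/eqP; rewrite -(@eqrXn2 _ 2) ?absv_ge0 ?ler01// h expr1n.
Qed.

Definition valring_pred : pred F := [pred x | absv x <= 1].

Lemma valring_subring : subring_closed valring_pred.
Proof.
split=> [|x y|x y]; rewrite !inE ?absv1// => x1 y1.
  apply: (le_trans (absv_ultra _ _)); rewrite ge_max x1 /=.
  by rewrite -mulN1r absvM absvN1 mul1r.
by rewrite absvM mulr_ile1 ?absv_ge0.
Qed.

HB.instance Definition _ :=
  GRing.isSubringClosed.Build F valring_pred valring_subring.

End absv_theory.

(* The valuation ring, with the induced topology. *)
Record valring (R : realType) (F : naLocalFieldType R) := ValRing {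
  valring_val :> F ;
  _ : valring_val \in @valring_pred R F }.

Section valring_instances.
Context (R : realType) (F : naLocalFieldType R).
HB.instance Definition _ := [isSub for @valring_val R F].
HB.instance Definition _ := [Choice of valring F by <:].
HB.instance Definition _ := [SubChoice_isSubComNzRing of valring F by <:].
HB.instance Definition _ :=
  Topological.copy (valring F) (initial_topology (@valring_val R F)).
End valring_instances.

Record SL2 (A : comNzRingType) := MkSL2 {
  slmx :> 'M[A]_2 ;
  _ : \det slmx == 1 }.

Section SL2_group.
Context (A : comNzRingType).
Implicit Types x y : SL2 A.

HB.instance Definition _ := [isSub for @slmx A].
HB.instance Definition _ := [Choice of SL2 A by <:].

Lemma det_slmx x : \det (slmx x) = 1.
Proof. by case: x => m /= /eqP. Qed.

Lemma SL2_one_subproof : \det (1%:M : 'M[A]_2) == 1.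
Proof. by rewrite det1. Qed.
Definition SL2_one := MkSL2 SL2_one_subproof.

Lemma SL2_mul_subproof x y : \det (slmx x *m slmx y) == 1.
Proof. by rewrite det_mulmx !det_slmx mulr1. Qed.
Definition SL2_mul x y := MkSL2 (SL2_mul_subproof x y).

Lemma SL2_inv_subproof x : \det (\adj (slmx x)) == 1.
Proof.
have := congr1 determinant (mul_mx_adj (slmx x)).
by rewrite det_mulmx det_slmx mul1r det1 => ->.
Qed.
Definition SL2_inv x := MkSL2 (SL2_inv_subproof x).

Lemma SL2_mulA : associative SL2_mul.
Proof. by move=> x y z; apply: val_inj; rewrite /= mulmxA. Qed.
Lemma SL2_mul1 : left_id SL2_one SL2_mul.
Proof. by move=> x; apply: val_inj; rewrite /= mul1mx. Qed.
Lemma SL2_mulr1 : right_id SL2_one SL2_mul.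
Proof. by move=> x; apply: val_inj; rewrite /= mulmx1. Qed.
Lemma SL2_mulV : left_inverse SL2_one SL2_inv SL2_mul.
Proof. by move=> x; apply: val_inj; rewrite /= mul_adj_mx det_slmx. Qed.
Lemma SL2_mulrV : right_inverse SL2_one SL2_inv SL2_mul.
Proof. by move=> x; apply: val_inj; rewrite /= mul_mx_adj det_slmx. Qed.

HB.instance Definition _ :=
  isGroup.Build (SL2 A) SL2_mulA SL2_mul1 SL2_mulr1 SL2_mulV SL2_mulrV.
HB.instance Definition _ := isPointed.Build (SL2 A) 1%g.

End SL2_group.

HB.instance Definition _ (A : topComNzRingType) :=
  Topological.copy (SL2 A) (initial_topology (@slmx A)).

Section SL2_map.
Context (A B : comNzRingType) (h : {rmorphism A -> B}).
Lemma SL2_map_subproof (x : SL2 A) : \det (map_mx h (slmx x)) == 1.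
Proof. by rewrite det_map_mx det_slmx rmorph1. Qed.
Definition SL2_map (x : SL2 A) : SL2 B := MkSL2 (SL2_map_subproof x).
End SL2_map.

Definition SL2_incl (R : realType) (F : naLocalFieldType R) :
  SL2 (valring F) -> SL2 F := SL2_map (val : valring F -> F).

Section unipotent.
Context (A : comNzRingType).
Lemma unip_subproof (n : A) :
  \det (block_mx 1%:M n%:M 0 1%:M : 'M[A]_(1 + 1)) == 1.
Proof. by rewrite det_ublock !det1 mulr1. Qed.
Definition unip (n : A) : SL2 A := @MkSL2 A _ (unip_subproof n).
End unipotent.

(* The space T\G of right cosets T x of a subset T of G = SL(2, F), with the
   quotient topology; x and y are identified when T x = T y. *)
Section coset_space.
Context (A : topComNzRingType) (T : set (SL2 A)).
Definition rcoset (x : SL2 A) : set (SL2 A) := [set (t * x)%g | t in T].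
Definition rcoset_rel : rel (SL2 A) := [rel x y | `[< rcoset x = rcoset y >]].

Lemma rcoset_rel_refl : reflexive rcoset_rel.
Proof. by move=> x; apply/asboolP. Qed.
Lemma rcoset_rel_sym : symmetric rcoset_rel.
Proof. by move=> x y; apply/asboolP/asboolP. Qed.
Lemma rcoset_rel_trans : transitive rcoset_rel.
Proof. by move=> y x z /asboolP xy /asboolP yz; apply/asboolP; rewrite xy. Qed.

Canonical rcoset_equiv :=
  EquivRel rcoset_rel rcoset_rel_refl rcoset_rel_sym rcoset_rel_trans.

Definition coset_space : ptopologicalType :=
  quotient_topology {eq_quot rcoset_equiv}%qT.

Definition coset_pi (x : SL2 A) : coset_space :=
  (\pi_(quotient_topology {eq_quot rcoset_equiv}) x)%qT.
Definition coset_repr (q : coset_space) : SL2 A :=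
  repr (q : quotient_topology {eq_quot rcoset_equiv}%qT).

Definition coset_act (g : SL2 A) (q : coset_space) : coset_space :=
  coset_pi (coset_repr q * g)%g.
End coset_space.

Notation borel X := (g_sigma_algebraType (@open X)).

(* Nonzero Borel measures that are finite on compact sets and invariant under a
   family of transformations. The spaces below are locally compact and second
   countable, so that such measures are automatically regular. *)
Definition invariant_measure (R : realType) (X : ptopologicalType) (S : Type)
    (act : S -> X -> X) (mu : {measure set (borel X) -> \bar R}) : Prop :=
  [/\ (mu setT <> 0)%E,
      forall A : set X, compact A -> (mu A < +oo)%E &
      forall (g : S) (A : set (borel X)), measurable A ->
        mu (act g @^-1` A) = mu A].

Definition haar_add (R : realType) (F : naLocalFieldType R)
    (mu : {measure set (borel F) -> \bar R}) : Prop :=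
  invariant_measure (fun a x : F => a + x) mu.

Definition haar_SL2 (R : realType) (A : topComNzRingType)
    (mu : {measure set (borel (SL2 A)) -> \bar R}) : Prop :=
  invariant_measure (fun g x : SL2 A => (g * x)%g) mu.

(* The right G-invariant measures on T\G are the quotients of the Haar measures
   of G by those of T. *)
Definition haar_coset (R : realType) (A : topComNzRingType) (T : set (SL2 A))
    (mu : {measure set (borel (coset_space T)) -> \bar R}) : Prop :=
  invariant_measure (@coset_act A T) mu.

Definition cintegral (R : realType) (d : measure_display) (X : measurableType d)
    (mu : {measure set X -> \bar R}) (f : X -> R[i]) : R[i] :=
  (\int[mu]_x complex.Re (f x))%R +i* (\int[mu]_x complex.Im (f x))%R.

(* C_c^oo of a totally disconnected space: smooth means locally constant. *)
Definition Ccinf (R : realType) (X : topologicalType) (f : X -> R[i]) : Prop :=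
  (forall x, \forall y \near x, f y = f x) /\
  compact (closure [set x | f x != 0]).

(* O(t, f); for commutative T and t in T the integrand does not depend on the
   representative of the coset. *)
Definition orbint (R : realType) (F : naLocalFieldType R) (T : set (SL2 F))
    (mu : {measure set (borel (coset_space T)) -> \bar R})
    (t : SL2 F) (f : SL2 F -> R[i]) : R[i] :=
  cintegral mu (fun q : coset_space T =>
    let x := coset_repr q in f (x^-1 * t * x)%g).

(* O^chi(nu, f); the value of chi at 0 is immaterial. *)
Definition unip_orbint (R : realType) (F : naLocalFieldType R)
    (muK : {measure set (borel (SL2 (valring F))) -> \bar R})
    (muF : {measure set (borel F) -> \bar R})
    (chi : F -> R[i]) (f : SL2 F -> R[i]) : R[i] :=
  cintegral muK (fun k : SL2 (valring F) =>
    cintegral muF (fun n : F =>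
      let x := SL2_incl k in chi n * f (x^-1 * unip n * x)%g)).

Section quadratic.
Context (R : realType) (F : naLocalFieldType R) (E : splittingFieldType F).

Definition normEF (z : E) : E := galNorm 1%VS {:E} z.

(* The element of F equal to [z], if there is one. *)
Definition descend (z : E) : F := xget 0 [set a : F | a%:A = z].

(* The character of the units of F whose kernel is the group of norms of units
   of E, extended by 0. *)
Definition epsEF (a : F) : R[i] :=
  if a == 0 then 0 else if `[< exists z, normEF z = a%:A >] then 1 else -1.

(* The matrix of the multiplication by [g] in the basis (1, tau), acting on
   column vectors. *)
Definition mulE_mx (tau g : E) : 'M[F]_2 :=
  \matrix_(i, j) coord [tuple 1; tau] i (g * [tuple 1; tau]`_j).

Definition torus (tau : E) : set (SL2 F) :=
  [set t | exists2 g, normEF g = 1 & slmx t = mulE_mx tau g].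

Definition torus_reg (tau : E) : set (SL2 F) :=
  [set t | [/\ torus tau t, slmx t <> 1%:M & slmx t <> - 1%:M]].

Definition transfer_factor (lambda : R[i]) (sigma : gal_of {:E}) (tau g : E) :
    R[i] :=
  lambda * epsEF (descend ((g - sigma g) / (tau - sigma tau)))
  * (Num.sqrt (absv (descend (normEF (g - sigma g)))))%:C.

End quadratic.

(* Main.v *)
Require Import Defs.
From HB Require Import structures.
From mathcomp Require Import all_boot all_order all_algebra all_fingroup all_field.
From mathcomp Require Import complex.
From mathcomp Require Import all_classical all_reals all_analysis.
From mathcomp Require Import measurable_realfun ring lra zify.

Import Order.TTheory GRing.Theory Num.Theory.

Local Open Scope classical_set_scope.
Local Open Scope ring_scope.
Local Open Scope complex_scope.

Set Implicit Arguments.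
Unset Strict Implicit.
Unset Printing Implicit Defensive.

(** Write a regular element of the torus as [t = a + b M], where [M] is the
    multiplication by [tau]. The entries [A], [B], [C] of [x^-1 M x] are functions
    of the coset [T x], with [- B] and [C] norms, and [x^-1 t x = a + b (x^-1 M x)].
    Near trace 2, a smooth [f] is the sum of [f 1] times the indicator of a small
    ball around 1 and of a combination of indicators of [K]-conjugates of boxes,
    which prescribe the first row near that of a unipotent with upper right entry
    [x]. The measure of a box in the coordinates [(A, B)] is determined by
    invariance. Lower unipotents shear [A] by multiples of [B]: the center of the
    box in [A] is irrelevant. The Weyl element moves [B] to the norm
    [A^2 - s A + n] divided by [B]: the mass is unchanged when [B] is multiplied
    by a norm. So the measure is a constant times the radii divided by [|B|] if
    [- B] is a norm, and 0 otherwise. As the norms have index 2, with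
    [eps] the norm character the orbital integral of a box is thus a constant
    times [(1 + eps(-1) eps(b) eps(x)) / (2 |b| |x|)], whereas its unipotent
    [chi]-orbital integral is a constant times [chi(x) / |x|]: this yields
    [Gamma_nu] and [c]. What remains depends on [f] only through [f 1], so that
    [Gamma_1] can be read off the indicator of [SL2(O)]. *)

(** * The absolute value *)

(** Residue characteristic 2 is allowed, so the norm form cannot be diagonalized. It is kept as x^2
    + s x y + n y^2 in the basis (1, tau), with two assumptions: it is anisotropic, and its trace
    form 2 x + s y is not zero, which is separability. The costly step is that the product of two
    non-norms is a norm; it rests on counting in the residue field, in three cases: |2| = 1; |2| < 1
    with a norm of odd valuation; |2| < 1 with all norms of even valuation.

    The measure on the coset space is known only through its invariance. The moves used are the
    lower unipotents, the Weyl element and finite subdivision, and they control the boxes that are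
    small relative to |B|. Hence two scales: centers of size more than |r|, and radius |k r|.

    The mass of the ball around 1 is never computed. It depends on r, hence on f, whereas Gamma_1 is
    chosen before f: the same r serves for f and for the indicator of SL2(O), so that this mass
    cancels. *)

Section absv_basics.
Context {R : realType} {F : naLocalFieldType R}.
Implicit Types x y z : F.

Lemma absv_eq0E x : (absv x == 0) = (x == 0).
Proof. by apply/eqP/eqP => [/absv_eq0//|->]; rewrite absv0. Qed.

Lemma absv_gt0 x : (0 < absv x) = (x != 0).
Proof. by rewrite lt0r absv_ge0 andbT absv_eq0E. Qed.

Lemma absvN x : absv (- x) = absv x.
Proof. by rewrite -mulN1r absvM absvN1 mul1r. Qed.

Lemma absv_distC x y : absv (x - y) = absv (y - x).
Proof. by rewrite -opprB absvN. Qed.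

Lemma absvX x n : absv (x ^+ n) = absv x ^+ n.
Proof. by elim: n => [|n IH]; rewrite ?expr0 ?absv1// !exprS absvM IH. Qed.

Lemma absvV x : absv x^-1 = (absv x)^-1.
Proof.
have [->|x0] := eqVneq x 0; first by rewrite invr0 absv0 invr0.
have ax0 : absv x != 0 by rewrite absv_eq0E.
by apply: (mulfI ax0); rewrite -absvM !mulfV// absv1.
Qed.

Lemma absv_div x y : absv (x / y) = absv x / absv y.
Proof. by rewrite absvM absvV. Qed.

Lemma absvD_le x y (r : R) : absv x <= r -> absv y <= r -> absv (x + y) <= r.
Proof. by move=> xr yr; rewrite (le_trans (absv_ultra _ _))// ge_max xr. Qed.

Lemma absvB_le x y (r : R) : absv x <= r -> absv y <= r -> absv (x - y) <= r.
Proof. by move=> xr yr; rewrite absvD_le// absvN. Qed.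

Lemma absvD_lt x y (r : R) : absv x < r -> absv y < r -> absv (x + y) < r.
Proof. by move=> xr yr; rewrite (le_lt_trans (absv_ultra _ _))// gt_max xr. Qed.

Lemma absvB_lt x y (r : R) : absv x < r -> absv y < r -> absv (x - y) < r.
Proof. by move=> xr yr; rewrite absvD_lt// absvN. Qed.

Lemma absv_trans_le x y z (r : R) :
  absv (x - y) <= r -> absv (y - z) <= r -> absv (x - z) <= r.
Proof. by move=> xy yz; rewrite -(subrKA y) absvD_le. Qed.

Lemma absv_trans_lt x y z (r : R) :
  absv (x - y) < r -> absv (y - z) < r -> absv (x - z) < r.
Proof. by move=> xy yz; rewrite -(subrKA y) absvD_lt. Qed.

Lemma absvDl x y : absv y < absv x -> absv (x + y) = absv x.
Proof.
move=> yx; apply/le_anti; rewrite absvD_le// ?(ltW yx)//= leNgt.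
apply/negP => xyx.
by have := absvB_lt xyx yx; rewrite addrK ltxx.
Qed.

Lemma absvDr x y : absv x < absv y -> absv (x + y) = absv y.
Proof. by rewrite addrC; apply: absvDl. Qed.

Lemma absv_close x y : absv (x - y) < absv y -> absv x = absv y.
Proof. by move=> /absvDr; rewrite subrK. Qed.

Lemma absv_close_le x y (r : R) : absv (x - y) <= r -> r < absv y -> absv x = absv y.
Proof. by move=> xr ry; apply: absv_close; apply: le_lt_trans ry. Qed.

Lemma absv_nat n : absv (n%:R : F) <= 1.
Proof. by elim: n => [|n IH]; rewrite ?absv0 ?ler01// -natr1 absvD_le ?absv1. Qed.

Lemma absv_1D x : absv x < 1 -> absv (1 + x) = 1.
Proof. by move=> x1; rewrite absvDl absv1. Qed.

Definition unif : F := sval (cid (@absv_normalized R F)).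
Definition residues : seq F := sval (cid (svalP (cid (@absv_normalized R F)))).

Lemma unif_spec :
  [/\ uniq residues,
      forall a, a \in residues -> absv a <= 1,
      forall a b, a \in residues -> b \in residues -> absv (a - b) < 1 -> a = b &
      forall x, absv x <= 1 -> exists2 a, a \in residues & absv (x - a) < 1] /\
  [/\ 0 < absv unif < 1,
      forall x, absv x < 1 -> absv x <= absv unif &
      absv unif = (size residues)%:R^-1].
Proof. exact: svalP (cid (svalP (cid (@absv_normalized R F)))). Qed.

Lemma residues_uniq : uniq residues. Proof. by have [[]] := unif_spec. Qed.
Lemma residues_le1 a : a \in residues -> absv a <= 1.
Proof. by have [[_ + _ _ _]] := unif_spec; apply. Qed.
Lemma residues_inj a b : a \in residues -> b \in residues ->
  absv (a - b) < 1 -> a = b.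
Proof. by have [[_ _ + _ _]] := unif_spec; apply. Qed.
Lemma residues_ex x : absv x <= 1 -> exists2 a, a \in residues & absv (x - a) < 1.
Proof. by have [[_ _ _ + _]] := unif_spec; apply. Qed.

Lemma unif_gt0 : 0 < absv unif. Proof. by have [_ [/andP[]]] := unif_spec. Qed.
Lemma unif_lt1 : absv unif < 1. Proof. by have [_ [/andP[]]] := unif_spec. Qed.
Lemma unif_max x : absv x < 1 -> absv x <= absv unif.
Proof. by have [_ [_ + _]] := unif_spec; apply. Qed.
Lemma absv_unif : absv unif = (size residues)%:R^-1.
Proof. by have [_ [_ _]] := unif_spec. Qed.
Lemma unif_neq0 : unif != 0. Proof. by rewrite -absv_gt0 unif_gt0. Qed.
Lemma unif_le1 : absv unif <= 1. Proof. exact/ltW/unif_lt1. Qed.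

Lemma absv_lt_unif x y : absv x < absv y -> absv x <= absv unif * absv y.
Proof.
move=> xy; have y0 : 0 < absv y by apply: le_lt_trans xy; exact: absv_ge0.
by rewrite -ler_pdivrMr// -absv_div unif_max// absv_div ltr_pdivrMr ?mul1r.
Qed.

Lemma size_residues_gt1 : (1 < size residues)%N.
Proof.
have := unif_lt1; have := unif_gt0; rewrite absv_unif.
by case: (size residues) => [|[|n]]; rewrite ?invr0 ?invr1 ?ltxx.
Qed.

Lemma expr_unif_small (e : R) : 0 < e -> exists n, absv (unif ^+ n) < e.
Proof.
move=> e0; exists (Num.bound e^-1).
have e1 : 0 < e^-1 by rewrite invr_gt0.
rewrite absvX absv_unif exprVn -[X in _ < X]invrK ltf_pV2 ?posrE ?exprn_gt0 ?ltr0n//.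
- apply: (lt_trans (archi_boundP (ltW e1))).
  by rewrite -natrX ltr_nat; apply: ltn_expl; exact: size_residues_gt1.
- exact/ltnW/size_residues_gt1.
Qed.

Lemma absv_ex_big (r : R) : exists2 x : F, x != 0 & r <= absv x.
Proof.
have r1 : 0 < (Num.max r 1)^-1 by rewrite invr_gt0 lt_max ltr01 orbT.
have [n nr] := expr_unif_small r1; exists (unif ^- n).
  by rewrite invr_neq0// expf_neq0 ?unif_neq0.
have a0 : 0 < absv (unif ^+ n) by rewrite absv_gt0 expf_neq0 ?unif_neq0.
rewrite absvV; apply: (@le_trans _ _ (Num.max r 1)); first by rewrite le_max lexx.
by rewrite -[leLHS]invrK lef_pV2 ?posrE// ltW.
Qed.

Lemma absv_ex_small (r : R) : 0 < r -> exists2 x : F, x != 0 & absv x < r.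
Proof.
move=> /expr_unif_small[n nr]; exists (unif ^+ n) => //.
by rewrite expf_neq0 ?unif_neq0.
Qed.

(* The descent terminates because the value group is discrete away from 0. *)
Lemma absv_descent (T : Type) (g : T -> F) (S G : T -> Prop) (d : R) : 0 < d ->
  (forall t, S t -> d <= absv (g t)) ->
  (forall t, S t -> G t \/ exists2 t', S t' & absv (g t') < absv (g t)) ->
  forall t, S t -> exists2 t', S t' & G t'.
Proof.
move=> d0 Sd step t St.
have gt0 : 0 < absv (g t) by apply: lt_le_trans (Sd _ St).
have [n hn] := @expr_unif_small (d / absv (g t)) (divr_gt0 d0 gt0).
have {hn gt0} : absv (unif ^+ n) * absv (g t) < d by rewrite -ltr_pdivlMr.
elim: n t St => [|n IH] t St.
  by rewrite expr0 absv1 mul1r => /lt_geF; rewrite Sd.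
move=> H; have [Gt|[t' St' tt']] := step t St; first by exists t.
apply: (IH t') => //; apply: le_lt_trans H; rewrite exprSr absvM -mulrA.
by rewrite ler_wpM2l ?absv_ge0// absv_lt_unif.
Qed.

Lemma absv_unif_expz x : x != 0 -> exists k : int, absv x = absv (unif ^ k).
Proof.
move=> x0; have ax0 : 0 < absv x by rewrite absv_gt0.
have u0 := unif_neq0; have au0 := unif_gt0.
(* A high power of [unif] first brings [x] into the unit ball. An element between [|unif ^ m|] and 1
   can then be divided by [unif] at most [m] times, which makes the induction finite. *)
suff H : forall m (y : F), y != 0 -> absv (unif ^+ m) <= absv y -> absv y <= 1 ->
    exists k : int, absv y = absv (unif ^ k).
  have [N] : exists N, absv (unif ^+ N) < (absv x)^-1.
    by apply: expr_unif_small; rewrite invr_gt0.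
  rewrite -[ltRHS]mul1r ltr_pdivlMr// -absvM => /ltW bN.
  have yn0 : unif ^+ N * x != 0 by rewrite mulf_neq0 ?expf_neq0.
  have [M hM] : exists M, absv (unif ^+ M) < absv (unif ^+ N * x).
    by apply: expr_unif_small; rewrite absv_gt0.
  have [k hk] := H M _ yn0 (ltW hM) bN.
  exists (k - N%:Z); rewrite expfzDr// absvM -hk -exprz_inv -exprnP exprVn.
  by rewrite -absvM mulrAC mulfV ?mul1r// expf_neq0.
elim => [|m IH] y y0 my y1.
  by exists 0; rewrite expr0z absv1; apply/le_anti; rewrite y1 -(absv1 F) -(expr0 unif).
have [yu|] := ltP (absv y) 1; last first.
  by move=> ?; exists 0; rewrite expr0z absv1; apply/le_anti; rewrite y1.
have [||| k hk] := IH (y / unif); rewrite ?mulf_neq0 ?invr_neq0//.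
- by rewrite absv_div ler_pdivlMr// -absvM -exprSr.
- by rewrite absv_div ler_pdivrMr// mul1r unif_max.
- exists (k + 1); rewrite expfzDr// expr1z absvM -hk absv_div divfK//.
  by rewrite absv_eq0E.
Qed.

End absv_basics.
Arguments unif {R} F.
Arguments residues {R} F.

(** * Finite systems of representatives for balls modulo smaller balls *)

Section ball_representatives.
Context {R : realType} {F : naLocalFieldType R}.
Implicit Types (x y a b : F) (L : seq F).

Lemma absv_lt1P x : (absv x < 1) = (absv x <= absv (unif F)).
Proof. by apply/idP/idP => [/unif_max//|/le_lt_trans]; apply; exact: unif_lt1. Qed.

(** Coset representatives of the fractional ideal generated by [a] modulo the one generated by
    [b]. *)
Definition ball_reps a b L :=
  [/\ uniq L, forall x, x \in L -> absv x <= absv a,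
      forall x y, x \in L -> y \in L -> absv (x - y) <= absv b -> x = y &
      forall x, absv x <= absv a -> exists2 y, y \in L & absv (x - y) <= absv b].

(** Digit expansions: a representative at level [n + 1] is a digit plus [unif] times a
    representative at level [n]. The exact count is what later gives the measures of cosets. *)
Lemma ball_reps_unit n : exists2 L, size L = (size (residues F) ^ n)%N &
  ball_reps 1 (unif F ^+ n) L.
Proof.
elim: n => [|n [L sL [uL L1 Linj Lex]]].
  exists [:: 0] => //; split=> // [x|x y|x]; rewrite ?inE.
  - by move=> /eqP->; rewrite absv0 absv1 ler01.
  - by move=> /eqP-> /eqP->.
  - by move=> x1; exists 0; rewrite ?inE// subr0.
have u0 := unif_gt0 (F := F); have ule := unif_le1 (F := F).
have disj a b x y : a \in residues F -> b \in residues F -> x \in L -> y \in L ->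
    absv (a + unif F * x - (b + unif F * y)) <= absv (unif F ^+ n.+1) ->
    a = b /\ x = y.
  move=> aR bR xL yL h.
  have E : a + unif F * x - (b + unif F * y) = (a - b) + unif F * (x - y) by ring.
  have ab : a = b.
    apply: residues_inj => //; rewrite absv_lt1P.
    have -> : a - b = a + unif F * x - (b + unif F * y) - unif F * (x - y) by ring.
    apply: absvB_le.
      apply: le_trans h _; rewrite exprS absvM ler_piMr ?absv_ge0// absvX.
      by rewrite exprn_ile1 ?absv_ge0.
    rewrite absvM ler_piMr ?absv_ge0//.
    by apply: absvB_le; rewrite -(absv1 F) L1.
  split=> //; apply: Linj => //; move: h; rewrite E ab subrr add0r exprS !absvM.
  by rewrite ler_pM2l.
exists [seq a + unif F * x | a <- residues F, x <- L].
  by rewrite size_allpairs sL expnS.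
split.
- apply: allpairs_uniq => // [|[a x] [b y]]; first exact: residues_uniq.
  move=> /allpairsP[[a' x'] [/= aR xL [-> ->]]] /allpairsP[[b' y'] [/= bR yL [-> ->]]] e.
  have [//|-> ->//] := disj a' b' x' y' aR bR xL yL.
  by rewrite e subrr absv0 absv_ge0.
- move=> _ /allpairsP[[a x] [/= aR xL ->]]; rewrite absv1.
  apply: absvD_le; first exact: residues_le1.
  by rewrite absvM mulr_ile1 ?absv_ge0// -(absv1 F) L1.
- move=> _ _ /allpairsP[[a x] [/= aR xL ->]] /allpairsP[[b y] [/= bR yL ->]] /disj[]//.
  by move=> -> ->.
- move=> x; rewrite absv1 => x1; have [a aR] := residues_ex x1.
  rewrite absv_lt1P => xa.
  have [|y yL xy] := Lex ((x - a) / unif F).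
    by rewrite absv1 absv_div ler_pdivrMr// mul1r.
  exists (a + unif F * y); first exact: allpairs_f.
  have -> : x - (a + unif F * y) = unif F * ((x - a) / unif F - y).
    by field; exact: unif_neq0.
  by rewrite absvM exprS absvM ler_pM2l.
Qed.

Lemma ball_reps_ex a n : a != 0 -> exists2 L, size L = (size (residues F) ^ n)%N &
  ball_reps a (a * unif F ^+ n) L.
Proof.
move=> a0; have [L sL [uL L1 Linj Lex]] := ball_reps_unit n.
have aa0 : 0 < absv a by rewrite absv_gt0.
exists [seq a * x | x <- L]; first by rewrite size_map.
split.
- by rewrite map_inj_uniq//; exact: mulfI.
- by move=> _ /mapP[x xL ->]; rewrite absvM ler_piMr ?absv_ge0// -(absv1 F) L1.
- move=> _ _ /mapP[x xL ->] /mapP[y yL ->]; rewrite -mulrBr !absvM ler_pM2l// => h.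
  by rewrite (Linj x y).
- move=> x xa; have [|y yL xy] := Lex (a^-1 * x).
    by rewrite absv1 mulrC absv_div ler_pdivrMr// mul1r.
  exists (a * y); first exact: map_f.
  have -> : x - a * y = a * (a^-1 * x - y) by field.
  by rewrite !absvM ler_pM2l.
Qed.

End ball_representatives.

(** * Compactness and Hensel's lemma *)

Section field_topology.
Context {R : realType} {F : naLocalFieldType R}.
Implicit Types (x y a b c : F).

Lemma nbhs_absvP x (A : set F) :
  nbhs x A <-> exists2 e : R, 0 < e & forall y, absv (x - y) < e -> A y.
Proof.
rewrite -nbhs_entourageE entourage_absv; split=> [[B [e /= e0 eB] BA]|[e e0 eA]].
  exists e => // y xy; apply: BA; apply/xsectionP; exact: eB.
exists [set xy : F * F | absv (xy.1 - xy.2) < e]; first by exists e.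
by move=> y /xsectionP /=; exact: eA.
Qed.

Lemma near_absv x (e : R) : 0 < e -> \forall y \near x, absv (x - y) < e.
Proof. by move=> e0; apply/nbhs_absvP; exists e. Qed.

Lemma open_absvP (A : set F) :
  open A <-> forall x, A x -> exists2 e : R, 0 < e & forall y, absv (x - y) < e -> A y.
Proof. by rewrite openE; split=> h x /h /nbhs_absvP. Qed.

Lemma ultra_seq (T : Type) (I : eqType) (G : set_system T) (L : seq I) (B : I -> set T) :
  UltraFilter G -> G (fun t => exists2 i, i \in L & B i t) ->
  exists2 i, i \in L & G (B i).
Proof.
move=> GU; elim: L => [|i L IH] GB.
  have GP := @ultra_proper _ _ GU; exfalso; apply: (@filter_not_empty _ G _).
  by apply: filterS GB => t [].
have [Gi|Gi] := in_ultra_setVsetC (B i) GU; first by exists i; rewrite ?inE ?eqxx.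
have [|j jL Gj] := IH; last by exists j; rewrite ?inE ?jL ?orbT.
apply: filterS (filterI GB Gi) => t [[j]]; rewrite inE => /orP[/eqP-> //|jL Bj _].
by exists j.
Qed.

(** The ball is totally bounded: at each scale the ultrafilter picks one of finitely many small
    balls, so it is Cauchy. It lives on an arbitrary type, through [h], so that limits of matrices
    can be taken entry by entry. *)
Lemma ultra_absv_lim (T : Type) (G : set_system T) (h : T -> F) a : a != 0 ->
  UltraFilter G -> G [set t | absv (h t) <= absv a] ->
  exists2 l, absv l <= absv a & forall e : R, 0 < e -> G [set t | absv (h t - l) < e].
Proof.
move=> a0 GU Ga; have GP := @ultra_proper _ _ GU.
have small (e : R) : 0 < e -> exists y, G [set t | absv (h t - y) < e].
  move=> e0; have a0' : 0 < absv a by rewrite absv_gt0.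
  have [n hn] := @expr_unif_small R F (e / absv a) (divr_gt0 e0 a0').
  have [L _ [_ _ _ Lex]] := ball_reps_ex n a0.
  have [|y yL Gy] :=
      @ultra_seq _ _ G L (fun y t => absv (h t - y) <= absv (a * unif F ^+ n)) GU.
    by apply: filterS Ga => t /Lex.
  exists y; apply: filterS Gy => t /= /le_lt_trans; apply.
  by rewrite absvM mulrC -ltr_pdivlMr.
have cG : cauchy (h @ G).
  rewrite /cauchy entourage_absv => A [e /= e0 eA].
  have [y Gy] := small e e0.
  exists ([set z | absv (z - y) < e], [set z | absv (z - y) < e]) => //= -[u v] [/= ue ve].
  by apply: eA; apply: (absv_trans_lt ue); rewrite absv_distC.
have [l hl] := absv_complete _ _ cG.
have Gl (e : R) : 0 < e -> G [set t | absv (h t - l) < e].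
  move=> e0; have := hl [set z | absv (l - z) < e] (near_absv l e0).
  rewrite /= /fmap /=; apply: (@filterS _ G) => t /=; rewrite absv_distC//.
exists l => //; have [t [/= ta tl]] : exists t, (([set t | absv (h t) <= absv a] `&`
    [set t | absv (h t - l) < absv a]) t).
  by apply: (@filter_ex _ G GP); apply: filterI => //; apply: Gl; rewrite absv_gt0.
have -> : l = h t - (h t - l) by rewrite opprB addrC subrK.
by apply: absvB_le => //; apply: ltW.
Qed.

Lemma compact_ball a : compact [set x : F | absv x <= absv a].
Proof.
have [->|a0] := eqVneq a 0.
  have -> : [set x : F | absv x <= absv (0 : F)] = [set 0]; last exact: compact_set1.
  apply/seteqP; split=> x /=; last by move->.
  by rewrite absv0 => x0; apply: absv_eq0; apply/le_anti; rewrite x0 absv_ge0.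
rewrite compact_ultra => G GU Ga; have [l la lG] := ultra_absv_lim a0 GU Ga.
exists l; split=> // A /nbhs_absvP[e e0 eA]; apply: filterS (lG _ e0) => t /= te.
by apply: eA; rewrite absv_distC.
Qed.

(** Compactness of the unit ball: the sets of approximate zeros are nested, and a cluster point is
    an exact zero because [h x - h y] is [x - y] times a bounded factor. *)
Lemma quadratic_zero a b c :
  (forall n, exists2 x, absv x <= 1 & absv (a * x ^+ 2 + b * x + c) <= absv (unif F ^+ n)) ->
  exists2 x, absv x <= 1 & a * x ^+ 2 + b * x + c = 0.
Proof.
move=> approx; pose h x := a * x ^+ 2 + b * x + c.
pose D n := [set x : F | absv x <= 1 /\ absv (h x) <= absv (unif F ^+ n)].
have unif_mono m n : (m <= n)%N -> absv (unif F ^+ n) <= absv (unif F ^+ m).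
  move=> mn; rewrite -(subnK mn) exprD absvM ler_piMl ?absv_ge0// absvX.
  by rewrite exprn_ile1 ?absv_ge0 ?unif_le1.
have FF : Filter (filter_from setT D).
  apply: filter_from_filter; first by exists 0%N.
  move=> m n _ _; exists (maxn m n) => // x [x1 hx]; split; split=> //;
    by apply: (le_trans hx); rewrite unif_mono ?leq_maxl ?leq_maxr.
have FP : ProperFilter (filter_from setT D).
  by apply: filter_from_proper => n _; have [x x1 hx] := approx n; exists x.
have := @compact_ball 1 _ FP; rewrite absv1 => /(_ _)[].
  by exists 0%N => // x [].
move=> x [/= x1 xcl]; exists x => //; apply/eqP/negP => /negP; rewrite -/(h x) => hx0.
pose M := Num.max 1 (Num.max (absv a) (absv b)).
have M0 : 0 < M by rewrite /M lt_max ltr01.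
have hx : 0 < absv (h x) by rewrite absv_gt0.
have [n hn] := @expr_unif_small R F _ hx.
have e0 : 0 < Num.min 1 (absv (h x) / M) by rewrite lt_min ltr01 divr_gt0.
have [y [[y1 hy] /=]] := xcl _ _ (ex_intro2 _ _ n I (@subset_refl _ (D n))) (near_absv x e0).
rewrite lt_min => /andP[xy1 xyM].
suff : absv (h x) < absv (h x) by rewrite ltxx.
rewrite -{1}(subrKC (h y) (h x)).
apply: absvD_lt; first exact: le_lt_trans hy hn.
have -> : h x - h y = (x - y) * (a * (x + y) + b) by rewrite /h; ring.
rewrite absvM; apply: (@le_lt_trans _ _ (absv (x - y) * M)).
  rewrite ler_wpM2l ?absv_ge0//; apply: absvD_le; last by rewrite /M !le_max lexx !orbT.
  rewrite absvM; apply: (@le_trans _ _ (absv a)); last by rewrite /M !le_max lexx !orbT.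
  by rewrite ler_piMr ?absv_ge0// absvD_le.
by rewrite -ltr_pdivlMr.
Qed.

Lemma hensel_monic a : absv a < 1 -> exists2 x, absv x <= 1 & 1 + x + a * x ^+ 2 = 0.
Proof.
move=> a1.
suff [x x1 hx] : exists2 x, absv x <= 1 & a * x ^+ 2 + 1 * x + 1 = 0.
  by exists x => //; rewrite -hx; ring.
apply: quadratic_zero; elim => [|n [x x1 hx]].
  exists 0; rewrite ?absv0 ?ler01//.
  by rewrite expr0n/= mulr0 mul1r !add0r expr0.
(* Newton's step with the slope replaced by 1. The new value is [a g (g - 2 x)], smaller than [g] by
   a factor at most [|a|], whatever [|2|] is. *)
pose g := a * x ^+ 2 + 1 * x + 1; exists (x - g).
  have -> : x - g = - (1 + a * x ^+ 2) by rewrite /g; ring.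
  rewrite absvN absvD_le ?absv1// absvM absvX mulr_ile1 ?absv_ge0 ?exprn_ge0 ?(ltW a1)//.
    by rewrite absv_ge0.
  by rewrite exprn_ile1 ?absv_ge0.
have -> : a * (x - g) ^+ 2 + 1 * (x - g) + 1 = a * (g * (g - 2%:R * x)).
  by rewrite {2}/g; ring.
have g1 : absv g <= 1.
  by apply: le_trans hx _; rewrite absvX exprn_ile1 ?absv_ge0 ?unif_le1.
rewrite exprS !absvM; apply: ler_pM; rewrite ?absv_ge0 ?mulr_ge0 ?absv_ge0 ?unif_max//.
apply: le_trans hx; rewrite ler_piMr ?absv_ge0// absvB_le//.
by rewrite absvM mulr_ile1 ?absv_ge0 ?absv_nat.
Qed.

(** The substitution [x = (c / b) y] turns the equation into [1 + y + (a c / b^2) y^2 = 0]. *)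
Lemma hensel_quadratic a b c : absv a * absv c < absv b ^+ 2 ->
  exists x, a * x ^+ 2 + b * x + c = 0.
Proof.
move=> acb; have b0 : b != 0.
  apply: contraTneq acb => ->; rewrite absv0 expr0n/= -leNgt mulr_ge0 ?absv_ge0//.
have [|x _ hx] := @hensel_monic (a * c / b ^+ 2).
  by rewrite absvM absvV absvX absvM ltr_pdivrMr ?mul1r// exprn_gt0// absv_gt0.
exists (c / b * x).
transitivity (c * (1 + x + a * c / b ^+ 2 * x ^+ 2)); last by rewrite hx mulr0.
by field.
Qed.

End field_topology.

(** * Square classes *)

Lemma size_le_fibres2 (T K : eqType) (s : seq T) (L : seq K) (f : T -> K) :
  uniq s -> uniq L -> (forall x, x \in s -> f x \in L) ->
  (forall x y z, x \in s -> y \in s -> z \in s -> f x = f y -> f x = f z ->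
     x != y -> x != z -> y != z -> False) ->
  (size s <= 2 * size L)%N.
Proof.
move=> us uL fL fib.
have -> : size s = (\sum_(y <- L) count (fun x => f x == y) s)%N.
  elim: s {us fib} fL => [|x s IH] fL /=; first by rewrite big1_seq.
  rewrite big_split /= -IH; last by move=> y ys; apply: fL; rewrite inE ys orbT.
  rewrite (bigD1_seq (f x)) ?fL ?inE ?eqxx//=.
  by rewrite big1 ?addn0// => i /negPf; rewrite eq_sym => ->.
have -> : (2 * size L = \sum_(y <- L) 2)%N by rewrite big_const_seq count_predT iter_addn_0.
rewrite big_seq [leqRHS]big_seq; apply: leq_sum => y yL.
rewrite -size_filter.
have : uniq [seq x <- s | f x == y] by rewrite filter_uniq.
have : forall x, x \in [seq x <- s | f x == y] -> x \in s /\ f x = y.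
  by move=> x; rewrite mem_filter => /andP[/eqP].
case: [seq x <- s | f x == y] => [|a [|b [|c l]]] //= mem.
rewrite !inE !negb_or => /andP[/and3P[ab ac _] /andP[/andP[bc _] _]]; exfalso.
have [a1 a2] : a \in s /\ f a = y by apply: mem; rewrite !inE eqxx.
have [b1 b2] : b \in s /\ f b = y by apply: mem; rewrite !inE eqxx orbT.
have [c1 c2] : c \in s /\ f c = y by apply: mem; rewrite !inE eqxx !orbT.
by apply: (fib a b c) => //; rewrite ?a2 ?b2 ?c2.
Qed.

(** The pairs [(v, i)] map to [L] with fibres of at most two elements, so [3 |L| <= 2 |L|]. Both
    index bounds in the residue field, for squares and for an Artin-Schreier map, come down to this
    count. *)
Lemma pigeonhole3 (K : eqType) (L : seq K) (f : K -> nat -> K) : uniq L ->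
  (forall v i, v \in L -> (i < 3)%N -> f v i \in L) ->
  (forall v w i j, v \in L -> w \in L -> (i < j < 3)%N -> f v i <> f w j) ->
  (forall u v w i, u \in L -> v \in L -> w \in L -> (i < 3)%N -> u != v -> u != w ->
     f u i = f v i -> f u i = f w i -> v = w) ->
  L = [::].
Proof.
move=> uL fL f1 f2; apply/eqP; rewrite -size_eq0.
suff : (size L * 3 <= 2 * size L)%N by lia.
have := @size_le_fibres2 _ _ [seq (v, i) | v <- L, i <- iota 0 3] L (fun p => f p.1 p.2).
rewrite size_allpairs size_iota; apply => //.
- by rewrite allpairs_uniq ?iota_uniq// => -[? ?] [? ?].
- by move=> _ /allpairsP[[v i] [vL + ->]]; rewrite mem_iota => i3; apply: fL.
move=> _ _ _ /allpairsP[[u i] [uL' + ->]] /allpairsP[[v j] [vL + ->]]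
  /allpairsP[[w k] [wL + ->]].
rewrite !mem_iota /= => i3 j3 k3 uv uw.
have eqij v1 w1 i1 j1 : v1 \in L -> w1 \in L -> (i1 < 3)%N -> (j1 < 3)%N ->
    f v1 i1 = f w1 j1 -> i1 = j1.
  move=> v1L w1L i13 j13 e; have [ij|ij|//] := ltngtP i1 j1.
  - by exfalso; apply: (f1 v1 w1 i1 j1); rewrite ?ij.
  - by exfalso; apply: (f1 w1 v1 j1 i1); rewrite ?ij.
have ij := eqij _ _ _ _ uL' vL i3 j3 uv; have ik := eqij _ _ _ _ uL' wL i3 k3 uw.
subst j k; rewrite !xpair_eqE !eqxx !andbT => nuv nuw nvw.
by rewrite (f2 u v w i) ?eqxx in nvw.
Qed.

Section square_classes.
Context {R : realType} {F : naLocalFieldType R}.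
Implicit Types (x y u v w b c d : F).

Definition residue x : F := xget 0 [set a | a \in residues F /\ absv (x - a) < 1].

Lemma residueP x : absv x <= 1 -> residue x \in residues F /\ absv (x - residue x) < 1.
Proof.
move=> x1; rewrite /residue; case: xgetP => [y _ //|] none.
by have [a aR xa] := residues_ex x1; have := none a; case.
Qed.

Lemma eq_residue x y : absv x <= 1 -> absv y <= 1 -> residue x = residue y ->
  absv (x - y) < 1.
Proof.
move=> /residueP[_ hx] /residueP[_ hy] e; apply: (absv_trans_lt hx).
by rewrite absv_distC e.
Qed.

Lemma residues_eqP u v : u \in residues F -> v \in residues F ->
  (u != v) = (absv (u - v) == 1).
Proof.
move=> uR vR; apply/idP/idP; last first.
  by apply: contraTneq => ->; rewrite subrr absv0 eq_sym oner_eq0.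
apply: contraNT => h; apply/eqP/residues_inj => //.
by rewrite lt_neqAle h absvB_le//; exact: residues_le1.
Qed.

Lemma absv_mul_lt1 x y : absv x = 1 -> absv (x * y) < 1 -> absv y < 1.
Proof. by rewrite absvM => ->; rewrite mul1r. Qed.

Definition is_square c := exists x, c = x ^+ 2.

(** Even valuation, expressed through the absolute value; 0 counts as even. *)
Definition even_val c := exists x, absv c = absv (x ^+ 2).

Lemma even_val_mul c d : c != 0 -> d != 0 ->
  [\/ even_val c, even_val d | even_val (c * d)].
Proof.
move=> c0 d0; have [k hk] := absv_unif_expz c0; have [l hl] := absv_unif_expz d0.
have u0 := @unif_neq0 R F.
have even (x : F) (m : int) : absv x = absv (unif F ^ (m + m)) -> even_val x.
  by move=> h; exists (unif F ^ m); rewrite h expfzDr.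
have parity (m : int) : (exists j, m = j + j) \/ (exists j, m = j + j + 1).
  case: m => n; have [e|e] := boolP (odd n).
  - by right; exists (n./2)%:Z; lia.
  - by left; exists (n./2)%:Z; lia.
  - by left; exists (- (n.+1./2)%:Z); lia.
  - by right; exists (- (n.+2./2)%:Z); lia.
have [[j kj]|[j kj]] := parity k; first by apply: Or31; apply: (even _ j); rewrite -kj.
have [[i li]|[i li]] := parity l; first by apply: Or32; apply: (even _ i); rewrite -li.
apply: Or33; apply: (even _ (j + i + 1)); rewrite absvM hk hl -absvM -expfzDr//.
by congr (absv (_ ^ _)); lia.
Qed.

Section residue_char2.
Hypothesis two1 : absv (2%:R : F) < 1.

(** Modulo 2 squaring is additive, hence injective on the finite residue field, hence surjective:
    the residue field is perfect. *)
Lemma square_mod_unif u : absv u = 1 -> exists2 v, absv v = 1 & absv (u - v ^+ 2) < 1.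
Proof.
move=> u1; pose sq v := residue (v ^+ 2).
have sq1 v : v \in residues F -> absv (v ^+ 2) <= 1.
  by move=> vR; rewrite absvX exprn_ile1 ?absv_ge0 ?residues_le1.
have sqinj : {in residues F &, injective sq}.
  move=> v w vR wR /eq_residue h; apply: residues_inj => //.
  have {}h := h (sq1 _ vR) (sq1 _ wR).
  rewrite -(@expr_lt1 _ 2) ?absv_ge0// -absvX.
  have -> : (v - w) ^+ 2 = (v ^+ 2 - w ^+ 2) - 2%:R * (w * (v - w)) by ring.
  apply: absvB_lt => //; rewrite absvM; apply: le_lt_trans two1.
  rewrite ler_piMr ?absv_ge0// absvM mulr_ile1 ?absv_ge0//; first exact: residues_le1.
  by apply: absvB_le; exact: residues_le1.
have [_ sqs] : (size [seq sq v | v <- residues F] = size (residues F)) *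
    ([seq sq v | v <- residues F] =i residues F).
  apply: uniq_min_size; rewrite ?size_map//.
  - by rewrite map_inj_in_uniq// residues_uniq.
  - by move=> _ /mapP[v vR ->]; have [] := residueP (sq1 _ vR).
have [] := @residueP u; first by rewrite u1.
rewrite -sqs => /mapP[v vR e] h.
have {}h : absv (u - v ^+ 2) < 1.
  by apply: (absv_trans_lt h); rewrite e absv_distC; have [] := residueP (sq1 _ vR).
exists v => //; apply/eqP; rewrite -(@eqrXn2 _ 2) ?absv_ge0// expr1n -absvX.
by rewrite -u1; apply/eqP/absv_close; rewrite absv_distC u1.
Qed.

End residue_char2.

Section odd_residue_char.
Hypothesis two1 : absv (2%:R : F) = 1.

Lemma square_near1 c : absv c < 1 -> is_square (1 + c).
Proof.
move=> c1; have [|x hx] := @hensel_quadratic R F 1 2%:R (- c).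
  by rewrite absv1 mul1r absvN two1 expr1n.
exists (1 + x); have -> : (1 + x) ^+ 2 = (1 * x ^+ 2 + 2 * x + - c) + (1 + c) by ring.
by rewrite hx add0r.
Qed.

Lemma square_close c d : absv (c - d) < absv d -> is_square d -> is_square c.
Proof.
move=> cd [x dx]; have d0 : d != 0.
  by apply: contraTneq cd => ->; rewrite absv0 -leNgt absv_ge0.
have [|y hy] := @square_near1 ((c - d) / d).
  by rewrite absv_div ltr_pdivrMr ?absv_gt0// mul1r.
by exists (x * y); rewrite exprMn -hy -dx; field.
Qed.

Lemma is_square_div c d : d != 0 -> is_square d -> is_square (c * d) -> is_square c.
Proof.
move=> d0 [x dx] [y cd]; have x0 : x != 0 by apply: contraNneq d0; rewrite dx => ->; rewrite expr0n.
by exists (y / x); rewrite expr_div_n -cd -dx mulfK.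
Qed.

(** Otherwise the residues of the [v^2], of the [c v^2] and of the [d v^2] would form three disjoint
    sets of residue units, each the image of an at most two-to-one map, against [pigeonhole3]. *)
Lemma unit_square_index c d : absv c = 1 -> absv d = 1 ->
  [\/ is_square c, is_square d | is_square (c * d)].
Proof.
move=> c1 d1; apply: contrapT => nS.
have nc : ~ is_square c by move=> h; apply: nS; apply: Or31.
have nd : ~ is_square d by move=> h; apply: nS; apply: Or32.
have ncd : ~ is_square (c * d) by move=> h; apply: nS; apply: Or33.
pose e (i : nat) := nth c [:: 1; c; d] i.
have e1 i : (i < 3)%N -> absv (e i) = 1.
  by case: i => [|[|[|]]]; rewrite ?absv1.
pose L := [seq v <- residues F | absv v == 1].
have L1 v : v \in L -> absv v = 1 by rewrite mem_filter => /andP[/eqP].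
have LR v : v \in L -> v \in residues F by rewrite mem_filter => /andP[].
have ev1 v i : v \in L -> (i < 3)%N -> absv (e i * v ^+ 2) = 1.
  by move=> vL i3; rewrite absvM absvX e1// L1// expr1n mulr1.
suff : L = [::].
  have [] := @residueP 1; first by rewrite absv1.
  move=> rR; rewrite absv_distC -[ltRHS](absv1 F) => /absv_close r1 L0.
  have : residue 1 \in L by rewrite mem_filter rR r1 absv1 eqxx.
  by rewrite L0.
apply: (@pigeonhole3 _ _ (fun v i => residue (e i * v ^+ 2))).
- by rewrite filter_uniq// residues_uniq.
- move=> v i vL i3; have [] := @residueP (e i * v ^+ 2); first by rewrite ev1.
  move=> rR h; rewrite mem_filter rR andbT; apply/eqP; rewrite -(ev1 _ _ vL i3).
  by apply: absv_close; rewrite absv_distC ev1.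
- move=> v w i j vL wL /andP[ij j3] /eq_residue.
  have i3 := ltn_trans ij j3; rewrite !ev1// => /(_ (lexx _) (lexx _)) h.
  have sqij : is_square (e i * e j).
    have v0 : v ^+ 2 != 0 by rewrite expf_neq0// -absv_gt0 L1// ltr01.
    apply: (is_square_div v0); first by exists v.
    apply: (@square_close _ ((e j * w) ^+ 2)); last by exists (e j * w).
    have -> : absv ((e j * w) ^+ 2) = 1.
      by rewrite absvX absvM (e1 j)// (L1 w)// mul1r expr1n.
    have -> : e i * e j * v ^+ 2 - (e j * w) ^+ 2 = e j * (e i * v ^+ 2 - e j * w ^+ 2).
      by ring.
    by rewrite absvM e1// mul1r.
  by case: i j ij j3 sqij {h i3} => [|[|i]] [|[|[|j]]]//=; rewrite ?mul1r.
- move=> u v w i uL vL wL i3; rewrite !residues_eqP ?LR// => /eqP uv /eqP uw.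
  move=> /eq_residue; rewrite !ev1// => /(_ (lexx _) (lexx _)) huv.
  move=> /eq_residue; rewrite !ev1// => /(_ (lexx _) (lexx _)) huw.
  have aux z : z \in L -> absv (u - z) = 1 -> absv (e i * u ^+ 2 - e i * z ^+ 2) < 1 ->
      absv (u + z) < 1.
    move=> zL uz h; apply: (absv_mul_lt1 uz); apply: (absv_mul_lt1 (e1 _ i3)).
    by apply: le_lt_trans h; rewrite le_eqVlt; apply/orP/or_introl/eqP; congr absv; ring.
  apply: residues_inj; rewrite ?LR//.
  have -> : v - w = (u + v) - (u + w) by ring.
  by rewrite absvB_lt// aux.
Qed.

Lemma even_square_index c d : even_val c -> even_val d ->
  [\/ is_square c, is_square d | is_square (c * d)].
Proof.
move=> [x cx] [y dy].
have [x0|x0] := eqVneq x 0.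
  by apply: Or31; exists 0; rewrite expr0n; apply: absv_eq0; rewrite cx x0 expr0n absv0.
have [y0|y0] := eqVneq y 0.
  by apply: Or32; exists 0; rewrite expr0n; apply: absv_eq0; rewrite dy y0 expr0n absv0.
have un (z t : F) : t != 0 -> absv z = absv (t ^+ 2) -> absv (z / t ^+ 2) = 1.
  by move=> t0 h; rewrite absv_div h mulfV// absv_eq0E expf_neq0.
have sqV (z t : F) : t != 0 -> is_square (z / t ^+ 2) -> is_square z.
  by move=> t0 [a ha]; exists (t * a); rewrite exprMn -ha; field.
have [h|h|h] := unit_square_index (un _ _ x0 cx) (un _ _ y0 dy).
- by apply: Or31; apply: sqV h.
- by apply: Or32; apply: sqV h.
- apply: Or33; apply: (sqV _ (x * y)); first by rewrite mulf_neq0.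
  by rewrite exprMn invfM mulrACA.
Qed.

(* The group of square classes has order at most 4. *)
Lemma square_class_dependence b c d : b != 0 -> c != 0 -> d != 0 -> ~ is_square b ->
  [\/ is_square c \/ is_square (b * c), is_square d \/ is_square (b * d) |
      is_square (c * d) \/ is_square (b * (c * d))].
Proof.
move=> b0 c0 d0 nb.
have sqM (z t : F) : t != 0 -> is_square (z * t ^+ 2) -> is_square z.
  by move=> t0; apply: is_square_div; rewrite ?expf_neq0//; exists t.
have [ec|ec] := pselect (even_val c); have [ed|ed] := pselect (even_val d).
- have [h|h|h] := even_square_index ec ed;
    by [apply: Or31; left|apply: Or32; left|apply: Or33; left].
- have [eb|eb] := pselect (even_val b).
    have [//|h|h] := even_square_index eb ec; first by apply: Or31; left.
    by apply: Or31; right.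
  have [//|//|ebd] := even_val_mul b0 d0.
  have [h|h|h] := even_square_index ec ebd; first by apply: Or31; left.
    by apply: Or32; right.
  by apply: Or33; right; rewrite mulrCA.
- have [eb|eb] := pselect (even_val b).
    have [//|h|h] := even_square_index eb ed; first by apply: Or32; left.
    by apply: Or32; right.
  have [//|//|ebc] := even_val_mul b0 c0.
  have [h|h|h] := even_square_index ebc ed; first by apply: Or31; right.
    by apply: Or32; left.
  by apply: Or33; right; rewrite mulrA.
- have [//|//|ecd] := even_val_mul c0 d0.
  have [eb|eb] := pselect (even_val b).
    have [//|h|h] := even_square_index eb ecd; first by apply: Or33; left.
    by apply: Or33; right.
  have [//|//|ebc] := even_val_mul b0 c0.
  have [h|h|h] := even_square_index ecd ebc; first by apply: Or33; left.
    by apply: Or31; right.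
  apply: Or32; right; apply: (sqM _ c) => //.
  by have -> : b * d * c ^+ 2 = c * d * (b * c) by ring.
Qed.

End odd_residue_char.
End square_classes.

(** * The norm form and its values *)

Section norm_form.
Context {R : realType} {F : naLocalFieldType R}.
Variables (s n : F).
Implicit Types (x y u v w b c d t : F).

(** Norm and, below, trace of [x + y tau], for [tau] a root of [X^2 - s X + n]. *)
Definition nform x y := x ^+ 2 + s * x * y + n * y ^+ 2.
Definition tform x y := 2%:R * x + s * y.
Definition is_norm c := exists x y, nform x y = c.

Hypothesis nform_eq0 : forall x y, nform x y = 0 -> x = 0 /\ y = 0.
Hypothesis separable_form : s != 0 \/ (2%:R : F) != 0.

Lemma nformM x y u v :
  nform x y * nform u v = nform (x * u - n * (y * v)) (x * v + y * u + s * (y * v)).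
Proof. by rewrite /nform; ring. Qed.

Lemma nformZ c x y : nform (c * x) (c * y) = c ^+ 2 * nform x y.
Proof. by rewrite /nform; ring. Qed.

Lemma nform_add1 x y : nform (1 + x) y = 1 + tform x y + nform x y.
Proof. by rewrite /nform /tform; ring. Qed.

Lemma is_normM c d : is_norm c -> is_norm d -> is_norm (c * d).
Proof. by move=> [x [y <-]] [u [v <-]]; rewrite nformM; do 2 eexists. Qed.

Lemma is_norm_sqr c : is_norm (c ^+ 2).
Proof. by exists c, 0; rewrite /nform; ring. Qed.

Lemma is_norm_square c : is_square c -> is_norm c.
Proof. by move=> [x ->]; exact: is_norm_sqr. Qed.

Lemma is_norm1 : is_norm 1.
Proof. by rewrite -(expr1n _ 2); exact: is_norm_sqr. Qed.

Lemma is_normV c : is_norm c -> is_norm c^-1.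
Proof.
have [->|c0] := eqVneq c 0; first by rewrite invr0.
move=> nc; have -> : c^-1 = c * c^-1 ^+ 2 by field.
exact/is_normM/is_norm_sqr.
Qed.

Lemma is_norm_mulr c d : d != 0 -> is_norm d -> is_norm (c * d) -> is_norm c.
Proof.
by move=> d0 /is_normV nd ncd; rewrite -(mulfK d0 c); exact: is_normM.
Qed.

Lemma nform_neq0 x y : y != 0 -> nform x y != 0.
Proof. by apply: contraNneq => /nform_eq0[_ ->]. Qed.

(** For [w = x + y tau], the norm of [1 + k w] is [1 + k Tr(w) + k^2 N(w)]. Hensel's lemma solves
    for [k] when the trace dominates. *)
Lemma is_norm_quadratic x y c : absv (nform x y) * absv c < absv (tform x y) ^+ 2 ->
  is_norm (1 + c).
Proof.
rewrite -(absvN c) => /hensel_quadratic[k hk]; exists (1 + k * x), (k * y).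
transitivity (nform x y * k ^+ 2 + tform x y * k + - c + (1 + c)).
  by rewrite /nform /tform; ring.
by rewrite hk add0r.
Qed.

(** The group of norms is open. Separability provides the element of nonzero trace to which
    [is_norm_quadratic] is applied. *)
Lemma is_norm_near1 : exists2 e : R, 0 < e & forall c, absv (1 - c) < e -> is_norm c.
Proof.
have [x [y t0]] : exists x y, tform x y != 0.
  case: separable_form => h; first by exists 0, 1; rewrite /tform mulr0 add0r mulr1.
  by exists 1, 0; rewrite /tform mulr0 addr0 mulr1.
have n0 : nform x y != 0.
  apply: contraNneq t0 => /nform_eq0[-> ->]; rewrite /tform !mulr0 addr0 //.
have an0 : 0 < absv (nform x y) by rewrite absv_gt0.
exists (absv (tform x y) ^+ 2 / absv (nform x y)).
  by rewrite divr_gt0// exprn_gt0// absv_gt0.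
move=> c; rewrite ltr_pdivlMr// mulrC absv_distC => /is_norm_quadratic.
by rewrite subrKC.
Qed.

Lemma nform_unit_bound (a b c : F) : (forall x, a * x ^+ 2 + b * x + c != 0) ->
  exists2 k : R, 0 < k & forall x, absv x <= 1 -> k <= absv (a * x ^+ 2 + b * x + c).
Proof.
move=> nz; apply: contrapT => H.
suff [x _ hx] : exists2 x, absv x <= 1 & a * x ^+ 2 + b * x + c = 0.
  by have := nz x; rewrite hx eqxx.
apply: quadratic_zero => m; apply: contrapT => Hm; apply: H.
exists (absv (unif F ^+ m)); first by rewrite absv_gt0 expf_neq0 ?unif_neq0.
by move=> x x1; rewrite leNgt; apply/negP => h; apply: Hm; exists x => //; exact: ltW.
Qed.

(** Dividing by the larger coordinate reduces to a polynomial without zero on the unit ball, which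
    is bounded below by compactness. This quantitative anisotropy gives the compactness of subsets
    of the coset space. *)
Lemma nform_bound : exists2 k : R, 0 < k & forall x y,
  k * absv x ^+ 2 <= absv (nform x y) /\ k * absv y ^+ 2 <= absv (nform x y).
Proof.
have [|k k0 hk] := @nform_unit_bound 1 s n.
  move=> x; have := @nform_neq0 x 1 (oner_neq0 _); rewrite /nform.
  by rewrite mul1r expr1n !mulr1.
have [|l l0 hl] := @nform_unit_bound n s 1.
  move=> x; apply/eqP => h; have [|/eqP] := @nform_eq0 1 x; last by rewrite oner_eq0.
  by rewrite -h /nform; ring.
exists (Num.min k l); first by rewrite lt_min k0.
have kn : 0 <= Num.min k l by rewrite le_min !ltW.
move=> x y.
suff : (exists2 z : F, absv x <= absv z /\ absv y <= absv z &
    Num.min k l * absv z ^+ 2 <= absv (nform x y)).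
  move=> [z [xz yz] h]; split; apply: le_trans h; rewrite ler_wpM2l//;
    by rewrite lerXn2r ?nnegrE ?absv_ge0.
have [xy|xy] := leP (absv x) (absv y).
  exists y; first by [].
  have [y0|y0] := eqVneq y 0; first by rewrite y0 absv0 expr0n mulr0 absv_ge0.
  have -> : nform x y = (1 * (x / y) ^+ 2 + s * (x / y) + n) * y ^+ 2.
    by rewrite /nform; field.
  rewrite absvM absvX ler_wpM2r ?exprn_ge0 ?absv_ge0//.
  by rewrite ge_min hk// absv_div ler_pdivrMr ?absv_gt0// mul1r.
have x0 : x != 0 by rewrite -absv_gt0 (le_lt_trans _ xy)// absv_ge0.
exists x; first by split=> //; exact: ltW.
have -> : nform x y = (n * (y / x) ^+ 2 + s * (y / x) + 1) * x ^+ 2.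
  by rewrite /nform; field.
rewrite absvM absvX ler_wpM2r ?exprn_ge0 ?absv_ge0//.
by rewrite ge_min hl ?orbT// absv_div ler_pdivrMr ?absv_gt0// mul1r ltW.
Qed.

(** * Index of the norms when the residue characteristic is 2 *)

Section residue_char2.
Hypothesis two1 : absv (2%:R : F) < 1.

Lemma absv_mul2_lt x y : absv x <= absv y -> y != 0 -> absv (2%:R * x) < absv y.
Proof.
move=> xy y0; rewrite absvM; apply: (@le_lt_trans _ _ (absv (2%:R : F) * absv y)).
  by rewrite ler_wpM2l ?absv_ge0.
by rewrite gtr_pMl ?absv_gt0.
Qed.

(** The unramified case. Descent on [x] produces an element [x + tau] whose norm is at most the
    square of its trace; then [is_norm_quadratic] makes every [1 + c] with [|c| < 1] a norm, and an
    element of even valuation is a square times such a [1 + c]. *)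
Lemma even_norm_unramified : (forall x y, even_val (nform x y)) ->
  forall c, even_val c -> is_norm c.
Proof.
move=> ev.
have [k k0 hk] := nform_bound.
have [||x _ hx] := @absv_descent R F F (fun x => nform x 1) (fun=> True)
    (fun x => absv (nform x 1) <= absv (tform x 1) ^+ 2) k k0 _ _ 0 I.
- by move=> x _; have [_] := hk x 1; rewrite absv1 expr1n mulr1.
- move=> x _; have [|lt] := leP; [by left|right].
  have N0 := @nform_neq0 x 1 (oner_neq0 _).
  have [w hw] := ev x 1.
  have w0 : w != 0.
    by apply: contraNneq N0 => w0; rewrite -absv_eq0E hw w0 expr0n absv0.
  have w20 : w ^+ 2 != 0 by rewrite expf_neq0.
  have [|v v1 hv] := square_mod_unif two1 (u := nform x 1 / w ^+ 2).
    by rewrite absv_div hw mulfV// absv_eq0E.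
  (* Here [(v w)^2] approximates the norm. As 2 is small, shifting [x] by [v w] cancels the leading
     term; what remains is small because the square of the trace is smaller than the norm. *)
  exists (x - v * w) => //.
  have -> : nform (x - v * w) 1 = - (w ^+ 2 * (nform x 1 / w ^+ 2 - v ^+ 2)) +
      2%:R * nform x 1 - v * w * tform x 1.
    by rewrite mulrBr mulrCA mulfV// mulr1 /nform /tform; ring.
  apply: absvB_lt; first apply: absvD_lt.
  + by rewrite absvN absvM -hw gtr_pMr// absv_gt0.
  + exact: absv_mul2_lt.
  + rewrite !absvM v1 mul1r hw expr2 absvM ltr_pM2l ?absv_gt0//.
    by rewrite -(@ltr_pXn2r _ 2) ?nnegrE ?absv_ge0// -[ltRHS]absvX -hw.
have N0 := @nform_neq0 x 1 (oner_neq0 _).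
have near1 c : absv c < 1 -> is_norm (1 + c).
  move=> c1; apply: (@is_norm_quadratic x 1).
  by apply: lt_le_trans hx; rewrite gtr_pMr// absv_gt0.
move=> c [w hw]; have [c0|c0] := eqVneq c 0.
  by rewrite c0; exists 0, 0; rewrite /nform; ring.
have w0 : w != 0 by apply: contraNneq c0 => w0; rewrite -absv_eq0E hw w0 expr0n absv0.
have w20 : w ^+ 2 != 0 by rewrite expf_neq0.
have [|v v1 hv] := square_mod_unif two1 (u := c / w ^+ 2).
  by rewrite absv_div hw mulfV// absv_eq0E.
have v0 : v != 0 by rewrite -absv_gt0 v1 ltr01.
have -> : c = (v * w) ^+ 2 * (1 + (c / w ^+ 2 - v ^+ 2) / v ^+ 2).
  by field; rewrite v0.
apply: is_normM; first exact: is_norm_sqr.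
by apply: near1; rewrite absv_div absvX v1 expr1n divr1.
Qed.

(** A norm of odd valuation together with the squares gives norms of every valuation, and squares of
    units give every residue. *)
Lemma norm_close_ramified : (exists x y, ~ even_val (nform x y)) ->
  forall c, c != 0 -> exists x y, absv (c - nform x y) < absv c.
Proof.
move=> [x [y odd]] c c0.
have N0 : nform x y != 0.
  by apply: contra_not_neq odd => ->; exists 0; rewrite expr0n.
suff [d [nd cd]] : exists d, is_norm d /\ absv c = absv d.
  have d0 : d != 0 by rewrite -absv_gt0 -cd absv_gt0.
  have [|v v1 hv] := square_mod_unif two1 (u := c / d).
    by rewrite absv_div cd mulfV// absv_eq0E.
  have [u [w e]] := is_normM nd (is_norm_sqr v).
  exists u, w; rewrite e; have -> : c - d * v ^+ 2 = d * (c / d - v ^+ 2) by field.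
  by rewrite absvM cd gtr_pMr// absv_gt0.
have [[w hw]|//|[w hw]] := even_val_mul c0 N0.
  by exists (w ^+ 2); split=> //; exact: is_norm_sqr.
exists (w ^+ 2 * (nform x y)^-1); split.
  by apply: is_normM; [exact: is_norm_sqr|apply: is_normV; do 2 eexists].
by rewrite absvM -hw -absvM mulfK.
Qed.

(** A non-norm is corrected by norms until its defect [t] can no longer be reduced. The descent is
    bounded because [1 + t] is a norm for small [t]; it stops when the trace of an element with norm
    close to [t] is at least as large as [t]. *)
Lemma nonnorm_defect : (exists x y, ~ even_val (nform x y)) ->
  forall c, c != 0 -> ~ is_norm c -> exists d t x y,
  [/\ c = d * (1 + t), is_norm d, t != 0, absv t < 1 &
      absv (t - nform x y) < absv t /\ absv t <= absv (tform x y)].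
Proof.
move=> odd c c0 nc; have close := norm_close_ramified odd.
have [e e0 he] := is_norm_near1.
pose S t := absv t < 1 /\ exists2 d, is_norm d & c = d * (1 + t).
have [x [y cxy]] := close c c0.
have axy : absv (nform x y) = absv c by apply: absv_close; rewrite absv_distC.
have nxy0 : nform x y != 0 by rewrite -absv_gt0 axy absv_gt0.
have St : S ((c - nform x y) / nform x y).
  split; first by rewrite absv_div axy ltr_pdivrMr ?absv_gt0// mul1r.
  by exists (nform x y); [do 2 eexists|field].
have Se t : S t -> e <= absv t.
  move=> [t1 [d nd cd]]; rewrite leNgt; apply/negP => te; apply: nc; rewrite cd.
  by apply: is_normM => //; apply: he; rewrite opprD addrA subrr add0r absvN.
have [|t [t1 [d nd cd]] [u [v [h1 h2]]]] := @absv_descent R F F id S (fun t =>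
    exists x y, absv (t - nform x y) < absv t /\ absv t <= absv (tform x y)) e e0 Se _ _ St.
  move=> t S_t; have [t1 [d nd cd]] := S_t.
  have t0 : t != 0 by rewrite -absv_gt0 (lt_le_trans e0)// Se.
  have [u [v huv]] := close t t0.
  have [h|h] := leP (absv t) (absv (tform u v)); first by left; exists u, v.
  right.
  have auv : absv (nform u v) = absv t by apply: absv_close; rewrite absv_distC.
  have N1 : absv (nform (1 + u) v) = 1.
    rewrite nform_add1 -addrA absv_1D// absvD_lt ?auv//; exact: lt_trans t1.
  have N0 : nform (1 + u) v != 0 by rewrite -absv_gt0 N1 ltr01.
  have lt : absv ((t - nform u v - tform u v) / nform (1 + u) v) < absv t.
    by rewrite absv_div N1 divr1 absvB_lt.
  (* Dividing [1 + t] by the norm [1 + tform u v + nform u v] leaves this defect, in which both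
     [t - nform u v] and the trace are smaller than [t]. *)
  exists ((t - nform u v - tform u v) / nform (1 + u) v) => //.
  split; first exact: lt_trans lt t1.
  exists (d * nform (1 + u) v); first by apply: is_normM => //; do 2 eexists.
  by rewrite cd -mulrA; congr (_ * _); rewrite nform_add1 in N0 *; field.
exists d, t, u, v; split=> //; rewrite -absv_gt0 (lt_le_trans e0)// Se//.
by split=> //; exists d.
Qed.

(** Over the residue field, where 2 = 0, the map [v -> a v^2 + b v] is additive with a kernel of at
    most two elements. Its image has index at most 2, hence contains one of [1], [e], [1 + e]. *)
Lemma artin_schreier_index (a b e : F) : absv a = 1 -> absv b = 1 -> absv e <= 1 ->
  exists2 v, absv v <= 1 & [\/ absv (a * v ^+ 2 + b * v - 1) < 1,
     absv (a * v ^+ 2 + b * v - e) < 1 | absv (a * v ^+ 2 + b * v - (1 + e)) < 1].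
Proof.
move=> a1 b1 e1; apply: contrapT => nS.
pose f v := a * v ^+ 2 + b * v.
have no v z : absv v <= 1 -> [\/ z = 1, z = e | z = 1 + e] -> ~ absv (f v - z) < 1.
  by move=> v1 [] -> h; apply: nS; exists v => //;
    [apply: Or31|apply: Or32|apply: Or33].
(* If none of the three values were attained, the translates of the image by 0, 1 and [e] would be
   disjoint. *)
pose ee (i : nat) := nth e [:: 0; 1; e] i.
have ee1 i : absv (ee i) <= 1.
  case: i => [|[|i]]; rewrite /ee /= ?absv0 ?absv1 ?ler01//.
  by case: i => [|i]//=; rewrite nth_nil.
have f1 v : v \in residues F -> absv (f v) <= 1.
  move=> /residues_le1 v1; rewrite absvD_le// absvM ?a1 ?b1 mul1r// absvX.
  by rewrite exprn_ile1 ?absv_ge0.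
have fe1 v i : v \in residues F -> absv (f v + ee i) <= 1.
  by move=> vR; rewrite absvD_le ?f1.
have two (z : F) : absv z <= 1 -> absv (2%:R * z) < 1.
  by move=> z1; rewrite absvM; apply: le_lt_trans two1; rewrite ler_piMr ?absv_ge0.
suff L0 : residues F = [::].
  by have [] := @residueP R F 0; rewrite ?absv0 ?ler01// L0.
apply: (@pigeonhole3 _ _ (fun v i => residue (f v + ee i))).
- exact: residues_uniq.
- by move=> v i vR _; have [] := residueP (fe1 v i vR).
- move=> v w i j vR wR /andP[ij j3] /eq_residue h.
  have {}h := h (fe1 _ _ vR) (fe1 _ _ wR).
  have vw1 : absv (v - w) <= 1 by apply: absvB_le; exact: residues_le1.
  have w1 := residues_le1 wR; have v1 := residues_le1 vR.
  have {}h : absv (f (v - w) - (ee j - ee i)) < 1.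
    have -> : f (v - w) - (ee j - ee i) = (f v + ee i - (f w + ee j)) -
        2%:R * (a * w * (v - w)) by rewrite /f; ring.
    by rewrite absvB_lt// two// !absvM a1 mul1r mulr_ile1 ?absv_ge0.
  move: h; case: i j ij j3 => [|[|i]] [|[|[|j]]] //= _ _; rewrite /ee /= ?subr0.
  + by apply: no => //; apply: Or31.
  + by apply: no => //; apply: Or32.
  + move=> h; apply: (@no (v - w) (1 + e)) => //; first exact: Or33.
    have -> : f (v - w) - (1 + e) = f (v - w) - (e - 1) - 2%:R * 1 by ring.
    by rewrite absvB_lt// two// absv1.
- move=> u v w i uR vR wR _; rewrite !residues_eqP// => /eqP uv /eqP uw.
  move=> /(eq_residue (fe1 _ _ uR) (fe1 _ _ vR)) huv.
  move=> /(eq_residue (fe1 _ _ uR) (fe1 _ _ wR)) huw.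
  have aux z : absv (u - z) = 1 -> absv (f u + ee i - (f z + ee i)) < 1 ->
      absv (a * (u + z) + b) < 1.
    move=> uz h; apply: (absv_mul_lt1 uz).
    by have -> : (u - z) * (a * (u + z) + b) = f u + ee i - (f z + ee i) by rewrite /f; ring.
  apply: residues_inj => //; apply: (absv_mul_lt1 a1).
  have -> : a * (v - w) = (a * (u + v) + b) - (a * (u + w) + b) by ring.
  by rewrite absvB_lt// aux.
Qed.

(** Two non-norms have irreducible defects [t1] and [t2] of the same size, that of the trace of an
    element [w] with norm close to [t1]. Comparing with the norms of [1 + v w] becomes an
    Artin-Schreier equation in [v] over the residue field. *)
Lemma norm_index_ramified : (exists x y, ~ even_val (nform x y)) ->
  forall c1 c2, c1 != 0 -> c2 != 0 -> [\/ is_norm c1, is_norm c2 | is_norm (c1 * c2)].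
Proof.
move=> odd c1 c2 c10 c20.
have [|n1] := pselect (is_norm c1); first by move=> ?; apply: Or31.
have [|n2] := pselect (is_norm c2); first by move=> ?; apply: Or32.
apply: Or33.
have [d1 [t1 [x1 [y1 [e1 nd1 t10 t11 [close1 tr1]]]]]] := nonnorm_defect odd c10 n1.
have [d2 [t2 [x2 [y2 [e2 nd2 t20 t21 [close2 tr2]]]]]] := nonnorm_defect odd c20 n2.
have {}n1 : ~ is_norm (1 + t1) by move=> h; apply: n1; rewrite e1; exact: is_normM.
have {}n2 : ~ is_norm (1 + t2) by move=> h; apply: n2; rewrite e2; exact: is_normM.
have N1 : absv (nform x1 y1) = absv t1 by apply: absv_close; rewrite absv_distC.
have N2 : absv (nform x2 y2) = absv t2 by apply: absv_close; rewrite absv_distC.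
have at10 : 0 < absv t1 by rewrite absv_gt0.
have at20 : 0 < absv t2 by rewrite absv_gt0.
have bound x y t u : ~ is_norm (1 + u) -> absv (nform x y) = absv t ->
    absv (tform x y) ^+ 2 <= absv t * absv u.
  by move=> nu <-; rewrite leNgt; apply/negP => /is_norm_quadratic.
have sq x y t : absv t <= absv (tform x y) -> absv t * absv t <= absv (tform x y) ^+ 2.
  by move=> h; rewrite expr2 ler_pM ?absv_ge0.
(* Failure of [is_norm_quadratic] for either non-norm bounds the squared trace from above,
   irreducibility bounds it from below; the two sizes are squeezed together. *)
have t12 : absv t1 = absv t2.
  apply/le_anti/andP; split.
    by rewrite -(ler_pM2l at10) (le_trans (sq _ _ _ tr1))// bound.
  by rewrite -(ler_pM2l at20) (le_trans (sq _ _ _ tr2))// bound.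
have T1 : absv (tform x1 y1) = absv t1.
  apply/le_anti; rewrite tr1 andbT -(@ler_pXn2r _ 2) ?nnegrE ?absv_ge0//.
  by rewrite [leRHS]expr2 bound.
have [|||v v1 hv] := @artin_schreier_index (nform x1 y1 / t1) (tform x1 y1 / t1) (t2 / t1).
- by rewrite absv_div N1 mulfV// gt_eqF.
- by rewrite absv_div T1 mulfV// gt_eqF.
- by rewrite absv_div t12 mulfV// gt_eqF.
(* If the Artin-Schreier map takes the value [e] at [v], dividing [1 + t] by the norm of [1 + v w]
   leaves an error below [|t1|], which [is_norm_quadratic] absorbs. *)
have key e t : absv (t - t1 * e) < absv t1 -> absv (nform x1 y1 / t1 * v ^+ 2 +
    tform x1 y1 / t1 * v - e) < 1 -> is_norm (1 + t).
  move=> te h.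
  have vN : absv (nform (v * x1) (v * y1)) <= absv t1.
    rewrite nformZ absvM N1 ler_piMl ?absv_ge0// absvX exprn_ile1 ?absv_ge0//.
  have vT : absv (tform (v * x1) (v * y1)) <= absv t1.
    have -> : tform (v * x1) (v * y1) = v * tform x1 y1 by rewrite /tform; ring.
    by rewrite absvM T1 ler_piMl ?absv_ge0.
  have U1 : absv (nform (1 + v * x1) (v * y1)) = 1.
    by rewrite nform_add1 -addrA absv_1D// (le_lt_trans (absvD_le vT vN)).
  have U0 : nform (1 + v * x1) (v * y1) != 0 by rewrite -absv_gt0 U1 ltr01.
  have -> : 1 + t = nform (1 + v * x1) (v * y1) *
      (1 + (t - tform (v * x1) (v * y1) - nform (v * x1) (v * y1)) /
        nform (1 + v * x1) (v * y1)).
    by rewrite mulrDr mulrCA mulfV// nform_add1; ring.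
  apply: is_normM; first by do 2 eexists.
  apply: (@is_norm_quadratic x1 y1); rewrite T1 N1 expr2 ltr_pM2l//.
  rewrite absv_div U1 divr1.
  have -> : t - tform (v * x1) (v * y1) - nform (v * x1) (v * y1) = (t - t1 * e) -
      t1 * (nform x1 y1 / t1 * v ^+ 2 + tform x1 y1 / t1 * v - e).
    by rewrite nformZ /tform; field.
  by apply: absvB_lt => //; rewrite absvM gtr_pMr.
case: hv => hv.
- by exfalso; apply: n1; apply: (key 1) => //; rewrite mulr1 subrr absv0.
- by exfalso; apply: n2; apply: (key (t2 / t1)) => //; rewrite mulrCA mulfV// mulr1 subrr absv0.
- rewrite e1 e2 mulrACA; apply: is_normM; first exact: is_normM.
  have -> : (1 + t1) * (1 + t2) = 1 + (t1 + t2 + t1 * t2) by ring.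
  apply: (key (1 + t2 / t1)) => //.
  have -> : t1 + t2 + t1 * t2 - t1 * (1 + t2 / t1) = t1 * t2 by field.
  by rewrite absvM gtr_pMr.
Qed.

End residue_char2.

(** * Index of the norms when the residue characteristic is odd *)

Section odd_residue_char.
Hypothesis two1 : absv (2%:R : F) = 1.

(** If all norms were squares, completing the square would turn the norm form into [x^2 + y^2], so
    sums of two squares would be squares, and vanish only trivially. By induction all natural
    numbers would be squares. *)
Lemma nonsquare_norm : exists b, [/\ b != 0, is_norm b & ~ is_square b].
Proof.
apply: contrapT => H.
have two0 : (2%:R : F) != 0 by rewrite -absv_gt0 two1 ltr01.
have sq x y : is_square (nform x y).
  have [->|N0] := eqVneq (nform x y) 0; first by exists 0; rewrite expr0n.
  by apply: contrapT => nsq; apply: H; exists (nform x y); split=> //; do 2 eexists.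
have [m hm] := sq (- (s / 2%:R)) 1.
have m0 : m != 0.
  apply: contraTneq (oner_neq0 F) => m0; apply/negP => /(nform_neq0 (- (s / 2%:R))).
  by rewrite hm m0 expr0n eqxx.
have nE x y : nform (x - s / 2%:R * (y / m)) (y / m) = x ^+ 2 + y ^+ 2.
  have -> : y ^+ 2 = m ^+ 2 * (y / m) ^+ 2 by rewrite -exprMn mulrCA mulfV// mulr1.
  have sh : s = 2%:R * (s / 2%:R) by rewrite mulrC divfK.
  by rewrite -hm /nform; move: (s / 2%:R) (y / m) sh => h z ->; ring.
have sumsq x y : is_square (x ^+ 2 + y ^+ 2) by rewrite -nE.
have sum0 x y : x ^+ 2 + y ^+ 2 = 0 -> y = 0.
  rewrite -nE => /nform_eq0[_ /eqP]; rewrite mulf_eq0 invr_eq0 (negPf m0) orbF.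
  by move=> /eqP.
have natsq k : is_square (k%:R : F).
  elim: k => [|k [x hx]]; first by exists 0; rewrite expr0n.
  by have := sumsq x 1; rewrite expr1n -hx natr1.
(* Two natural numbers have the same residue, and [k] is their difference. Then [k - 1] and [1 - k]
   are both squares, the latter by Hensel's lemma, and their sum is zero. *)
have [k k0 kpi] : exists2 k, (0 < k)%N & absv (k%:R : F) < 1.
  have [i [j [ij e]]] : exists i j, (i < j)%N /\ residue (i%:R : F) = residue j%:R.
    pose L := [seq residue (i%:R : F) | i <- iota 0 (size (residues F)).+1].
    have : ~~ uniq L.
      apply/negP => uL.
      have : (size L <= size (residues F))%N.
        apply: uniq_leq_size => // _ /mapP[i _ ->].
        by have [] := @residueP R F i%:R (absv_nat _).
      by rewrite size_map size_iota ltnn.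
    move=> /(uniqPn 0)[i [j [ij]]]; rewrite size_map size_iota => jn.
    have iN := ltn_trans ij jn.
    rewrite !(nth_map 0%N) ?size_iota// !nth_iota// => e.
    by exists i, j.
  exists (j - i)%N; first by rewrite subn_gt0.
  rewrite natrB ?(ltnW ij)// absv_distC; apply: eq_residue e; exact: absv_nat.
have [x hx] := natsq k.-1.
have [|y hy] := @square_near1 R F two1 (- (k%:R)); first by rewrite absvN.
have := @sum0 x y; rewrite -hx -hy.
have -> : (k.-1)%:R + (1 - k%:R) = 0 :> F.
  by case: k k0 {kpi hx hy} => // k _; rewrite -natr1 /=; ring.
move=> /(_ erefl) y0.
move: hy; rewrite y0 expr0n => /eqP; rewrite subr_eq0 => /eqP k1.
by move: kpi; rewrite -k1 absv1 ltxx.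
Qed.

(** Modulo squares there are at most four classes, and the nonsquare norm [b] generates a subgroup
    of order 2 made of norms. *)
Lemma norm_index_odd c1 c2 : c1 != 0 -> c2 != 0 ->
  [\/ is_norm c1, is_norm c2 | is_norm (c1 * c2)].
Proof.
move=> c10 c20; have [b [b0 nb nsb]] := nonsquare_norm.
have step c : is_square c \/ is_square (b * c) -> is_norm c.
  case=> [/is_norm_square//|/is_norm_square]; rewrite mulrC; exact: is_norm_mulr.
by have [/step|/step|/step] := square_class_dependence two1 b0 c10 c20 nsb;
  [exact: Or31|exact: Or32|exact: Or33].
Qed.

End odd_residue_char.

Theorem norm_index c1 c2 : c1 != 0 -> c2 != 0 ->
  [\/ is_norm c1, is_norm c2 | is_norm (c1 * c2)].
Proof.
move=> c10 c20; have := @absv_nat R F 2; rewrite le_eqVlt => /orP[/eqP two1|two1].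
  exact: norm_index_odd.
have [odd|even] := pselect (exists x y, ~ even_val (nform x y)).
  exact: norm_index_ramified.
have ev x y : even_val (nform x y) by apply: contrapT => h; apply: even; exists x, y.
have nev := even_norm_unramified two1 ev.
by have [/nev|/nev|/nev] := even_val_mul c10 c20;
  [exact: Or31|exact: Or32|exact: Or33].
Qed.

End norm_form.

(** * Matrix entries and the topology of SL(2) *)

Section SL2_coordinates.
Context {A : comNzRingType}.
Implicit Types (a b c d : A) (x y : SL2 A).

Lemma sum_ord2 (V : nmodType) (f : 'I_2 -> V) : \sum_(i < 2) f i = f 0 + f 1.
Proof.
rewrite !big_ord_recl big_ord0 addr0; congr (f _ + f _); exact: val_inj.
Qed.

Lemma ord2P (P : 'I_2 -> Prop) : P 0 -> P 1 -> forall i, P i.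
Proof.
move=> P0 P1; case=> -[|[|//]] i2.
  by have -> : Ordinal i2 = 0 by exact: val_inj.
by have -> : Ordinal i2 = 1 by exact: val_inj.
Qed.

Lemma ord2_min_ex (R : realType) (P : 'I_2 -> 'I_2 -> R -> Prop) :
  (forall i j, exists2 e, 0 < e & P i j e) ->
  exists2 e, 0 < e & forall i j, exists2 e', e <= e' & P i j e'.
Proof.
move=> h; pose e i j := s2val (cid2 (h i j)).
have e0 i j : 0 < e i j by rewrite /e; case: cid2.
have eP i j : P i j (e i j) by rewrite /e; case: cid2.
exists (Num.min (Num.min (e 0 0) (e 0 1)) (Num.min (e 1 0) (e 1 1))).
  by rewrite !lt_min !e0.
by do 2 apply: ord2P; eexists; try exact: eP; rewrite !ge_min !lexx ?orbT.
Qed.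

Definition mx2 a b c d : 'M[A]_2 :=
  \matrix_(i, j) if i == 0 then (if j == 0 then a else b) else (if j == 0 then c else d).

Lemma mx2E a b c d :
  (mx2 a b c d 0 0 = a) * (mx2 a b c d 0 1 = b) *
  ((mx2 a b c d 1 0 = c) * (mx2 a b c d 1 1 = d)).
Proof. by rewrite !mxE. Qed.

Lemma mx2P (M N : 'M[A]_2) : M 0 0 = N 0 0 -> M 0 1 = N 0 1 -> M 1 0 = N 1 0 ->
  M 1 1 = N 1 1 -> M = N.
Proof. by move=> e1 e2 e3 e4; apply/matrixP; do 2 apply: ord2P => //. Qed.

Lemma det_mx2 (M : 'M[A]_2) : \det M = M 0 0 * M 1 1 - M 0 1 * M 1 0.
Proof.
rewrite (expand_det_row _ 0) sum_ord2 /cofactor !det_mx11 !mxE /=.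
rewrite expr0 expr1 mul1r mulN1r mulrN; congr (_ * M _ _ - _ * M _ _); exact: val_inj.
Qed.

(** The value is the identity when the determinant is not 1. *)
Definition sl2 a b c d : SL2 A := insubd (SL2_one A) (mx2 a b c d).

Lemma sl2E a b c d : a * d - b * c = 1 -> slmx (sl2 a b c d) = mx2 a b c d.
Proof.
move=> h; rewrite -[slmx _]/(val _) /sl2 insubdK//.
by rewrite unfold_in /= det_mx2 !mx2E h.
Qed.

Lemma SL2P x y : x 0 0 = y 0 0 -> x 0 1 = y 0 1 -> x 1 0 = y 1 0 -> x 1 1 = y 1 1 ->
  x = y.
Proof. by move=> *; apply: val_inj; exact: mx2P. Qed.

Lemma SL2_det x : x 0 0 * x 1 1 - x 0 1 * x 1 0 = 1.
Proof. by rewrite -det_mx2 det_slmx. Qed.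

Lemma SL2_mulE x y i j : (x * y)%g i j = x i 0 * y 0 j + x i 1 * y 1 j.
Proof. by rewrite [LHS]mxE sum_ord2. Qed.

Lemma SL2_oneE : ((1%g : SL2 A) 0 0 = 1) * ((1%g : SL2 A) 0 1 = 0) *
  (((1%g : SL2 A) 1 0 = 0) * ((1%g : SL2 A) 1 1 = 1)).
Proof. by rewrite !mxE. Qed.

Lemma SL2_invE x : (x^-1%g 0 0 = x 1 1) * (x^-1%g 0 1 = - x 0 1) *
  ((x^-1%g 1 0 = - x 1 0) * (x^-1%g 1 1 = x 0 0)).
Proof.
have h : x 1 1 * x 0 0 - - x 0 1 * - x 1 0 = 1 by rewrite mulrNN mulrC (mulrC (x 0 1)) [x 1 0 * _]mulrC SL2_det.
have -> : x^-1%g = sl2 (x 1 1) (- x 0 1) (- x 1 0) (x 0 0).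
  apply: (mulIg x); rewrite mulVg; apply: SL2P; rewrite SL2_mulE !SL2_oneE sl2E// !mx2E.
  - by rewrite -(SL2_det x); ring.
  - by ring.
  - by ring.
  - by rewrite -(SL2_det x); ring.
by rewrite sl2E// !mx2E.
Qed.

Definition weyl : SL2 A := sl2 0 1 (- 1) 0.
Definition lowu a : SL2 A := sl2 1 0 a 1.

Lemma weylE : (weyl 0 0 = 0) * (weyl 0 1 = 1) * ((weyl 1 0 = - 1) * (weyl 1 1 = 0)).
Proof. by rewrite sl2E ?mx2E//; ring. Qed.

Lemma lowuE a : (lowu a 0 0 = 1) * (lowu a 0 1 = 0) * ((lowu a 1 0 = a) * (lowu a 1 1 = 1)).
Proof. by rewrite sl2E ?mx2E//; ring. Qed.

Lemma unipE a : (unip a 0 0 = 1) * (unip a 0 1 = a) * ((unip a 1 0 = 0) * (unip a 1 1 = 1)).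
Proof.
pose B : 'M[A]_(1 + 1) := block_mx 1%:M a%:M 0 1%:M.
have e0 : (0 : 'I_2) = lshift 1 (0 : 'I_1) by exact: val_inj.
have e1 : (1 : 'I_2) = rshift 1 (0 : 'I_1) by exact: val_inj.
have h i j k l : i = k -> j = l -> unip a i j = B k l by move=> -> ->.
by rewrite (h _ _ _ _ e0 e0) (h _ _ _ _ e0 e1) (h _ _ _ _ e1 e0) (h _ _ _ _ e1 e1)
  /B block_mxEul block_mxEur block_mxEdl block_mxEdr !mxE.
Qed.

End SL2_coordinates.

Section SL2_topology.
Context {R : realType} {F : naLocalFieldType R}.
Implicit Types (x y z : SL2 F) (k : SL2 (valring F)).

Lemma nbhs_initialP (S : choiceType) (T : topologicalType) (f : S -> T)
    (x : initial_topology f) (B : set S) :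
  nbhs x B <-> exists2 C, nbhs (f x) C & f @^-1` C `<=` B.
Proof.
split=> [[_ [[C oC <-] Cx] CB]|[C]].
  by exists C => //; exact: open_nbhs_nbhs.
rewrite nbhsE => -[D [oD Dx] DC] CB; exists (f @^-1` D).
by split=> //; [exists D|move=> y Dy; apply: CB; exact: DC].
Qed.

Definition sl_close (e : R) x y := forall i j, absv (x i j - y i j) < e.

Lemma nbhs_SL2P x (B : set (SL2 F)) :
  nbhs x B <-> exists2 e : R, 0 < e & forall y, sl_close e x y -> B y.
Proof.
rewrite (@nbhs_initialP _ _ (@slmx F)); split=> [[C [D hD DC] CB]|[e e0 eB]].
  have {hD} hD i j : exists2 e : R, 0 < e & forall y : F, absv (x i j - y) < e -> D i j y.
    by apply/nbhs_absvP; exact: hD.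
  have [e e0 he] := ord2_min_ex hD; exists e => // y xy; apply/CB/DC => i j.
  have [e' ee' h] := he i j; apply: h; exact: lt_le_trans (xy i j) ee'.
exists [set N : 'M[F]_2 | forall i j, absv (x i j - N i j) < e].
  exists (fun i j => [set z | absv (x i j - z) < e]) => // i j; exact: near_absv.
by move=> y /= xy; exact: eB.
Qed.

Lemma nbhs_SL2_valringP k (B : set (SL2 (valring F))) :
  nbhs k B <-> exists2 e : R, 0 < e &
    forall k', sl_close e (SL2_incl k) (SL2_incl k') -> B k'.
Proof.
rewrite (@nbhs_initialP _ _ (@slmx (valring F))); split=> [[C [D hD DC] CB]|[e e0 eB]].
  have {hD} hD i j : exists2 e : R, 0 < e &
      forall y : valring F, absv (val (k i j) - val y) < e -> D i j y.
    have [G] := (nbhs_initialP (k i j) (D i j)).1 (hD i j).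
    move=> /nbhs_absvP[e e0 eG] GD; exists e => // y ky; apply: GD; exact: eG.
  have [e e0 he] := ord2_min_ex hD; exists e => // y xy; apply/CB/DC => i j.
  have [e' ee' h] := he i j; apply: h; apply: lt_le_trans ee'.
  by have := xy i j; rewrite /= !mxE.
exists [set N : 'M[valring F]_2 | forall i j, absv (val (k i j) - val (N i j)) < e].
  exists (fun i j => [set z : valring F | absv (val (k i j) - val z) < e]) => // i j.
  apply/(@nbhs_initialP _ _ (@valring_val R F)).
  by exists [set z | absv (val (k i j) - z) < e] => //; exact: near_absv.
by move=> y xy; apply: eB => i j; rewrite /= !mxE; exact: xy.
Qed.

(** Limits are taken entrywise and the determinant passes to the limit. With [h] the identity or
    [SL2_incl], this gives compactness in both [SL2 F] and [SL2 (valring F)]. *)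
Lemma ultra_SL2_lim (T : Type) (G : set_system T) (h : T -> SL2 F) (a : F) : a != 0 ->
  UltraFilter G -> G [set t | forall i j, absv (h t i j) <= absv a] ->
  exists x, (forall i j, absv (x i j) <= absv a) /\
    forall e : R, 0 < e -> G [set t | sl_close e (h t) x].
Proof.
move=> a0 GU Ga; have GP := @ultra_proper _ _ GU.
have lim i j : exists2 l, absv l <= absv a &
    forall e : R, 0 < e -> G [set t | absv (h t i j - l) < e].
  by apply: (ultra_absv_lim a0 GU); apply: filterS Ga => t; apply.
pose l i j := s2val (cid2 (lim i j)).
have la i j : absv (l i j) <= absv a by rewrite /l; case: cid2.
have lG i j (e : R) : 0 < e -> G [set t | absv (h t i j - l i j) < e].
  by rewrite /l; case: cid2 => ? ? /= + e0; apply.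
have Gall (e : R) : 0 < e -> G [set t | forall i j, absv (h t i j - l i j) < e].
  move=> e0; apply: filterS (filterI (filterI (lG 0 0 e e0) (lG 0 1 e e0))
    (filterI (lG 1 0 e e0) (lG 1 1 e e0))) => t [[? ?] [? ?]].
  by do 2 apply: ord2P => //.
have det1 : l 0 0 * l 1 1 - l 0 1 * l 1 0 = 1.
  apply/eqP; rewrite -subr_eq0; apply/negP => /negP d0.
  have aa0 : 0 < absv a by rewrite absv_gt0.
  set d := _ - 1 in d0.
  have e0 : 0 < absv d / absv a by rewrite divr_gt0 ?absv_gt0.
  have [t [/= ta tl]] := @filter_ex _ G GP _ (filterI Ga (Gall _ e0)).
  suff : absv d < absv d by rewrite ltxx.
  have dE : d = l 0 0 * (l 1 1 - h t 1 1) + h t 1 1 * (l 0 0 - h t 0 0) -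
      (l 0 1 * (l 1 0 - h t 1 0) + h t 1 0 * (l 0 1 - h t 0 1)).
    by rewrite /d -(SL2_det (h t)); ring.
  have bnd (u v w : F) : absv u <= absv a -> absv (w - v) < absv d / absv a ->
      absv (u * (v - w)) < absv d.
    move=> ua; rewrite absv_distC => va; rewrite absvM.
    apply: (@le_lt_trans _ _ (absv a * absv (v - w))).
      by rewrite ler_wpM2r ?absv_ge0.
    by rewrite mulrC -ltr_pdivlMr.
  by rewrite {1}dE; apply: absvB_lt; apply: absvD_lt; apply: bnd.
exists (sl2 (l 0 0) (l 0 1) (l 1 0) (l 1 1)); rewrite /sl_close sl2E//; split.
  by do 2 apply: ord2P; rewrite !mx2E.
move=> e e0; apply: filterS (Gall e e0) => t /= H.
by do 2 apply: ord2P; rewrite !mx2E.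
Qed.

Lemma compact_SL2_bounded (a : F) (B : set (SL2 F)) :
  (forall x, B x -> forall i j, absv (x i j) <= absv a) -> closed B -> compact B.
Proof.
move=> Ba cB; have [a0|a0] := eqVneq a 0.
  have -> : B = set0; last exact: compact0.
  apply/seteqP; split=> // x Bx; have := SL2_det x.
  have z i j : x i j = 0.
    by apply: absv_eq0; apply/le_anti; rewrite absv_ge0 andbT -(absv0 F) -a0 Ba.
  by rewrite !z mul0r subrr => /esym/eqP; rewrite oner_eq0.
rewrite compact_ultra => G GU GB; have GP := @ultra_proper _ _ GU.
have [|x [xa xG]] := @ultra_SL2_lim _ G id a a0 GU.
  by apply: filterS GB => x /Ba.
have Gx : G --> x.
  move=> C /nbhs_SL2P[e e0 eC]; apply: filterS (xG e e0) => y /= yx.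
  by apply: eC => i j; rewrite absv_distC.
exists x; split=> //; apply: cB => C Cx.
by have [y [By Cy]] := @filter_ex _ G GP _ (filterI GB (Gx C Cx)); exists y.
Qed.

Definition to_valring (x : F) : valring F := insubd 0 x.

Lemma to_valringK (x : F) : absv x <= 1 -> val (to_valring x) = x.
Proof. by move=> x1; rewrite /to_valring insubdK. Qed.

Lemma valring_le1 (u : valring F) : absv (val u) <= 1.
Proof. exact: valP u. Qed.

Lemma SL2_inclE k i j : SL2_incl k i j = val (k i j).
Proof. by rewrite mxE. Qed.

Lemma SL2_inclM k l : SL2_incl (k * l)%g = (SL2_incl k * SL2_incl l)%g.
Proof. by apply: SL2P; rewrite !SL2_mulE !SL2_inclE SL2_mulE rmorphD !rmorphM. Qed.

Lemma SL2_inclV k : SL2_incl k^-1%g = (SL2_incl k)^-1%g.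
Proof. by apply: SL2P; rewrite !SL2_invE !SL2_inclE !SL2_invE ?rmorphN. Qed.

Lemma SL2_inclP x : (forall i j, absv (x i j) <= 1) -> exists k, SL2_incl k = x.
Proof.
move=> x1; exists (sl2 (to_valring (x 0 0)) (to_valring (x 0 1)) (to_valring (x 1 0))
  (to_valring (x 1 1))).
have h : to_valring (x 0 0) * to_valring (x 1 1) -
    to_valring (x 0 1) * to_valring (x 1 0) = 1.
  by apply: val_inj; rewrite rmorphB !rmorphM /= !to_valringK// SL2_det.
by apply: SL2P; rewrite SL2_inclE sl2E// mx2E to_valringK.
Qed.

Lemma SL2_incl_le1 k i j : absv (SL2_incl k i j) <= 1.
Proof. by rewrite SL2_inclE valring_le1. Qed.

Lemma compact_SL2_valring : compact [set: SL2 (valring F)].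
Proof.
rewrite compact_ultra => G GU _; have GP := @ultra_proper _ _ GU.
have [|x [x1 xG]] := @ultra_SL2_lim _ G (@SL2_incl R F) 1 (oner_neq0 _) GU.
  by apply: filterS (@filterT _ G _) => k _ i j; rewrite absv1 SL2_incl_le1.
have [k hk] : exists k, SL2_incl k = x by apply: SL2_inclP; rewrite -(absv1 F).
exists k; split=> // C /nbhs_SL2_valringP[e e0 eC]; apply: filterS (xG e e0) => y /= yx.
by apply: eC => i j; rewrite absv_distC hk.
Qed.

End SL2_topology.

#[local] Arguments SL2_incl : simpl never.

(** * Haar measures of balls and of Hecke cosets *)

Section finite_additivity.
Context {d : measure_display} {X : measurableType d} {R : realType}.
Variable mu : {measure set X -> \bar R}.

Lemma measure_seq_partition (I : eqType) (L : seq I) (B : I -> set X) (D : set X) :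
  uniq L -> (forall i, i \in L -> measurable (B i)) ->
  (forall i j x, i \in L -> j \in L -> B i x -> B j x -> i = j) ->
  (forall x, D x <-> exists2 i, i \in L & B i x) ->
  measurable D /\ (mu D = \sum_(i <- L) mu (B i))%E.
Proof.
elim: L D => [|i L IH] D uL mB disj DE.
  have -> : D = set0 by apply/seteqP; split=> // x /DE[].
  by rewrite big_nil measure0.
move: uL; rewrite cons_uniq => /andP[iL uL].
have mem j : j \in L -> j \in i :: L by rewrite inE => ->; rewrite orbT.
have [] := IH [set x | exists2 j, j \in L & B j x] uL.
- by move=> j /mem /mB.
- by move=> j k x /mem jL /mem kL; exact: disj.
- by [].
move=> mD' eD'; have mi : measurable (B i) by apply: mB; rewrite inE eqxx.
have DU : D = B i `|` [set x | exists2 j, j \in L & B j x].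
  apply/seteqP; split=> x.
    move=> /DE[j]; rewrite inE => /orP[/eqP ->|jL Bj]; first by left.
    by right; exists j.
  move=> [Bi|[j jL Bj]]; apply/DE; first by exists i; rewrite ?inE ?eqxx.
  by exists j => //; exact: mem.
rewrite big_cons -eD' DU; split; first exact: measurableU.
rewrite measureU//; apply/seteqP; split=> // x [Bi [j jL Bj]].
have ij : i = j by apply: (disj i j x); rewrite ?inE ?eqxx ?jL ?orbT.
by rewrite ij jL in iL.
Qed.

Lemma measure_seq_partition_const (I : eqType) (L : seq I) (B : I -> set X) (D : set X) r :
  uniq L -> (forall i, i \in L -> measurable (B i)) ->
  (forall i j x, i \in L -> j \in L -> B i x -> B j x -> i = j) ->
  (forall x, D x <-> exists2 i, i \in L & B i x) ->
  (forall i, i \in L -> fine (mu (B i)) = r) -> (mu D < +oo)%E ->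
  fine (mu D) = (size L)%:R * r.
Proof.
move=> uL mB disj DE Br Dfin; have [mD eD] := measure_seq_partition uL mB disj DE.
rewrite eD; transitivity (fine (\sum_(i <- L) r%:E)%E).
  congr fine; rewrite big_seq [RHS]big_seq; apply: eq_bigr => i iL.
  rewrite -(Br i iL) fineK// ge0_fin_numE ?measure_ge0//; apply: le_lt_trans Dfin.
  apply: le_measure; rewrite ?inE//; first exact: mB.
  by move=> x Bx; apply/DE; exists i.
by rewrite sumEFin /= big_const_seq count_predT iter_addr_0 mulr_natl.
Qed.

End finite_additivity.

(** * Integrals of finite combinations of indicators *)

Section cintegral_simple.
Context {d : measure_display} {X : measurableType d} {R : realType}.
Variable mu : {measure set X -> \bar R}.

Lemma Rintegral_simple (I : eqType) (L : seq I) (r : I -> R) (A : I -> set X) :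
  (forall i, i \in L -> measurable (A i) /\ (mu (A i) < +oo)%E) ->
  (\int[mu]_x (\sum_(i <- L) r i * \1_(A i) x))%R = \sum_(i <- L) r i * fine (mu (A i)).
Proof.
move=> mA.
suff : mu.-integrable setT (EFin \o (fun x => \sum_(i <- L) r i * \1_(A i) x)) /\
    (\int[mu]_x (\sum_(i <- L) r i * \1_(A i) x))%R = \sum_(i <- L) r i * fine (mu (A i)).
  by case.
elim: L mA => [|i L IH] mA.
  rewrite big_nil; under eq_fun do rewrite big_nil; split.
    by have := @integrable0 _ _ _ mu setT.
  by rewrite /Rintegral integral0.
have [mi fi] := mA i (mem_head _ _).
have [intL eL] : mu.-integrable setT (EFin \o (fun x => \sum_(i <- L) r i * \1_(A i) x)) /\
    (\int[mu]_x (\sum_(i <- L) r i * \1_(A i) x))%R = \sum_(i <- L) r i * fine (mu (A i)).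
  by apply: IH => j jL; apply: mA; rewrite inE jL orbT.
have inti : mu.-integrable setT (EFin \o \1_(A i)).
  apply/integrableP; split; first exact/measurable_EFinP.
  rewrite (eq_integral (fun x => (\1_(A i) x)%:E)) ?integral_indic ?setIT//.
  by move=> t _; rewrite gee0_abs// lee_fin.
have intri : mu.-integrable setT (EFin \o (fun x => r i * \1_(A i) x)).
  by have := integrableZl measurableT (r i) inti; apply: eq_integrable.
split.
  have := integrableD measurableT intri intL; apply: eq_integrable => // x _.
  by rewrite /= big_cons EFinD.
under eq_Rintegral do rewrite big_cons.
rewrite RintegralD// big_cons eL RintegralZl//; congr (r i * _ + _).
by rewrite /Rintegral integral_indic// setIT.
Qed.

Lemma complex_Re_sum (I : Type) (L : seq I) (f : I -> R[i]) :
  complex.Re (\sum_(i <- L) f i) = \sum_(i <- L) complex.Re (f i).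
Proof.
elim: L => [|i L IH]; rewrite ?big_nil// !big_cons -IH.
by case: (f i) => a b; case: (\sum_(j <- L) f j).
Qed.

Lemma complex_Im_sum (I : Type) (L : seq I) (f : I -> R[i]) :
  complex.Im (\sum_(i <- L) f i) = \sum_(i <- L) complex.Im (f i).
Proof.
elim: L => [|i L IH]; rewrite ?big_nil// !big_cons -IH.
by case: (f i) => a b; case: (\sum_(j <- L) f j).
Qed.

Lemma complex_ReZ (z : R[i]) (r : R) : complex.Re (z * r%:C) = complex.Re z * r.
Proof. by case: z => a b /=; rewrite mulr0 subr0. Qed.

Lemma complex_ImZ (z : R[i]) (r : R) : complex.Im (z * r%:C) = complex.Im z * r.
Proof. by case: z => a b /=; rewrite mulr0 add0r. Qed.

(** The integrals of the expansion are evaluated by this finite sum, since their integrands split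
    into finitely many indicators; no limit theorem for integrals enters. *)
Lemma cintegral_simple (I : eqType) (L : seq I) (c : I -> R[i]) (A : I -> set X)
    (f : X -> R[i]) :
  (forall x, f x = \sum_(i <- L) c i * (\1_(A i) x)%:C) ->
  (forall i, i \in L -> measurable (A i) /\ (mu (A i) < +oo)%E) ->
  cintegral mu f = \sum_(i <- L) c i * (fine (mu (A i)))%:C.
Proof.
move=> fE mA; apply/eqP; rewrite eq_complex /cintegral /=; apply/andP; split; apply/eqP.
  rewrite complex_Re_sum; under eq_bigr do rewrite complex_ReZ.
  rewrite -Rintegral_simple//; apply: eq_Rintegral => x _.
  by rewrite fE complex_Re_sum; apply: eq_bigr => i _; rewrite complex_ReZ.
rewrite complex_Im_sum; under eq_bigr do rewrite complex_ImZ.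
rewrite -Rintegral_simple//; apply: eq_Rintegral => x _.
by rewrite fE complex_Im_sum; apply: eq_bigr => i _; rewrite complex_ImZ.
Qed.

End cintegral_simple.

Lemma open_measurable (X : ptopologicalType) (A : set X) :
  open A -> measurable (A : set (borel X)).
Proof. exact: sub_gen_smallest. Qed.

Section homogeneous.
Context {R : realType} {F : naLocalFieldType R}.
Implicit Types (b c : F).

(** The value group is generated by [|unif|], so one scaling step suffices. The cutoff [|c|] is
    there because for boxes the scaling holds only at small relative radius. *)
Lemma absv_homogeneous (h : F -> R) c : c != 0 ->
  (forall b b', absv b = absv b' -> h b = h b') ->
  (forall b, b != 0 -> absv b <= absv c -> h (b * unif F) = absv (unif F) * h b) ->
  forall b, b != 0 -> absv b <= absv c -> h b = absv (b / c) * h c.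
Proof.
move=> c0 habs hstep b b0 bc; have u0 := @unif_neq0 R F.
have [|k hk] := @absv_unif_expz R F (b / c); first by rewrite mulf_neq0 ?invr_neq0.
have k0 : exists m : nat, k = m.
  case: k hk => m hk; first by exists m.
  have : 1 < absv (b / c).
    rewrite hk NegzE -exprnN absvV absvX -invr1 ltf_pV2 ?posrE ?exprn_gt0 ?unif_gt0//.
    by rewrite exprn_ilt1 ?absv_ge0 ?unif_lt1.
  by rewrite absv_div ltr_pdivlMr ?absv_gt0// mul1r ltNge bc.
have {k0} [m km] := k0; rewrite {}km -exprnP in hk.
rewrite hk; rewrite (habs b (c * unif F ^+ m)); last first.
  by rewrite absvM -hk absv_div mulrC divfK// absv_eq0E.
elim: m {hk} => [|m IH]; first by rewrite expr0 mulr1 absv1 mul1r.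
rewrite exprSr mulrA hstep ?IH; first by rewrite absvM; ring.
  by rewrite mulf_neq0 ?expf_neq0.
by rewrite absvM ler_piMr ?absv_ge0// absvX exprn_ile1 ?absv_ge0 ?unif_le1.
Qed.

Definition fball (x b : F) := [set y : F | absv (y - x) <= absv b].

Lemma open_fball x b : b != 0 -> open (fball x b).
Proof.
move=> b0; apply/open_absvP => y yx; exists (absv b); first by rewrite absv_gt0.
by move=> z yz; apply: (absv_trans_le _ yx); rewrite absv_distC ltW.
Qed.

Lemma size_unif : (size (residues F))%:R * absv (unif F) = 1 :> R.
Proof.
by rewrite absv_unif mulfV// pnatr_eq0 -lt0n; apply: ltn_trans (size_residues_gt1).
Qed.

Lemma fball_unif_split x b : b != 0 ->
  (forall i j y, i \in residues F -> j \in residues F ->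
    fball (x + b * i) (b * unif F) y -> fball (x + b * j) (b * unif F) y -> i = j) /\
  (forall y, fball x b y <-> exists2 i, i \in residues F & fball (x + b * i) (b * unif F) y).
Proof.
move=> b0; have ab0 : 0 < absv b by rewrite absv_gt0.
have E y i : y - (x + b * i) = b * ((y - x) / b - i) by field.
have H y i : fball (x + b * i) (b * unif F) y <-> absv ((y - x) / b - i) < 1.
  by rewrite /fball /= E !absvM ler_pM2l// absv_lt1P.
split=> [i j y iR jR /H hi /H hj|y].
  by apply: residues_inj => //; apply: (absv_trans_lt _ hj); rewrite absv_distC.
split=> [yx|[i iR /H yi]].
  have [|i iR hi] := @residues_ex R F ((y - x) / b).
    by rewrite absv_div ler_pdivrMr// mul1r.
  by exists i => //; apply/H.
rewrite /fball /=; have -> : y - x = b * ((y - x) / b - i) + b * i by field.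
apply: absvD_le; rewrite absvM ler_piMr ?absv_ge0// ?(ltW yi)//.
exact: residues_le1.
Qed.

End homogeneous.

Section haar_field.
Context {R : realType} {F : naLocalFieldType R}.
Variable muF : {measure set (borel F) -> \bar R}.
Hypothesis haarF : haar_add muF.

Lemma measurable_fball (x b : F) : b != 0 -> measurable (fball x b : set (borel F)).
Proof. by move=> b0; apply: open_measurable; exact: open_fball. Qed.

Lemma haar_fball_fin (x b : F) : (muF (fball x b) < +oo)%E.
Proof.
have [_ fin inv] := haarF; have [->|b0] := eqVneq b 0.
  apply: fin; have -> : fball x 0 = [set x]; last exact: compact_set1.
  apply/seteqP; split=> y /=; last by move=> ->; rewrite /fball /= subrr lexx.
  rewrite /fball /= absv0 => yx; apply/eqP; rewrite -subr_eq0; apply/eqP/absv_eq0.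
  by apply/le_anti; rewrite yx absv_ge0.
have -> : fball x b = (fun y => - x + y) @^-1` fball 0 b.
  by apply/seteqP; split=> y; rewrite /fball /= subr0 addrC.
rewrite inv; last exact: measurable_fball.
have -> : fball 0 b = [set y : F | absv y <= absv b].
  by apply/seteqP; split=> y; rewrite /fball /= subr0.
exact/fin/compact_ball.
Qed.

Lemma haar_fball_translate (x b : F) : b != 0 -> muF (fball x b) = muF (fball 0 b).
Proof.
move=> b0; have [_ fin inv] := haarF.
rewrite -(inv (- x) (fball 0 b)); last exact: measurable_fball.
by congr (muF _); apply/seteqP; split=> y; rewrite /fball /= subr0 addrC.
Qed.

Lemma haar_fball (x b : F) : b != 0 ->
  fine (muF (fball x b)) = absv b * fine (muF (fball 0 1)).
Proof.
move=> b0; rewrite haar_fball_translate//.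
have habs (a a' : F) : absv a = absv a' -> fine (muF (fball 0 a)) = fine (muF (fball 0 a')).
  by rewrite /fball => ->.
have hstep (a : F) : a != 0 ->
    fine (muF (fball 0 (a * unif F))) = absv (unif F) * fine (muF (fball 0 a)).
  move=> a0; have [disj part] := fball_unif_split 0 a0.
  have au0 : a * unif F != 0 by rewrite mulf_neq0 ?unif_neq0.
  rewrite (@measure_seq_partition_const _ _ _ muF _ _ _ _
    (fine (muF (fball 0 (a * unif F)))) (residues_uniq) _ disj part).
  - by rewrite mulrA [absv _ * _]mulrC size_unif mul1r.
  - by move=> i _; exact: measurable_fball.
  - by move=> i _; rewrite haar_fball_translate.
  - exact: haar_fball_fin.
have [c c0 hc] := @absv_ex_big R F (Num.max 1 (absv b)).
have h := @absv_homogeneous R F (fun a => fine (muF (fball 0 a))) c c0 habs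
  (fun a a0 _ => hstep a a0).
rewrite h//; last by apply: le_trans hc; rewrite le_max lexx orbT.
rewrite [in RHS]h ?oner_neq0//; last by rewrite absv1; apply: le_trans hc; rewrite le_max lexx.
by rewrite !absv_div absv1; ring.
Qed.

Lemma haar_fball1_gt0 : 0 < fine (muF (fball 0 1)).
Proof.
have [nz fin inv] := haarF.
rewrite lt_neqAle fine_ge0 ?measure_ge0// andbT eq_sym; apply/negP => /eqP h0.
apply: nz; apply/eqP; rewrite eq_le measure_ge0 andbT.
have u0 n : unif F ^- n != 0 by rewrite invr_neq0// expf_neq0// unif_neq0.
have mB n : measurable (fball 0 (unif F ^- n) : set (borel F)).
  exact: measurable_fball.
have B0 n : muF (fball 0 (unif F ^- n)) = 0%E.
  have := @haar_fball 0 _ (u0 n); rewrite h0 mulr0 => e.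
  by rewrite -[LHS]fineK ?e// ge0_fin_numE ?measure_ge0// haar_fball_fin.
have TE : [set: borel F] `<=` \bigcup_n (fball 0 (unif F ^- n)).
  move=> x _; have [|n hn] := @expr_unif_small R F (absv (x : F) + 1)^-1.
    by rewrite invr_gt0 ltr_wpDl ?absv_ge0.
  exists n => //; rewrite /fball /= subr0 absvV -[leLHS]invrK.
  have n0 : 0 < absv (unif F ^+ n) by rewrite absv_gt0 expf_neq0// unif_neq0.
  have [->|x0] := eqVneq (x : F) 0; first by rewrite absv0 invr0 invr0 invr_ge0 ltW.
  have ax : 0 < absv (x : F) by rewrite absv_gt0.
  have ax1 : 0 < absv (x : F) + 1 by rewrite addr_gt0.
  rewrite lef_pV2 ?posrE ?invr_gt0//.
  by apply/ltW/(lt_trans hn); rewrite ltf_pV2 ?posrE// ltrDl.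
apply: le_trans (@measure_sigma_subadditive _ _ _ muF setT
  (fun n => fball 0 (unif F ^- n)) mB measurableT TE) _.
by rewrite eseries0// => n _ _.
Qed.

End haar_field.

(** * Measures of cosets of congruence subgroups of SL(2, O) *)

Section haar_SL2_valring.
Context {R : realType} {F : naLocalFieldType R}.
Implicit Types (k h : SL2 (valring F)).
Variable muK : {measure set (borel (SL2 (valring F))) -> \bar R}.
Hypothesis haarK : haar_SL2 muK.

(** For [|e| <= 1], the right coset by [h] of the subgroup of matrices that are upper triangular
    modulo [e]. *)
Definition hecke_coset h (e : F) :=
  [set k | absv (SL2_incl (k * h^-1)%g 1 0) <= absv e].

Lemma open_hecke_coset h e : e != 0 -> open (hecke_coset h e).
Proof.
move=> e0; rewrite openE => k kh; apply/nbhs_SL2_valringP.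
exists (absv e); first by rewrite absv_gt0.
move=> k' kk'; rewrite /hecke_coset /=.
have -> : SL2_incl (k' * h^-1)%g 1 0 = SL2_incl (k * h^-1)%g 1 0 -
    ((SL2_incl k 1 0 - SL2_incl k' 1 0) * SL2_incl h^-1%g 0 0 +
     (SL2_incl k 1 1 - SL2_incl k' 1 1) * SL2_incl h^-1%g 1 0).
  by rewrite !SL2_inclM !SL2_mulE; ring.
apply: absvB_le => //; apply: absvD_le; rewrite absvM -[leRHS]mulr1 ler_pM ?absv_ge0//;
  by rewrite ?SL2_incl_le1// ltW.
Qed.

Lemma measurable_hecke_coset h e :
  e != 0 -> measurable (hecke_coset h e : set (borel (SL2 (valring F)))).
Proof. by move=> e0; apply: open_measurable; exact: open_hecke_coset. Qed.

Lemma muK_fin (A : set (SL2 (valring F))) : measurable (A : set (borel (SL2 (valring F)))) ->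
  (muK A < +oo)%E.
Proof.
move=> mA; have [_ fin _] := haarK.
apply: le_lt_trans (fin _ compact_SL2_valring).
by apply: le_measure; rewrite ?inE.
Qed.

(** The first columns [(1, y)] and [(y, 1)] are the two charts of the projective line over [O / e],
    which parametrizes the cosets of the congruence subgroup. *)
Definition bruhat_rep (i : bool * F) : SL2 (valring F) :=
  if i.1 then lowu (to_valring i.2) else sl2 (to_valring i.2) (-1) 1 0.

Lemma bruhat_rep_actE i k : absv i.2 <= 1 ->
  SL2_incl ((bruhat_rep i)^-1 * k)%g 1 0 =
    if i.1 then SL2_incl k 1 0 - i.2 * SL2_incl k 0 0
    else i.2 * SL2_incl k 1 0 - SL2_incl k 0 0.
Proof.
case: i => [[] y] y1; rewrite SL2_inclM SL2_mulE SL2_inclV !SL2_invE.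
  by rewrite /bruhat_rep !SL2_inclE !lowuE to_valringK// rmorph1 mul1r mulNr addrC.
have -> : bruhat_rep (false, y) = sl2 (to_valring y) (-1) 1 0 by [].
rewrite !SL2_inclE sl2E; last by ring.
by rewrite !mx2E to_valringK// rmorph1 mulN1r addrC.
Qed.

Lemma SL2_incl_col k : absv (SL2_incl k 0 0) < 1 -> absv (SL2_incl k 1 0) = 1.
Proof.
move=> p1; apply/eqP; rewrite eq_le SL2_incl_le1 leNgt; apply/negP => r1.
have : absv (1 : F) < 1; last by rewrite absv1 ltxx.
rewrite -(SL2_det (SL2_incl k)); apply: absvB_lt.
  by rewrite absvM; apply: le_lt_trans p1; rewrite ler_piMr ?absv_ge0 ?SL2_incl_le1.
by rewrite absvM mulrC; apply: le_lt_trans r1; rewrite ler_piMr ?absv_ge0 ?SL2_incl_le1.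
Qed.

(** For [|e| = q^-(j+1)] the group is the disjoint union of [q^(j+1) + q^j] left translates of the
    coset, all of the same mass by invariance. *)
Lemma measure_hecke_coset h e : e != 0 -> absv e < 1 ->
  fine (muK (hecke_coset h e)) =
    absv e * (fine (muK setT) / (1 + absv (unif F))).
Proof.
move=> e0 e1; have [_ _ inv] := haarK.
(* The exponent is at least 1 because [|e| < 1]; so the chart at infinity, made of the [y] divisible
   by [unif], has [q^j] points. *)
have [j ej] : exists j, absv e = absv (unif F ^+ j.+1).
  have [[j|j] hj] := absv_unif_expz e0.
    case: j hj => [|j] hj; last by exists j.
    by move: e1; rewrite hj -exprnP expr0 absv1 ltxx.
  move: e1; rewrite hj NegzE -exprnN absvV absvX invf_lt1 ?exprn_gt0 ?unif_gt0//.
  by rewrite ltNge exprn_ile1 ?absv_ge0 ?unif_le1.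
have [L1 s1 [uL1 L1b L1i L1e]] := @ball_reps_unit R F j.+1.
have [L2 s2 [uL2 L2b L2i L2e]] := @ball_reps_ex R F (unif F) j (@unif_neq0 R F).
rewrite -ej in L1i L1e; rewrite -exprS -ej in L2i L2e.
pose L := [seq (true, y) | y <- L1] ++ [seq (false, y) | y <- L2].
have L1P y : ((true, y) \in L) = (y \in L1).
  rewrite mem_cat mem_map; last by move=> ? ? [].
  by rewrite orbC; case: (boolP (_ \in _)) => // /mapP[].
have L2P y : ((false, y) \in L) = (y \in L2).
  rewrite mem_cat [X in _ || X]mem_map; last by move=> ? ? [].
  by case: (boolP (_ \in _)) => // /mapP[].
have Lle i : i \in L -> absv i.2 <= 1.
  case: i => [[] y]; rewrite ?L1P ?L2P => yL /=; first by rewrite -(absv1 F) L1b.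
  exact: le_trans (L2b _ yL) unif_le1.
have Llt y : y \in L2 -> absv y < 1.
  by move=> yL; apply: le_lt_trans (L2b _ yL) unif_lt1.
pose B (i : bool * F) : set (SL2 (valring F)) :=
  (fun k => (bruhat_rep i)^-1 * k)%g @^-1` hecke_coset h e.
(* The first column [(p, r)] of [k h^-1], which is primitive. The translates read [r = y p] or
   [p = y r] modulo [e], according to whether [p] is a unit. *)
pose p k : F := SL2_incl (k * h^-1)%g 0 0; pose r k : F := SL2_incl (k * h^-1)%g 1 0.
have p1 k : absv (p k) <= 1 by exact: SL2_incl_le1.
have r1 k : absv (r k) <= 1 by exact: SL2_incl_le1.
have pr k : absv (p k) < 1 -> absv (r k) = 1 by exact: SL2_incl_col.
have BT y k : y \in L1 -> B (true, y) k <-> absv (r k - y * p k) <= absv e.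
  rewrite -L1P => yL.
  have E : SL2_incl ((bruhat_rep (true, y))^-1 * k * h^-1)%g 1 0 = r k - y * p k.
    by rewrite -mulgA; exact: (bruhat_rep_actE (k * h^-1)%g (Lle _ yL)).
  by rewrite -E.
have BF y k : y \in L2 -> B (false, y) k <-> absv (y * r k - p k) <= absv e.
  rewrite -L2P => yL.
  have E : SL2_incl ((bruhat_rep (false, y))^-1 * k * h^-1)%g 1 0 = y * r k - p k.
    by rewrite -mulgA; exact: (bruhat_rep_actE (k * h^-1)%g (Lle _ yL)).
  by rewrite -E.
clearbody p r.
have sizeL : size L = (size (residues F) ^ j.+1 + size (residues F) ^ j)%N.
  by rewrite size_cat !size_map s1 s2.
have pT y k : y \in L1 -> absv (r k - y * p k) <= absv e -> absv (p k) = 1.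
  move=> yL H; apply/eqP; rewrite eq_le p1 leNgt; apply/negP => pk1.
  have yp : absv (y * p k) < 1.
    rewrite absvM; apply: le_lt_trans pk1; rewrite ler_piMl ?absv_ge0//.
    by rewrite -(absv1 F) L1b.
  by move: (le_lt_trans H e1); rewrite absvDl ?absvN pr// ltxx.
have pF y k : y \in L2 -> absv (y * r k - p k) <= absv e -> absv (p k) < 1.
  move=> yL H.
  have yr : absv (y * r k) < 1.
    by rewrite absvM; apply: le_lt_trans (Llt _ yL); rewrite ler_piMr ?absv_ge0.
  rewrite -[X in absv X](subKr (y * r k)).
  by apply: absvB_lt => //; exact: le_lt_trans H e1.
have mH := @measurable_hecke_coset h e e0.
have BH i : muK (B i) = muK (hecke_coset h e) by rewrite -(inv (bruhat_rep i)^-1%g _ mH).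
have uL : uniq L.
  rewrite cat_uniq !map_inj_uniq ?uL1 ?uL2 ?andbT /=; try by move=> ? ? [].
  by apply/hasPn => _ /mapP[y _ ->]; apply/negP => /mapP[].
have openB i : i \in L -> measurable (B i : set (borel (SL2 (valring F)))).
  move=> iL; apply: open_measurable; rewrite openE => k kB.
  have -> : B i = [set k | (hecke_coset h e) ((bruhat_rep i)^-1 * k)%g] by [].
  have := @open_hecke_coset h e e0; rewrite openE => /(_ _ kB)/nbhs_SL2_valringP[t t0 ht].
  apply/nbhs_SL2_valringP; exists t; first exact: t0.
  move=> k' kk'; apply: (ht ((bruhat_rep i)^-1 * k')%g) => a b.
  rewrite !SL2_inclM !SL2_mulE.
  have -> : forall u v x y x' y' : F, u * x + v * y - (u * x' + v * y') =
    u * (x - x') + v * (y - y') by move=> *; ring.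
  have mul_lt (u v : F) : absv u <= 1 -> absv v < t -> absv (u * v) < t.
    by move=> u1; apply: le_lt_trans; rewrite absvM ler_piMl ?absv_ge0.
  by apply: absvD_lt; apply: mul_lt; rewrite ?SL2_incl_le1//; exact: kk'.
have H := @measure_seq_partition_const _ _ _ muK _ L B setT
  (fine (muK (hecke_coset h e))) uL openB.
rewrite [in RHS]H.
- rewrite sizeL natrD expnS natrM !natrX ej absvX.
  set q := (size (residues F))%:R; set u := absv (unif F).
  have qu : q * u = 1 by exact: size_unif.
  have u1 : 1 + u != 0 by rewrite gt_eqF// ltr_wpDr ?absv_ge0.
  have quj : u ^+ j * q ^+ j = 1 by rewrite -exprMn mulrC qu expr1n.
  have -> : u ^+ j.+1 * ((q * q ^+ j + q ^+ j) * fine (muK (hecke_coset h e)) / (1 + u)) =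
      (u ^+ j * q ^+ j) * (q * u + u) * fine (muK (hecke_coset h e)) / (1 + u).
    by rewrite exprS; field.
  by rewrite quj qu; field.
- case=> [[] y] [[] y'] k; rewrite ?L1P ?L2P => yL y'L.
  + move=> /(BT _ _ yL) hy /(BT _ _ y'L) hy'; congr (_, _); apply: L1i => //.
    have -> : absv (y - y') = absv ((y - y') * p k).
      by rewrite absvM (pT y k)// mulr1.
    have -> : (y - y') * p k = (r k - y' * p k) - (r k - y * p k) by ring.
    exact: absvB_le.
  + by move=> /(BT _ _ yL) /(pT _ _ yL) h1 /(BF _ _ y'L) /(pF _ _ y'L); rewrite h1 ltxx.
  + by move=> /(BF _ _ yL) /(pF _ _ yL) + /(BT _ _ y'L) /(pT _ _ y'L) h1; rewrite h1 ltxx.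
  + move=> /(BF _ _ yL) hy /(BF _ _ y'L) hy'; congr (_, _); apply: L2i => //.
    have -> : absv (y - y') = absv ((y - y') * r k).
      by rewrite absvM (pr k) ?mulr1// (pF y k).
    have -> : (y - y') * r k = (y * r k - p k) - (y' * r k - p k) by ring.
    exact: absvB_le.
- move=> k; split=> // _.
  have [pk1|pk1] := ltP (absv (p k)) 1.
    have rk1 := pr k pk1.
    have r0 : r k != 0 by rewrite -absv_gt0 rk1 ltr01.
    have [|y yL hy] := L2e (p k / r k); first by rewrite absv_div rk1 divr1 unif_max.
    exists (false, y); first by rewrite L2P.
    apply/(BF _ _ yL); have -> : y * r k - p k = (y - p k / r k) * r k by field.
    by rewrite absvM rk1 mulr1 absv_distC.
  have {}pk1 : absv (p k) = 1 by apply/le_anti; rewrite pk1 p1.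
  have p0 : p k != 0 by rewrite -absv_gt0 pk1 ltr01.
  have [|y yL hy] := L1e (r k / p k); first by rewrite absv_div pk1 divr1 absv1.
  exists (true, y); first by rewrite L1P.
  apply/(BT _ _ yL); have -> : r k - y * p k = (r k / p k - y) * p k by field.
  by rewrite absvM pk1 mulr1.
- by move=> i _; rewrite BH.
- exact: muK_fin.
Qed.

Lemma haar_SL2_valring_gt0 : 0 < fine (muK setT).
Proof.
have [nz _ _] := haarK; apply: fine_gt0; apply/andP; split; last exact: muK_fin.
by rewrite lt0e measure_ge0 andbT; apply/eqP.
Qed.

End haar_SL2_valring.

(** * Coordinates on T\G *)

Section continuous_functions.
Context {R : realType} {F : naLocalFieldType R}.
Implicit Types (f g : SL2 F -> F) (x y : SL2 F).

Definition sl_cts f := forall x (e : R), 0 < e ->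
  exists2 d : R, 0 < d & forall y, sl_close d x y -> absv (f x - f y) < e.

Lemma sl_cts_cst (a : F) : sl_cts (fun=> a).
Proof. by move=> x e e0; exists 1 => // y _; rewrite subrr absv0. Qed.

Lemma sl_cts_entry i j : sl_cts (fun x => x i j).
Proof. by move=> x e e0; exists e => // y; apply. Qed.

Lemma sl_ctsD f g : sl_cts f -> sl_cts g -> sl_cts (fun x => f x + g x).
Proof.
move=> cf cg x e e0; have [d d0 hd] := cf x e e0; have [d' d0' hd'] := cg x e e0.
exists (Num.min d d'); first by rewrite lt_min d0.
move=> y xy; rewrite opprD addrACA; apply: absvD_lt.
  by apply: hd => i j; apply: lt_le_trans (xy i j) _; rewrite ge_min lexx.
by apply: hd' => i j; apply: lt_le_trans (xy i j) _; rewrite ge_min lexx orbT.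
Qed.

Lemma sl_ctsM f g : sl_cts f -> sl_cts g -> sl_cts (fun x => f x * g x).
Proof.
move=> cf cg x e e0.
pose M := Num.max 1 (Num.max (absv (f x)) (absv (g x))).
have M0 : 0 < M by rewrite /M lt_max ltr01.
have eM : 0 < Num.min 1 (e / M) by rewrite lt_min ltr01 divr_gt0.
have [d d0 hd] := cf x _ eM; have [d' d0' hd'] := cg x _ eM.
exists (Num.min d d'); first by rewrite lt_min d0.
move=> y xy.
have /hd : sl_close d x y by move=> i j; apply: lt_le_trans (xy i j) _; rewrite ge_min lexx.
have /hd' : sl_close d' x y.
  by move=> i j; apply: lt_le_trans (xy i j) _; rewrite ge_min lexx orbT.
rewrite !lt_min => /andP[g1 gM] /andP[f1 fM].
have -> : f x * g x - f y * g y =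
    f x * (g x - g y) + g x * (f x - f y) - (f x - f y) * (g x - g y) by ring.
have small u v : absv u <= M -> absv v < e / M -> absv (u * v) < e.
  move=> uM vM; rewrite absvM; apply: (@le_lt_trans _ _ (M * absv v)).
    by rewrite ler_wpM2r ?absv_ge0.
  by rewrite mulrC -ltr_pdivlMr.
apply: absvB_lt; first apply: absvD_lt; apply: small => //.
- by rewrite /M !le_max lexx !orbT.
- by rewrite /M !le_max lexx !orbT.
- by apply/ltW/(lt_le_trans f1); rewrite /M le_max lexx.
Qed.

Lemma sl_ctsN f : sl_cts f -> sl_cts (fun x => - f x).
Proof.
move=> cf x e e0; have [d d0 hd] := cf x e e0; exists d => // y /hd.
by rewrite -opprD absvN.
Qed.

Lemma sl_cts_open_ball f (a b : F) : b != 0 -> sl_cts f ->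
  open [set x | absv (f x - a) <= absv b].
Proof.
move=> b0 cf; rewrite openE => x /= xa.
have [|d d0 hd] := cf x (absv b); first by rewrite absv_gt0.
apply/nbhs_SL2P; exists d => // y /hd /ltW h /=.
by apply: (absv_trans_le _ xa); rewrite absv_distC.
Qed.

Lemma sl_cts_closed_ball f (b : F) : sl_cts f ->
  closed [set x | absv (f x) <= absv b].
Proof.
move=> cf; rewrite -[X in closed X]setCK; apply: open_closedC.
rewrite openE => x /= /negP; rewrite -ltNge => bx.
have [|d d0 hd] := cf x (absv (f x)); first exact: le_lt_trans (absv_ge0 _) bx.
apply/nbhs_SL2P; exists d => // y /hd h /=; apply/negP; rewrite -ltNge.
by rewrite (@absv_close _ _ (f y) (f x))// absv_distC.
Qed.

End continuous_functions.

Section torus_quotient.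
Context {R : realType} {F : naLocalFieldType R}.
Variables (s n : F) (T : set (SL2 F)).
Local Notation nf := (nform s n).
Hypothesis nform_eq0 : forall x y, nf x y = 0 -> x = 0 /\ y = 0.
Hypothesis torusP : forall t, T t <-> exists x y, nf x y = 1 /\ slmx t = mx2 x (- (n * y)) y (x + s * y).
Implicit Types (x y t g : SL2 F) (q : coset_space T).

(* With [M] the matrix of the multiplication by a root of [X^2 - s X + n], the
   entries of [x^-1 M x] are [Ac x], [Bc x], [Cc x] and [s - Ac x]. *)
Definition Ac x : F := - (x 0 0 * x 0 1 + s * x 0 1 * x 1 0 + n * x 1 0 * x 1 1).
Definition Bc x : F := - nf (x 0 1) (x 1 1).
Definition Cc x : F := nf (x 0 0) (x 1 0).
Definition Pc (a : F) : F := a ^+ 2 - s * a + n.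

(** The determinant of [x^-1 M x] is [n], with [Pc] the characteristic polynomial of [M]. *)
Lemma BcCc x : Bc x * Cc x = - Pc (Ac x).
Proof.
have d : x 0 0 * x 1 1 = 1 + x 0 1 * x 1 0 by rewrite -(SL2_det x) subrK.
have -> : Pc (Ac x) = nf (Ac x) (- (x 0 0 * x 1 1 - x 0 1 * x 1 0)).
  by rewrite SL2_det /Pc /nform; ring.
by rewrite /Bc /Cc /Ac /nform; ring.
Qed.

Lemma torus1 : T 1%g.
Proof.
apply/torusP; exists 1, 0; split; first by rewrite /nform; ring.
by apply: mx2P; rewrite !SL2_oneE !mx2E ?mulr0 ?oppr0 ?addr0.
Qed.

(** The torus centralizes [M], so [x^-1 M x] depends only on the coset. *)
Lemma torus_coords t x : T t ->
  [/\ Ac (t * x)%g = Ac x, Bc (t * x)%g = Bc x & Cc (t * x)%g = Cc x].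
Proof.
move=> /torusP[u [v [uv te]]]; rewrite /Ac /Bc /Cc !SL2_mulE te !mx2E.
split; rewrite -[RHS]mul1r -uv /nform; ring.
Qed.

Lemma coset_repr_pi x : exists2 t, T t & coset_repr (coset_pi T x) = (t * x)%g.
Proof.
have : rcoset_rel T (coset_repr (coset_pi T x)) x.
  by apply/eqmodP; exact: (reprK (coset_pi T x)).
move=> /asboolP e.
have : Defs.rcoset T (coset_repr (coset_pi T x)) (coset_repr (coset_pi T x)).
  by exists 1%g; [exact: torus1|rewrite mul1g].
by rewrite e => -[t Tt <-]; exists t.
Qed.

Definition Aq q := Ac (coset_repr q).
Definition Bq q := Bc (coset_repr q).
Definition Cq q := Cc (coset_repr q).

Lemma coords_pi x : [/\ Aq (coset_pi T x) = Ac x, Bq (coset_pi T x) = Bc x &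
  Cq (coset_pi T x) = Cc x].
Proof. by have [t Tt e] := coset_repr_pi x; rewrite /Aq /Bq /Cq e; exact: torus_coords. Qed.

Lemma coset_piK q : coset_pi T (coset_repr q) = q.
Proof. exact: reprK. Qed.

Lemma BqCq q : Bq q * Cq q = - Pc (Aq q).
Proof. exact: BcCc. Qed.

Lemma Bq_norm q : is_norm s n (- Bq q).
Proof. by rewrite opprK; do 2 eexists. Qed.

Lemma coset_act_lowu (y : F) q :
  Aq (coset_act (lowu y) q) = Aq q + y * Bq q /\ Bq (coset_act (lowu y) q) = Bq q.
Proof.
have [-> -> _] := coords_pi (coset_repr q * lowu y)%g.
by rewrite /Aq /Bq /Ac /Bc !SL2_mulE !lowuE /nform; split; ring.
Qed.

Lemma coset_act_weyl q :
  Aq (coset_act (weyl : SL2 F) q) = s - Aq q /\ Bq (coset_act (weyl : SL2 F) q) = - Cq q.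
Proof.
have [-> -> _] := coords_pi (coset_repr q * weyl)%g.
rewrite /Aq /Bq /Cq /Ac /Bc /Cc !SL2_mulE !weylE /nform; split; last by ring.
apply/eqP; rewrite -subr_eq0; apply/eqP; set x := coset_repr q.
transitivity (s * (x 0 0 * x 1 1 - x 0 1 * x 1 0 - 1)); first by ring.
by rewrite SL2_det subrr mulr0.
Qed.

Lemma sl_cts_coords : [/\ sl_cts Ac, sl_cts Bc & sl_cts Cc].
Proof.
have e i j : sl_cts (fun x : SL2 F => x i j) by exact: sl_cts_entry.
have c (a : F) : sl_cts (fun=> a) by exact: sl_cts_cst.
split; rewrite /Ac /Bc /Cc /nform; do ?[apply: sl_ctsN|apply: sl_ctsD|apply: sl_ctsM] => //.
Qed.

Lemma open_coset_space (U : set (coset_space T)) :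
  open [set x | U (coset_pi T x)] -> open U.
Proof. by []. Qed.

Lemma continuous_coset_pi : continuous (coset_pi T).
Proof. exact: pi_continuous. Qed.

Definition qbox (a r b e : F) : set (coset_space T) :=
  [set q | absv (Aq q - a) <= absv r /\ absv (Bq q - b) <= absv e].

Definition qbounded (r : F) : set (coset_space T) :=
  [set q | [/\ absv (Aq q) <= absv r, absv (Bq q) <= absv r & absv (Cq q) <= absv r]].

Lemma open_qbox (a r b e : F) : r != 0 -> e != 0 -> open (qbox a r b e).
Proof.
move=> r0 e0; apply: open_coset_space; have [cA cB _] := sl_cts_coords.
have -> : [set x | qbox a r b e (coset_pi T x)] =
    [set x | absv (Ac x - a) <= absv r] `&` [set x | absv (Bc x - b) <= absv e].
  by apply/seteqP; split=> x; rewrite /qbox /=; have [-> -> _] := coords_pi x.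
by apply: openI; exact: sl_cts_open_ball.
Qed.

Lemma measurable_qbox (a r b e : F) : r != 0 -> e != 0 ->
  measurable (qbox a r b e : set (borel (coset_space T))).
Proof. by move=> r0 e0; apply: open_measurable; exact: open_qbox. Qed.

Lemma qboundedE (r : F) : [set x | qbounded r (coset_pi T x)] =
  [set x | absv (Ac x) <= absv r] `&` ([set x | absv (Bc x) <= absv r] `&`
    [set x | absv (Cc x) <= absv r]).
Proof.
apply/seteqP; split=> x; rewrite /qbounded /=; have [-> -> ->] := coords_pi x.
  by case.
by move=> [? [? ?]].
Qed.

Lemma open_qbounded (r : F) : r != 0 -> open (qbounded r).
Proof.
move=> r0; apply: open_coset_space; have [cA cB cC] := sl_cts_coords.
have op (f : SL2 F -> F) : sl_cts f -> open [set x | absv (f x) <= absv r].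
  by move=> cf; have := sl_cts_open_ball 0 r0 cf; under eq_set do rewrite subr0.
by rewrite qboundedE; apply: openI; [exact: op|apply: openI; exact: op].
Qed.

(** Already the preimage in [SL2 F] is compact: up to sign [Bc] and [Cc] are the norms of the
    columns of [x], and [nform_bound] then bounds all entries. This is where the torus is
    anisotropic. *)
Lemma compact_qbounded (r : F) : compact (qbounded r).
Proof.
have [cA cB cC] := sl_cts_coords.
have -> : qbounded r = coset_pi T @` [set x | qbounded r (coset_pi T x)].
  apply/seteqP; split=> q; last by move=> [x /= hx <-].
  by move=> hq; exists (coset_repr q); rewrite /= coset_piK.
apply: continuous_compact.
  exact/continuous_subspaceT/continuous_coset_pi.
have [k k0 hk] := nform_bound nform_eq0.
have [c c0 hc] := @absv_ex_big R F (Num.max 1 (absv r / k)).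
apply: (@compact_SL2_bounded _ _ c); last first.
  by rewrite qboundedE; apply: closedI; [|apply: closedI]; exact: sl_cts_closed_ball.
have bound (u : F) : k * absv u ^+ 2 <= absv r -> absv u <= absv c.
  rewrite -ler_pdivlMl// mulrC => h; rewrite leNgt; apply/negP => cu.
  have c1 : 1 <= absv c by apply: le_trans hc; rewrite le_max lexx.
  have : absv u <= absv u ^+ 2.
    by rewrite expr2 ler_peMl ?absv_ge0// (le_trans c1)// ltW.
  move=> /le_trans /(_ h); rewrite leNgt => /negP; apply; apply: le_lt_trans cu.
  by apply: le_trans hc; rewrite le_max lexx orbT.
rewrite qboundedE => x [_ [/= hB hC]]; rewrite absvN in hB.
have [h00 h10] := hk (x 0 0) (x 1 0); have [h01 h11] := hk (x 0 1) (x 1 1).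
by do 2 apply: ord2P; apply: bound; [apply: le_trans hC|apply: le_trans hB|
  apply: le_trans hC|apply: le_trans hB].
Qed.

(** Since [|e| < |b|], the coordinate [B] has constant absolute value on the box, and [C] is
    recovered from [B C = - Pc A]. *)
Lemma qbox_bounded (a r b e : F) : absv e < absv b ->
  exists2 c, c != 0 & qbox a r b e `<=` qbounded c.
Proof.
move=> eb; have b0 : 0 < absv b by apply: le_lt_trans eb; exact: absv_ge0.
have [M M0 hM] := @absv_ex_big R F (Num.max (Num.max 1 (Num.max (absv s) (absv n)))
   (Num.max (absv a) (absv r))).
move: hM; rewrite !ge_max => /andP[/and3P[M1 Ms Mn] /andP[Ma Mr]].
have [c c0 hc] := @absv_ex_big R F (Num.max (absv M) (Num.max (absv b) (absv (M ^+ 2) / absv b))).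
move: hc; rewrite !ge_max => /and3P[cM cb cMb].
exists c => // q [hA hB].
have AM : absv (Aq q) <= absv M.
  by rewrite -(subrK a (Aq q)) absvD_le// (le_trans hA).
have Bb : absv (Bq q) = absv b by exact: absv_close_le hB eb.
split; [exact: le_trans cM|by rewrite Bb|].
apply: le_trans cMb; rewrite ler_pdivlMr// -Bb -absvM mulrC BqCq absvN /Pc.
have MM : absv M <= absv (M ^+ 2) by rewrite expr2 absvM ler_peMl ?absv_ge0.
apply: absvD_le; last exact: le_trans MM.
by rewrite expr2 (expr2 M); apply: absvB_le; rewrite !absvM ler_pM ?absv_ge0.
Qed.

Section invariant_measure.
Variable mu : {measure set (borel (coset_space T)) -> \bar R}.
Hypothesis haarT : haar_coset mu.

Lemma qbounded_fin (r : F) : (mu (qbounded r) < +oo)%E.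
Proof. by have [_ fin _] := haarT; apply/fin/compact_qbounded. Qed.

Lemma qbounded_sub_fin (r : F) (U : set (coset_space T)) : r != 0 ->
  measurable (U : set (borel (coset_space T))) -> U `<=` qbounded r -> (mu U < +oo)%E.
Proof.
move=> r0 mU Ur; apply: le_lt_trans (qbounded_fin r); apply: le_measure => //.
- by rewrite inE.
- by rewrite inE; apply: open_measurable; exact: open_qbounded.
Qed.

Lemma qbox_fin (a r b e : F) : r != 0 -> e != 0 -> absv e < absv b ->
  (mu (qbox a r b e) < +oo)%E.
Proof.
move=> r0 e0 eb; have [c c0 sub] := qbox_bounded a r eb.
by apply: qbounded_sub_fin sub => //; exact: measurable_qbox.
Qed.

End invariant_measure.
End torus_quotient.

(** * Invariant measure of boxes in T\G *)

Section close_quotients.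
Context {R : realType} {F : naLocalFieldType R}.
Implicit Types (b e p x w : F).

Lemma close_quotient b e p x w : b != 0 -> absv e < absv b ->
  absv (x * w - p) <= absv (p * e / b) -> absv (w - b) <= absv e ->
  absv (x - p / b) <= absv (e * p / b ^+ 2).
Proof.
move=> b0 eb hp hw; have ab0 : 0 < absv b by rewrite absv_gt0.
have aw : absv w = absv b by exact: absv_close_le hw eb.
have axw : absv x * absv b <= absv p.
  rewrite -aw -absvM -(subrK p (x * w)); apply: absvD_le => //.
  by apply: le_trans hp _; rewrite -mulrA absvM ler_piMr ?absv_ge0// absv_div
    ler_pdivrMr// mul1r ltW.
have -> : x - p / b = (x * (b - w) + (x * w - p)) / b by field.
rewrite absv_div ler_pdivrMr//.
have -> : absv (e * p / b ^+ 2) * absv b = absv (p * e / b).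
  by rewrite -absvM; congr absv; field.
apply: absvD_le => //; rewrite absvM absv_distC absv_div ler_pdivlMr// absvM.
by rewrite mulrAC; apply: ler_pM; rewrite ?mulr_ge0 ?absv_ge0.
Qed.

(** When the product [x w] is close to [p], the two neighbourhoods correspond to each other with the
    same relative radius. This describes a box after the Weyl element has exchanged [B] and [C] up
    to sign. *)
Lemma close_quotientP b e p x w : b != 0 -> p != 0 -> absv e < absv b ->
  absv (x * w - p) <= absv (p * e / b) ->
  absv (w - b) <= absv e <-> absv (x - p / b) <= absv (e * p / b ^+ 2).
Proof.
move=> b0 p0 eb hp; split; first exact: close_quotient.
move=> hx; have pb0 : p / b != 0 by rewrite mulf_neq0 ?invr_neq0.
have := @close_quotient (p / b) (e * p / b ^+ 2) p w x pb0.
have -> : p / (p / b) = b by field; rewrite b0 p0.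
have -> : p * (e * p / b ^+ 2) / (p / b) = p * e / b by field; rewrite b0 p0.
have -> : e * p / b ^+ 2 * p / (p / b) ^+ 2 = e by field; rewrite b0 p0.
rewrite [w * x]mulrC; apply => //.
have -> : e * p / b ^+ 2 = (p / b) * (e / b) by field.
rewrite absvM gtr_pMr ?absv_gt0// absv_div ltr_pdivrMr ?mul1r//.
by rewrite absv_gt0.
Qed.

End close_quotients.

Section box_mass.
Context {R : realType} {F : naLocalFieldType R}.
Variables (s n : F) (T : set (SL2 F)).
Local Notation nf := (nform s n).
Hypothesis nform_eq0 : forall x y, nf x y = 0 -> x = 0 /\ y = 0.
Hypothesis separable_form : s != 0 \/ (2%:R : F) != 0.
Hypothesis torusP : forall t, T t <-> exists x y, nf x y = 1 /\ slmx t = mx2 x (- (n * y)) y (x + s * y).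
Variable mu : {measure set (borel (coset_space T)) -> \bar R}.
Hypothesis haarT : haar_coset mu.
Implicit Types (q : coset_space T) (a b r e y z : F).

Local Notation A := (@Aq R F s n T).
Local Notation B := (@Bq R F s n T).
Local Notation C := (@Cq R F s n T).
Local Notation box := (@qbox R F s n T).
Local Notation P := (Pc s n).

Let measurable_box a r b e : r != 0 -> e != 0 ->
  measurable (box a r b e : set (borel (coset_space T))).
Proof. by move=> r0 e0; apply: (measurable_qbox torusP). Qed.

Let box_fin a r b e : r != 0 -> e != 0 -> absv e < absv b -> (mu (box a r b e) < +oo)%E.
Proof. exact: (qbox_fin nform_eq0 torusP haarT). Qed.

Lemma box_splitA a r b e : r != 0 -> e != 0 ->
  (mu (box a r b e) = \sum_(i <- residues F) mu (box (a + r * i)%R (r * unif F)%R b e))%E.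
Proof.
move=> r0 e0; have [disj part] := fball_unif_split a r0.
have ru0 : r * unif F != 0 by rewrite mulf_neq0 ?unif_neq0.
have [] := @measure_seq_partition _ _ _ mu _ (residues F)
  (fun i => box (a + r * i) (r * unif F) b e) (box a r b e); last by [].
- exact: residues_uniq.
- by move=> i _; exact: measurable_box.
- by move=> i j q iR jR [Ai _] [Aj _]; exact: (disj i j (A q)).
- move=> q; split=> [[/part[i iR Ai] Bb]|[i iR [Ai Bb]]]; first by exists i.
  by split=> //; apply/part; exists i.
Qed.

Lemma box_splitB a r b e : r != 0 -> e != 0 ->
  (mu (box a r b e) = \sum_(i <- residues F) mu (box a r (b + e * i)%R (e * unif F)%R))%E.
Proof.
move=> r0 e0; have [disj part] := fball_unif_split b e0.
have eu0 : e * unif F != 0 by rewrite mulf_neq0 ?unif_neq0.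
have [] := @measure_seq_partition _ _ _ mu _ (residues F)
  (fun i => box a r (b + e * i) (e * unif F)) (box a r b e); last by [].
- exact: residues_uniq.
- by move=> i _; exact: measurable_box.
- by move=> i j q iR jR [_ Bi] [_ Bj]; exact: (disj i j (B q)).
- move=> q; split=> [[Aa /part[i iR Bi]]|[i iR [Aa Bi]]]; first by exists i.
  by split=> //; apply/part; exists i.
Qed.

Lemma box_shear a r b e y : r != 0 -> e != 0 -> absv (y * e) <= absv r ->
  mu (box a r b e) = mu (box (a + y * b) r b e).
Proof.
move=> r0 e0 yer; have [_ _ inv] := haarT.
rewrite -(inv (lowu y) _ (measurable_box (a + y * b) b r0 e0)); congr (mu _).
apply/seteqP; split=> q; rewrite /qbox /=; have [-> ->] := coset_act_lowu torusP y q.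
  move=> [Aa Bb]; split=> //.
  have -> : A q + y * B q - (a + y * b) = (A q - a) + y * (B q - b) by ring.
  by apply: absvD_le => //; apply: le_trans yer; rewrite !absvM ler_wpM2l ?absv_ge0.
move=> [Aa Bb]; split=> //.
have -> : A q - a = (A q + y * B q - (a + y * b)) - y * (B q - b) by ring.
by apply: absvB_le => //; apply: le_trans yer; rewrite !absvM ler_wpM2l ?absv_ge0.
Qed.

(** The shear by [(a' - a) / b] moves [a] to [a'], but preserves boxes only when
    [|(a' - a) e| <= |r b|]. Subdividing in the direction of [B] shrinks [e] until this holds; [m]
    counts the subdivisions. *)
Lemma box_translate a a' r b e : r != 0 -> e != 0 -> absv e < absv b ->
  mu (box a r b e) = mu (box a' r b e).
Proof.
move=> r0 e0 eb; have b0 : b != 0 by rewrite -absv_gt0 (le_lt_trans _ eb)// absv_ge0.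
have [m] : exists m, absv (unif F ^+ m) * absv ((a' - a) * e) <= absv (r * b).
  have [aa|aa] := eqVneq ((a' - a) * e) 0.
    by exists 0%N; rewrite aa absv0 mulr0 absv_ge0.
  have [|m hm] := @expr_unif_small R F (absv (r * b) / absv ((a' - a) * e)).
    by rewrite divr_gt0 ?absv_gt0// mulf_neq0.
  by exists m; rewrite -ler_pdivlMr ?absv_gt0// ltW.
elim: m b e e0 eb b0 => [|m IH] b e e0 eb b0 H.
  rewrite (@box_shear _ _ _ _ ((a' - a) / b))//; first by rewrite divfK// addrC subrK.
  by rewrite mulrAC absv_div ler_pdivrMr ?absv_gt0// -[leRHS]absvM -[leLHS]mul1r
    -(absv1 F) -(expr0 (unif F)).
rewrite !box_splitB// big_seq [RHS]big_seq; apply: eq_bigr => i iR.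
have bi : absv (b + e * i) = absv b.
  rewrite absvDl// absvM (le_lt_trans _ eb)// ler_piMr ?absv_ge0//.
  exact: residues_le1.
apply: IH.
- by rewrite mulf_neq0 ?unif_neq0.
- by rewrite bi absvM (le_lt_trans _ eb)// ler_piMr ?absv_ge0 ?unif_le1.
- by rewrite -absv_gt0 bi absv_gt0.
- have -> : absv (r * (b + e * i)) = absv (r * b) by rewrite absvM bi -absvM.
  apply: le_trans H; rewrite exprSr -!absvM.
  by rewrite le_eqVlt; apply/orP; left; apply/eqP; congr absv; ring.
Qed.

Definition mass b e : R := fine (mu (box 0 1 b e)).

Lemma massE a r b e : r != 0 -> e != 0 -> absv e < absv b ->
  fine (mu (box a r b e)) = absv r * mass b e.
Proof.
move=> r0 e0 eb; rewrite (box_translate a 0)//.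
pose h r := fine (mu (box 0 r b e)).
have habs u v : absv u = absv v -> h u = h v by rewrite /h /qbox => ->.
have hstep u : u != 0 -> h (u * unif F) = absv (unif F) * h u.
  move=> u0; have uu0 : u * unif F != 0 by rewrite mulf_neq0 ?unif_neq0.
  rewrite [in RHS]/h box_splitA//.
  have -> : (\sum_(i <- residues F) mu (box (0 + u * i)%R (u * unif F)%R b e))%E =
      (\sum_(i <- residues F) (h (u * unif F))%:E)%E.
    apply: eq_bigr => i _; rewrite (box_translate _ 0)//.
    by rewrite fineK// ge0_fin_numE ?measure_ge0// box_fin.
  rewrite sumEFin /= big_const_seq count_predT iter_addr_0 -mulr_natl mulrA.
  by rewrite [absv _ * _]mulrC size_unif mul1r.
have [c c0] := @absv_ex_big R F (Num.max 1 (absv r)); rewrite ge_max => /andP[c1 cr].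
have H := @absv_homogeneous R F h c c0 habs (fun u u0 _ => hstep u u0).
rewrite -/(h r) H// /mass -/(h 1) (H 1) ?oner_neq0 ?absv1//.
by rewrite !absv_div absv1; ring.
Qed.

Lemma Pc_neq0 a : P a != 0.
Proof.
have -> : P a = nf (- a) 1 by rewrite /Pc /nform; ring.
exact: nform_neq0 nform_eq0 _ _ (oner_neq0 _).
Qed.

(** The Weyl element sends [B] to [- C], that is to [Pc A / B]. As masses do not depend on the
    center in [A], any value [P a] may be used. *)
Lemma mass_weyl a b e : b != 0 -> e != 0 -> absv e < absv b ->
  mass b e = mass (P a / b) (e * P a / b ^+ 2).
Proof.
move=> b0 e0 eb; have P0 := Pc_neq0 a.
have ab0 : 0 < absv b by rewrite absv_gt0.
set p := P a; have ap0 : 0 < absv p by rewrite absv_gt0.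
have e'0 : e * p / b ^+ 2 != 0 by rewrite !mulf_neq0 ?invr_neq0 ?expf_neq0.
have e'b' : absv (e * p / b ^+ 2) < absv (p / b).
  have -> : e * p / b ^+ 2 = (p / b) * (e / b) by field.
  rewrite absvM gtr_pMr ?absv_gt0 ?mulf_neq0 ?invr_neq0//.
  by rewrite absv_div ltr_pdivrMr// mul1r.
pose M := Num.max 1 (absv (s - a *+ 2)).
(* The range of [A] is taken so narrow that [P] is constant on it up to the error [|p e / b|]
   allowed by [close_quotientP]; the factor [|r|] cancels at the end. *)
have [|r r0 hr] := @absv_ex_small R F (Num.min 1 (absv (p * e / b) / M)).
  rewrite lt_min ltr01 divr_gt0 ?lt_max ?ltr01//.
  by rewrite absv_gt0 !mulf_neq0 ?invr_neq0.
move: hr; rewrite lt_min => /andP[r1]; rewrite ltr_pdivlMr ?lt_max ?ltr01// => rM.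
have close z : absv (z - (s - a)) <= absv r -> absv (P z - p) < absv (p * e / b).
  move=> zr; have -> : P z - p = (z - (s - a)) * ((z - (s - a)) + (s - a *+ 2)).
    by rewrite /p /Pc; ring.
  apply: le_lt_trans rM; rewrite absvM ler_pM ?absv_ge0//.
  apply: absvD_le; first by rewrite (le_trans zr)// /M le_max ltW.
  by rewrite /M le_max lexx orbT.
have [_ _ inv] := haarT.
have E : mu (box a r b e) = mu (box (s - a) r (p / b) (e * p / b ^+ 2)).
  rewrite -(inv weyl _ (measurable_box a b r0 e0)); congr (mu _).
  have key q : absv (A q - (s - a)) <= absv r -> absv (- C q - b) <= absv e <->
      absv (B q - p / b) <= absv (e * p / b ^+ 2).
    move=> Aa; apply: close_quotientP => //.
    by rewrite mulrN BqCq opprK ltW// close.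
  have flip q : absv (s - A q - a) = absv (A q - (s - a)).
    by rewrite absv_distC; congr absv; ring.
  apply/seteqP; split=> q; rewrite /qbox /=; have [-> ->] := coset_act_weyl torusP q;
    by rewrite flip => -[Aa /(key q Aa)].
have := massE a r0 e0 eb; rewrite E massE// => /mulfI -> //.
by rewrite absv_eq0E.
Qed.

(** Parametrized by the relative radius [z], since the Weyl element keeps it and changes only the
    center. *)
Definition rmass z b := mass b (z * b).

Lemma rmass_close z b b' : z != 0 -> absv z < 1 -> b != 0 -> absv (b' - b) <= absv (z * b) ->
  rmass z b' = rmass z b.
Proof.
move=> z0 z1 b0 bb'; have zb : absv (z * b) < absv b by rewrite absvM gtr_pMl ?absv_gt0.
have eb : absv b' = absv b by exact: absv_close_le bb' zb.
rewrite /rmass /mass; congr (fine (mu _)); apply/seteqP.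
have zz : absv (z * b') = absv (z * b) by rewrite !absvM eb.
split=> q [Aq Bq]; split=> //; rewrite ?zz in Bq *; apply: (absv_trans_le Bq) => //.
by rewrite absv_distC.
Qed.

Lemma rmass_weyl z a b : z != 0 -> absv z < 1 -> b != 0 -> rmass z b = rmass z (P a / b).
Proof.
move=> z0 z1 b0; rewrite /rmass (@mass_weyl a)// ?mulf_neq0//.
  by congr mass; field.
by rewrite absvM gtr_pMl ?absv_gt0.
Qed.

(** For large [a], [P a] is close to [a^2], so [b] and [a^2 / b] have the same mass. Applying this
    to [b c^2] with [a] and to [b] with [a / c] gives the same third center. *)
Lemma rmass_sqr z b c : z != 0 -> absv z < 1 -> b != 0 -> c != 0 ->
  rmass z (b * c ^+ 2) = rmass z b.
Proof.
move=> z0 z1 b0 c0.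
have az0 : 0 < absv z by rewrite absv_gt0.
pose M := Num.max 1 (Num.max (absv s / absv z) (absv n / absv z)).
have big a d : d != 0 -> M <= absv a -> rmass z d = rmass z (a ^+ 2 / d).
  rewrite !ge_max => d0 /and3P[a1]; rewrite !ler_pdivrMr// => sa na.
  have a0 : a != 0 by rewrite -absv_gt0 (lt_le_trans ltr01).
  rewrite (rmass_weyl a)//; apply: rmass_close => //.
    by rewrite mulf_neq0 ?invr_neq0 ?expf_neq0.
  have -> : P a / d - a ^+ 2 / d = (n - s * a) / d by rewrite /Pc; field.
  rewrite mulrA !absv_div ler_wpM2r ?invr_ge0 ?absv_ge0//.
  rewrite absvM absvX mulrC; apply: absvB_le.
    apply: (le_trans na); rewrite expr2 [leLHS]mulrC ler_wpM2l ?absv_ge0//.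
    by rewrite ler_peMl ?absv_ge0.
  by rewrite absvM expr2 mulrCA ler_wpM2l ?absv_ge0// [leRHS]mulrC.
have [a a0] := @absv_ex_big R F (Num.max M (M * absv c)).
rewrite ge_max => /andP[aM aMc].
have ac0 : 0 < absv c by rewrite absv_gt0.
rewrite (big a) ?mulf_neq0 ?expf_neq0// (big (a / c) b)//; last first.
  by rewrite absv_div ler_pdivlMr.
by congr rmass; field; rewrite b0 c0.
Qed.

(** The Weyl element sends [d * P a] to [1 / d], which is [d] times a square; and [nf x y] is
    [y^2 * P (- x / y)] when [y] is not zero. *)
Lemma rmass_norm z b x y : z != 0 -> absv z < 1 -> b != 0 -> nf x y != 0 ->
  rmass z (b * nf x y) = rmass z b.
Proof.
move=> z0 z1 b0 N0.
have stepP a d : d != 0 -> rmass z (d * P a) = rmass z d.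
  move=> d0; have P0 := Pc_neq0 a; rewrite (rmass_weyl a)// ?mulf_neq0//.
  have -> : P a / (d * P a) = d * d^-1 ^+ 2 by field; rewrite d0 P0.
  by rewrite rmass_sqr// invr_neq0.
have [y0|y0] := eqVneq y 0.
  have -> : nf x y = x ^+ 2 by rewrite y0 /nform; ring.
  apply: rmass_sqr => //; apply: contraNneq N0 => x0.
  by rewrite x0 y0 /nform; apply/eqP; ring.
have -> : b * nf x y = b * y ^+ 2 * P (- (x / y)) by rewrite /Pc /nform; field.
by rewrite stepP ?rmass_sqr// mulf_neq0 ?expf_neq0.
Qed.

(** The subboxes have centers [b (1 + u i)], and [1 + u i] is a norm once [u] is small, so
    [rmass_norm] gives them equal masses. *)
Lemma rmass_scale : exists2 z0, z0 != 0 /\ absv z0 < 1 & forall z b, z != 0 ->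
  absv z <= absv z0 -> b != 0 -> rmass z b = absv (z / z0) * rmass z0 b.
Proof.
have [e e0 he] := is_norm_near1 nform_eq0 separable_form.
have [|z0 z00] := @absv_ex_small R F (Num.min 1 e); first by rewrite lt_min ltr01.
rewrite lt_min => /andP[z01 z0e].
exists z0 => // z b zn0 zz0 b0.
pose h z := rmass z b.
have ab0 : 0 < absv b by rewrite absv_gt0.
have habs u v : absv u = absv v -> h u = h v.
  by move=> uv; rewrite /h /rmass /mass /qbox !absvM uv.
apply: (@absv_homogeneous R F h z0 z00 habs) => // u u0 uz0.
have u1 : absv u < 1 by exact: le_lt_trans z01.
have uu1 : absv (u * unif F) < 1.
  by rewrite absvM (le_lt_trans _ u1)// ler_piMr ?absv_ge0 ?unif_le1.
have uu0 : u * unif F != 0 by rewrite mulf_neq0 ?unif_neq0.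
have ub0 : u * b != 0 by rewrite mulf_neq0.
rewrite [in RHS]/h /rmass /mass box_splitB ?oner_neq0//.
have -> : (\sum_(i <- residues F) mu (box 0%R 1%R (b + u * b * i)%R (u * b * unif F)%R))%E =
    (\sum_(i <- residues F) (h (u * unif F))%:E)%E.
  rewrite big_seq [RHS]big_seq; apply: eq_bigr => i iR.
  have ui : absv (u * i) <= absv u by rewrite absvM ler_piMr ?absv_ge0 ?residues_le1.
  have [x [y xy]] : is_norm s n (1 + u * i).
    apply: he; rewrite opprD addrA subrr add0r absvN; apply: le_lt_trans ui _.
    exact: le_lt_trans z0e.
  have N1 : absv (1 + u * i) = 1 by rewrite absv_1D// (le_lt_trans ui).
  have bE : b + u * b * i = b * nf x y by rewrite xy; ring.
  have N0 : nf x y != 0 by rewrite xy -absv_gt0 N1 ltr01.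
  have <- : fine (mu (box 0 1 (b + u * b * i) (u * b * unif F))) = h (u * unif F).
    rewrite /h -(rmass_norm uu0 uu1 b0 N0) /rmass /mass /qbox bE.
    congr (fine (mu _)); apply/seteqP.
    have -> : absv (u * unif F * (b * nf x y)) = absv (u * b * unif F).
      by rewrite xy !absvM N1 mulr1 mulrAC.
    by split=> q.
  rewrite fineK// ge0_fin_numE ?measure_ge0// box_fin ?oner_neq0//.
    by rewrite mulf_neq0// unif_neq0.
  have -> : absv (b + u * b * i) = absv b by rewrite bE xy absvM N1 mulr1.
  by rewrite mulrAC absvM gtr_pMl.
rewrite sumEFin /= big_const_seq count_predT iter_addr_0 -mulr_natl mulrA.
by rewrite [absv _ * _]mulrC size_unif mul1r.
Qed.

Theorem qbox_measure : exists (c : R) (z0 : F), [/\ z0 != 0, absv z0 < 1 &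
  forall a r b e, r != 0 -> e != 0 -> b != 0 -> absv e <= absv (z0 * b) ->
  fine (mu (box a r b e)) =
    if `[< is_norm s n (- b) >] then c * (absv r * absv e / absv b) else 0].
Proof.
have [z0 [z00 z01] scale] := rmass_scale.
have [d d0 hd] := is_norm_near1 nform_eq0 separable_form.
have [|z1 z10] := @absv_ex_small R F (Num.min (absv z0) d).
  by rewrite lt_min d0 andbT absv_gt0.
rewrite lt_min => /andP[z1z0 z1d].
(* The reference box has center [B = -1]: when [- b] is a norm, [rmass_norm] moves the center [b]
   there. The radius [z1] also makes every element within relative distance [z1] of a norm a
   norm. *)
exists (rmass z0 (-1) / absv z0), z1; split=> //; first exact: lt_trans z01.
move=> a r b e r0 e0 b0 eb.
have ab0 : 0 < absv b by rewrite absv_gt0.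
have az0 : 0 < absv z0 by rewrite absv_gt0.
have ez : absv (e / b) <= absv z0.
  by rewrite absv_div ler_pdivrMr// (le_trans eb)// absvM ler_wpM2r// ltW.
have eb1 : absv e < absv b.
  apply: le_lt_trans eb _; rewrite absvM gtr_pMl//; exact: lt_trans z01.
case: asboolP => [[x [y xy]]|nb].
  have N0 : nf x y != 0 by rewrite xy oppr_eq0.
  rewrite massE//; have -> : mass b e = rmass (e / b) b by rewrite /rmass divfK.
  rewrite scale ?mulf_neq0 ?invr_neq0//.
  have -> : b = -1 * nf x y by rewrite xy mulrNN mul1r.
  rewrite rmass_norm ?oppr_eq0 ?oner_neq0// !absv_div; field.
  by rewrite !absv_eq0E z00 mulf_neq0 ?oppr_eq0 ?oner_neq0.
(* A point of the box would have [- B q], a norm, so close to [- b] that [- b] would be one too. *)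
have -> : box a r b e = set0; last by rewrite measure0.
apply/seteqP; split=> // q [_ hB]; apply: nb.
have Bb : absv (B q) = absv b by exact: absv_close_le hB eb1.
have nB : is_norm s n (- B q) := @Bq_norm R F s n T q.
have B0 : B q != 0 by rewrite -absv_gt0 Bb.
have -> : - b = - B q * (b / B q) by rewrite mulNr mulrCA mulfV// mulr1.
apply: is_normM nB _; apply: hd.
have -> : 1 - b / B q = (B q - b) / B q by field.
rewrite absv_div Bb ltr_pdivrMr//; apply: le_lt_trans hB _; apply: le_lt_trans eb _.
by rewrite absvM ltr_pM2r.
Qed.

End box_mass.

(** * Decomposition of smooth functions near trace 2 *)

Section decomposition.
Context {R : realType} {F : naLocalFieldType R}.
Implicit Types (f : SL2 F -> R[i]) (z : SL2 F) (a x r u : F).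

Lemma ball_reps_ball a r : r != 0 -> absv r <= absv a -> exists L, ball_reps a r L.
Proof.
move=> r0 ra; have a0 : a != 0.
  by apply: contraTneq ra => ->; rewrite absv0 -ltNge absv_gt0.
have [|k hk] := @absv_unif_expz R F (r / a); first by rewrite mulf_neq0 ?invr_neq0.
case: k hk => m hk; last first.
  have : 1 < absv (r / a).
    rewrite hk NegzE -exprnN absvV absvX -invr1 ltf_pV2 ?posrE ?exprn_gt0 ?unif_gt0//.
    by rewrite exprn_ilt1 ?absv_ge0 ?unif_lt1.
  by rewrite absv_div ltr_pdivlMr ?absv_gt0// mul1r ltNge ra.
have [L _ [uL Lb Li Le]] := ball_reps_ex m a0; exists L.
have e : absv (a * unif F ^+ m) = absv r.
  by rewrite absvM [unif F ^+ m]exprnP -hk absv_div mulrC divfK// absv_eq0E.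
by split=> //; rewrite -e.
Qed.

Definition wbox a x r : set (SL2 F) :=
  [set z | absv (z 0 0 - 1 - a) <= absv r /\ absv (z 0 1 - x) <= absv r].
Definition wball r : set (SL2 F) :=
  [set z | forall i j, absv (z i j - (1%g : SL2 F) i j) <= absv r].

Definition unif_locconst f (d : R) (c : F) :=
  [/\ forall z z', sl_close d z z' -> f z = f z', 1 <= absv c &
      forall z, f z != 0 -> forall i j, absv (z i j) <= absv c].

(** Compactness of the support makes the radius of local constancy and the bound on the entries
    uniform. *)
Lemma Ccinf_unif f : Ccinf f -> exists2 d : R, 0 < d & exists c, unif_locconst f d c.
Proof.
move=> [lc cf].
have [d d0 hd] : exists2 d : R, 0 < d & forall z, closure [set z | f z != 0] z ->
    forall z', sl_close d z z' -> f z' = f z.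
  have := (compact_near_coveringP _).1 cf R (at_right 0)
    (fun d z => forall z', sl_close d z z' -> f z' = f z) _.
  move=> /(_ _)[z _|e /= e0 he].
    have /nbhs_SL2P[e e0 he] := lc z.
    exists ([set z' | sl_close e z z'], [set d : R | d < e]) => /=.
      split; first by apply/nbhs_SL2P; exists e.
      exists e => //= d /=; rewrite sub0r normrN => de d0.
      by apply: le_lt_trans de; rewrite ler_norm.
    move=> [z' d] /= [zz' de] z'' z'z''.
    rewrite (he z')// (he z'')// => i j; apply: (absv_trans_lt (zz' i j)).
    exact: lt_trans (z'z'' i j) de.
  exists (e / 2); first by rewrite divr_gt0.
  move=> z cz; apply: (he (e / 2)) => //=; last by rewrite divr_gt0.
  by rewrite sub0r normrN gtr0_norm ?divr_gt0// ltr_pdivrMr// ltr_pMr// ltr1n.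
have [m hm] : exists m : nat, forall z, closure [set z | f z != 0] z ->
    forall i j, absv (z i j) <= m%:R.
  have := (compact_near_coveringP _).1 cf nat \oo
    (fun m z => forall i j, absv (z i j) <= m%:R) _.
  move=> /(_ _)[z _|N _ hN]; last by exists N => z cz; apply: (hN N) => //=.
  pose M := Num.max 1 (Num.max (Num.max (absv (z 0 0)) (absv (z 0 1)))
    (Num.max (absv (z 1 0)) (absv (z 1 1)))).
  have M0 : 0 <= M by rewrite /M le_max ler01.
  have zM i j : absv (z i j) <= M.
    by move: i j; do 2 apply: ord2P; rewrite /M !le_max lexx ?orbT.
  exists ([set z' | sl_close 1 z z'], [set m : nat | (Num.bound M <= m)%N]) => /=.
    split; first by apply/nbhs_SL2P; exists 1.
    by exists (Num.bound M).
  move=> [z' k] /= [zz' Mk] i j.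
  have Mk' : M <= k%:R.
    by apply/ltW/(lt_le_trans (archi_boundP M0)); rewrite ler_nat.
  have -> : z' i j = z i j - (z i j - z' i j) by rewrite subKr.
  apply: (le_trans _ Mk'); apply: absvB_le => //; apply/ltW/(lt_le_trans (zz' i j)).
  by rewrite /M le_max lexx.
have [c c0] := @absv_ex_big R F (Num.max 1 m%:R); rewrite ge_max => /andP[c1 cm].
exists d => //; exists c; split=> //.
  move=> z z' zz'; have [fz|fz] := eqVneq (f z) 0; last first.
    by rewrite (hd z)//; exact: subset_closure.
  have [fz'|fz'] := eqVneq (f z') 0; first by rewrite fz fz'.
  rewrite (hd z')//; first exact: subset_closure.
  by move=> i j; rewrite absv_distC.
by move=> z fz i j; apply: le_trans cm; apply: hm; exact: subset_closure.
Qed.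

Lemma sum_indic_unique (I : eqType) (L : seq I) (c : I -> R[i]) (P : I -> Prop)
    (v : R[i]) (b : bool) : uniq L ->
  (forall l l', l \in L -> l' \in L -> P l -> P l' -> l = l') ->
  (forall l, l \in L -> P l -> c l = v /\ b) ->
  (v != 0 -> b -> exists2 l, l \in L & P l) ->
  \sum_(l <- L) c l * (`[< P l >]%:R : R)%:C = if b then v else 0.
Proof.
move=> uL Pinj Pc Pex.
have [[l lL Pl]|none] := pselect (exists2 l, l \in L & P l).
  have [cl bl] := Pc l lL Pl.
  rewrite (bigD1_seq l)//= big1_seq ?addr0.
    by rewrite asboolT// mulr1 cl bl.
  move=> l' /andP[l'l l'L]; rewrite asboolF ?mulr0// => Pl'.
  by rewrite (Pinj l' l) ?eqxx in l'l.
rewrite big1_seq; last first.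
  by move=> l /andP[_ lL]; rewrite asboolF ?mulr0// => Pl; apply: none; exists l.
case: b Pc Pex => // Pc Pex; apply/eqP; rewrite eq_sym; apply/negPn/negP => v0.
exact/none/Pex.
Qed.

(* The element of trace 2 with first row [(1 + a, x)]; meaningless for [x = 0]. *)
Definition unip_elt a x : SL2 F := sl2 (1 + a) x (- (a ^+ 2 / x)) (1 - a).

Lemma unip_eltE a x : x != 0 ->
  [/\ unip_elt a x 0 0 = 1 + a, unip_elt a x 0 1 = x,
      unip_elt a x 1 0 = - (a ^+ 2 / x) & unip_elt a x 1 1 = 1 - a].
Proof. by move=> x0; rewrite sl2E ?mx2E//; field. Qed.

(** Near trace 2, [a^2] is close to minus the product of the off-diagonal entries, so comparing
    [|a|] with [|x|] amounts to comparing these entries. The strict version is meant for the Weyl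
    conjugates, so that ties are counted once. *)
Definition wcond (strict : bool) r a x :=
  (absv r < absv x) && (absv a < absv x ?<= if ~~ strict).

(** When the trace is close to 2, the first row determines the lower left entry up to a small error,
    which is why boxes prescribe the first row only. *)
Lemma near_unipotent z (t := z 0 0 + z 1 1 - 2%:R) :
  z 0 1 * z 1 0 = t * z 0 0 - (z 0 0 - 1) ^+ 2.
Proof.
rewrite /t; transitivity (z 0 0 * z 1 1 - 1); last by ring.
by rewrite -(SL2_det z); ring.
Qed.

(** Wherever [f] does not vanish and the upper right entry dominates, [z] lies in exactly one box,
    and there [f] equals its value at the center of trace 2. The trace condition is scaled by [c],
    the bound on [z 0 0], so that [t * z 0 0] is at most [|k r|^2]. *)
Lemma wbox_decomposition f d c r k (strict : bool) : unif_locconst f d c ->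
  r != 0 -> k != 0 -> absv r < d -> absv r <= 1 -> absv k < 1 ->
  exists L : seq (F * F), (forall l, l \in L -> wcond strict r l.1 l.2) /\
  forall z, absv (z 0 0 + z 1 1 - 2%:R) * absv c <= absv (k * r) ^+ 2 ->
    \sum_(l <- L) f (unip_elt l.1 l.2) * (`[< wbox l.1 l.2 (k * r) z >]%:R : R)%:C =
    if (absv r < absv (z 0 1)) && (absv (z 1 0) < absv (z 0 1) ?<= if ~~ strict)
    then f z else 0.
Proof.
move=> [fc c1 fb] r0 k0 rd r1 k1.
have ar0 : 0 < absv r by rewrite absv_gt0.
have kr : absv (k * r) < absv r by rewrite absvM gtr_pMl.
have kr0 : k * r != 0 by rewrite mulf_neq0.
have krc : absv (k * r) <= absv c.
  by apply: le_trans c1; apply: le_trans r1; exact: ltW.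
have [Lr [uL Lb Li Le]] := ball_reps_ball kr0 krc.
pose L := [seq l <- [seq (a, x) | a <- Lr, x <- Lr] | wcond strict r l.1 l.2].
have LP a x : ((a, x) \in L) = [&& a \in Lr, x \in Lr & wcond strict r a x].
  rewrite mem_filter /= andbC andbA; congr (_ && _).
  apply/allpairsP/andP => [[[a' x'] /= [aL xL [-> ->]]]//|[aL xL]].
  by exists (a, x).
exists L; split=> [[a x]|z]; first by rewrite LP => /and3P[].
set t := z 0 0 + z 1 1 - 2%:R => tc.
have F0 := near_unipotent z; rewrite -/t in F0.
set A := z 0 0 - 1 in F0 *.
have small a x : a \in Lr -> x \in Lr -> wcond strict r a x -> wbox a x (k * r) z ->
    [/\ absv (z 0 1) = absv x, absv A <= absv x, absv (t * z 0 0) <= absv (k * r) ^+ 2 &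
     (~~ strict \/ absv A < absv x)].
  move=> aL xL /andP[rx ax] [hA hB].
  have krx := lt_trans kr rx.
  have Bx : absv (z 0 1) = absv x by exact: absv_close_le hB krx.
  have Ax : absv A <= absv x.
    by rewrite -(subrK a A); apply: absvD_le; [apply/ltW/(le_lt_trans hA)|exact: lteifW ax].
  split=> //.
    rewrite absvM; apply: le_trans tc; rewrite ler_wpM2l ?absv_ge0//.
    rewrite -(subrK 1 (z 0 0)); apply: absvD_le; last by rewrite absv1.
    by apply: le_trans Ax _; exact: Lb.
  case: strict ax {LP L} => /= ax; last by left.
  by right; rewrite -(subrK a A); apply: absvD_lt => //; exact: le_lt_trans hA krx.
apply: sum_indic_unique.
- by rewrite filter_uniq// allpairs_uniq// => -[? ?] [? ?].
- move=> [a x] [a' x']; rewrite !LP => /and3P[aL xL _] /and3P[a'L x'L _] /= [h1 h2] [h1' h2'].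
  congr (_, _); apply: Li => //; [apply: (@absv_trans_le _ _ _ A)|apply: (@absv_trans_le _ _ _ (z 0 1))] => //;
    by rewrite absv_distC.
- move=> [a x]; rewrite LP => /and3P[aL xL cax] W /=.
  have [Bx Ax tx sx] := small a x aL xL cax W.
  have /andP[rx ax] := cax; have [hA hB] := W.
  have x0 : x != 0 by rewrite -absv_gt0 (lt_trans ar0).
  have krx := lt_trans kr rx.
  have ax0 : 0 < absv x by rewrite absv_gt0.
  have kr2 : absv (k * r) ^+ 2 < absv x ^+ 2.
    by rewrite ltr_pXn2r ?nnegrE ?absv_ge0.
  have B0 : z 0 1 != 0 by rewrite -absv_gt0 Bx.
  split; last first.
    rewrite Bx rx /=.
    have -> : absv (z 1 0) = absv (t * z 0 0 - A ^+ 2) / absv x.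
      by rewrite -F0 absvM Bx mulrC mulKf// gt_eqF.
    case: strict sx {LP L cax ax small} => /= -[]// sx.
    + rewrite ltr_pdivrMr// -expr2; apply: absvB_lt; first exact: le_lt_trans kr2.
      by rewrite absvX ltr_pXn2r ?nnegrE ?absv_ge0.
    + rewrite ler_pdivrMr// -expr2; apply: absvB_le; first exact: le_trans (ltW kr2).
      by rewrite absvX lerXn2r ?nnegrE ?absv_ge0.
    + rewrite ler_pdivrMr// -expr2; apply: absvB_le; first exact: le_trans (ltW kr2).
      by rewrite absvX lerXn2r ?nnegrE ?absv_ge0.
  apply/esym/fc => i j; apply: (@le_lt_trans _ _ (absv (k * r))); last exact: lt_trans rd.
  have [u00 u01 u10 u11] := unip_eltE a x0.
  have tk : absv t <= absv (k * r).
    have : absv t <= absv (k * r) ^+ 2.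
      by apply: le_trans tc; rewrite ler_peMr ?absv_ge0.
    move=> /le_trans; apply; rewrite expr2 ler_piMl ?absv_ge0//.
    by apply: le_trans r1; exact: ltW.
  move: i j; do 2 apply: ord2P; rewrite ?u00 ?u01 ?u10 ?u11//.
  + by rewrite opprD addrA.
  (* The lower left entries [(t * z 0 0 - A^2) / z 0 1] and [- a^2 / x] are compared over a common
     denominator of size [|x|^2]; each term of the numerator is at most [|k r| |x|^2]. *)
  + have -> : z 1 0 - - (a ^+ 2 / x) = (t * z 0 0 * x - ((A - a) * (A + a) * x +
        a ^+ 2 * (x - z 0 1))) / (z 0 1 * x).
      have -> : z 1 0 = (t * z 0 0 - A ^+ 2) / z 0 1 by rewrite -F0 mulrC mulKf.
      by field; rewrite x0 B0.
    rewrite absv_div absvM Bx ler_pdivrMr ?mulr_gt0//.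
    apply: absvB_le; last apply: absvD_le.
    * rewrite absvM mulrA ler_wpM2r ?absv_ge0//; apply: le_trans tx _.
      by rewrite expr2 ler_wpM2l ?absv_ge0// ltW.
    * rewrite !absvM mulrA ler_wpM2r ?absv_ge0//; apply: ler_pM; rewrite ?absv_ge0//.
      by rewrite -absvM; exact: hA.
      by apply: absvD_le => //; exact: lteifW ax.
    * rewrite absvM mulrC absv_distC; apply: ler_pM; rewrite ?absv_ge0//.
      by rewrite absvX -expr2 lerXn2r ?nnegrE ?absv_ge0//; exact: lteifW ax.
  + have -> : z 1 1 - (1 - a) = t - (A - a) by rewrite /t /A; ring.
    exact: absvB_le.
- move=> fz /andP[rB CB].
  have zc := fb z fz.
  have Ac : absv A <= absv c by apply: absvB_le; rewrite ?absv1.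
  have [a aL aA] := Le A Ac; have [x xL xB] := Le (z 0 1) (zc 0 1).
  exists (a, x); last by split.
  have krB := lt_trans kr rB.
  have xB' : absv x = absv (z 0 1) by apply: (absv_close_le _ krB); rewrite absv_distC.
  rewrite LP aL xL /= /wcond xB' rB /=.
  have kr2 : absv (k * r) ^+ 2 < absv (z 0 1) ^+ 2.
    by rewrite ltr_pXn2r ?nnegrE ?absv_ge0.
  have tz : absv (t * z 0 0) < absv (z 0 1) ^+ 2.
    apply: le_lt_trans kr2; rewrite absvM; apply: le_trans tc.
    by rewrite ler_wpM2l ?absv_ge0.
  have A2 : A ^+ 2 = t * z 0 0 - z 0 1 * z 1 0 by rewrite F0; ring.
  have -> : a = A - (A - a) by rewrite subKr.
  case: strict CB {LP L small} => /= CB.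
    apply: absvB_lt; last exact: le_lt_trans aA krB.
    rewrite -(@ltr_pXn2r _ 2) ?nnegrE ?absv_ge0// -absvX A2; apply: absvB_lt => //.
    by rewrite absvM expr2 ltr_pM2l// (lt_trans ar0).
  apply: absvB_le; last exact/ltW/(le_lt_trans aA).
  rewrite -(@ler_pXn2r _ 2) ?nnegrE ?absv_ge0// -absvX A2; apply: absvB_le; first exact: ltW.
  by rewrite absvM expr2 ler_wpM2l ?absv_ge0.
Qed.

End decomposition.

(** * Combining boxes with their Weyl conjugates *)

Section full_decomposition.
Context {R : realType} {F : naLocalFieldType R}.
Implicit Types (f : SL2 F -> R[i]) (z : SL2 F) (a x r u : F).

Definition conj_rep (b : bool) : SL2 (valring F) := if b then weyl else 1%g.

Lemma SL2_incl_conj_rep b : SL2_incl (conj_rep b) = if b then weyl else 1%g.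
Proof.
case: b; last by apply: SL2P; rewrite SL2_inclE !SL2_oneE ?rmorph1 ?rmorph0.
by apply: SL2P; rewrite SL2_inclE !weylE ?rmorph1 ?rmorph0 ?rmorphN1.
Qed.

Lemma weyl_conjE z : (weyl * z * weyl^-1)%g = sl2 (z 1 1) (- z 1 0) (- z 0 1) (z 0 0).
Proof.
have d : z 1 1 * z 0 0 - - z 1 0 * - z 0 1 = 1 by rewrite -(SL2_det z); ring.
by apply: SL2P; rewrite !SL2_mulE !SL2_invE !weylE sl2E// !mx2E; ring.
Qed.

Lemma weyl_conjE' z : (weyl * z * weyl^-1)%g = (weyl^-1 * z * weyl)%g.
Proof. by apply: SL2P; rewrite !SL2_mulE !SL2_invE !weylE; ring. Qed.

Lemma weyl_conj_entries z (z' := (weyl * z * weyl^-1)%g) :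
  [/\ z' 0 0 = z 1 1, z' 0 1 = - z 1 0, z' 1 0 = - z 0 1 & z' 1 1 = z 0 0].
Proof.
have d : z 1 1 * z 0 0 - - z 1 0 * - z 0 1 = 1 by rewrite -(SL2_det z); ring.
by rewrite /z' weyl_conjE sl2E// !mx2E.
Qed.

Lemma unif_locconst_weyl f d c : unif_locconst f d c ->
  unif_locconst (fun z => f (weyl^-1 * z * weyl)%g) d c.
Proof.
move=> [fc c1 fb]; split=> // [z z' zz'|z fz].
  apply: fc; rewrite -!weyl_conjE'.
  have [e1 e2 e3 e4] := weyl_conj_entries z; have [e1' e2' e3' e4'] := weyl_conj_entries z'.
  by do 2 apply: ord2P; rewrite ?e1 ?e2 ?e3 ?e4 ?e1' ?e2' ?e3' ?e4' -?opprD ?absvN; exact: zz'.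
have := fb _ fz; rewrite -weyl_conjE' => h.
have [e1 e2 e3 e4] := weyl_conj_entries z.
have h00 := h 0 0; have h01 := h 0 1; have h10 := h 1 0; have h11 := h 1 1.
rewrite e1 in h00; rewrite e2 absvN in h01; rewrite e3 absvN in h10; rewrite e4 in h11.
by do 2 apply: ord2P.
Qed.

Definition wcoef f (l : bool * (F * F)) : R[i] :=
  f ((SL2_incl (conj_rep l.1))^-1 * unip_elt l.2.1 l.2.2 * SL2_incl (conj_rep l.1))%g.

Lemma near_wball z (c r k : F) : 1 <= absv c -> absv r <= 1 -> absv k < 1 ->
  absv (z 0 0 + z 1 1 - 2%:R) * absv c <= absv (k * r) ^+ 2 -> absv (z 0 0) <= absv c ->
  absv (z 0 1) <= absv r -> absv (z 1 0) <= absv r -> wball r z.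
Proof.
move=> c1 r1 k1 tc z00 z01 z10; set t := _ - 2%:R in tc.
have krr : absv (k * r) ^+ 2 <= absv r ^+ 2.
  by rewrite lerXn2r ?nnegrE ?absv_ge0// absvM ler_piMl ?absv_ge0// ltW.
have tr : absv t <= absv r.
  apply: (@le_trans _ _ (absv t * absv c)); first by rewrite ler_peMr ?absv_ge0.
  by apply: (le_trans tc); apply: (le_trans krr); rewrite expr2 ler_piMl ?absv_ge0.
have Ar : absv (z 0 0 - 1) <= absv r.
  rewrite -(@ler_pXn2r _ 2) ?nnegrE ?absv_ge0// -absvX.
  have -> : (z 0 0 - 1) ^+ 2 = t * z 0 0 - z 0 1 * z 1 0 by rewrite near_unipotent /t; ring.
  apply: absvB_le; last by rewrite absvM expr2 ler_pM ?absv_ge0.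
  by rewrite absvM (le_trans _ krr)// (le_trans _ tc)// ler_wpM2l ?absv_ge0.
do 2 apply: ord2P; rewrite SL2_oneE ?subr0//.
have -> : z 1 1 - 1 = t - (z 0 0 - 1) by rewrite /t; ring.
exact: absvB_le.
Qed.

(** On the support of [f], if both off-diagonal entries are at most [|r|], the trace condition
    forces [z] into the ball around 1. Otherwise the larger one is at the upper right, for [z] or
    for its Weyl conjugate. *)
Lemma orbital_decomposition f d c r k : unif_locconst f d c ->
  r != 0 -> k != 0 -> absv r < d -> absv r <= 1 -> absv k < 1 ->
  exists L : seq (bool * (F * F)),
  (forall l, l \in L -> absv r < absv l.2.2 /\ absv l.2.1 <= absv l.2.2) /\
  forall z, absv (z 0 0 + z 1 1 - 2%:R) * absv c <= absv (k * r) ^+ 2 ->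
    f z = f 1%g * (`[< wball r z >]%:R : R)%:C +
      \sum_(l <- L) wcoef f l * (`[< wbox l.2.1 l.2.2 (k * r)
        (SL2_incl (conj_rep l.1) * z * (SL2_incl (conj_rep l.1))^-1)%g >]%:R : R)%:C.
Proof.
move=> uf r0 k0 rd r1 k1.
have [L1 [L1c L1s]] := wbox_decomposition false uf r0 k0 rd r1 k1.
have [L2 [L2c L2s]] :=
  wbox_decomposition true (unif_locconst_weyl uf) r0 k0 rd r1 k1.
have [fc c1 fb] := uf.
exists ([seq (false, l) | l <- L1] ++ [seq (true, l) | l <- L2]); split.
  move=> [b l]; rewrite mem_cat => /orP[/mapP[l' l'L [_ ->]]|/mapP[l' l'L [_ ->]]].
    by have /andP[? h] := L1c _ l'L; split=> //; exact: lteifW h.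
  by have /andP[? h] := L2c _ l'L; split=> //; exact: lteifW h.
move=> z zc; rewrite big_cat !big_map /=.
under eq_bigr => l _ do rewrite /wcoef SL2_incl_conj_rep /= invg1 mul1g mulg1 mul1g mulg1.
rewrite L1s//.
under eq_bigr => l _ do rewrite /wcoef SL2_incl_conj_rep /=.
have [e1 e2 e3 e4] := weyl_conj_entries z.
rewrite (L2s (weyl * z * weyl^-1)%g); last by rewrite e1 e4 [z 1 1 + _]addrC.
rewrite e2 e3 !absvN /= -weyl_conjE' => {L1 L2 L1c L2c L1s L2s}.
have -> : (weyl * (weyl * z * weyl^-1) * weyl^-1)%g = z.
  by rewrite weyl_conjE' !mulgA mulVg mul1g -mulgA mulVg mulg1.
have ar0 : 0 < absv r by rewrite absv_gt0.
case: asboolP => [W|nW].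
  have h i j : (1%g : SL2 F) i j = 0 -> absv (z i j) <= absv r.
    by move=> e; have := W i j; rewrite e subr0.
  have -> : f z = f 1%g by apply: fc => i j; apply: le_lt_trans rd.
  have h01 : absv (z 0 1) <= absv r by apply: h; rewrite SL2_oneE.
  have h10 : absv (z 1 0) <= absv r by apply: h; rewrite SL2_oneE.
  by rewrite !ltNge h01 h10 /= !addr0 mulr1.
rewrite mulr0 add0r.
have [fz|fz] := eqVneq (f z) 0; first by rewrite fz !if_same addr0.
have [BC|CB] := leP (absv (z 1 0)) (absv (z 0 1)).
  rewrite andbT andbF addr0; case: ifPn => //; rewrite -leNgt => Br; exfalso.
  by apply: nW; apply: (near_wball c1 r1 k1 zc) => //; [exact: fb|exact: le_trans BC Br].
rewrite andbF andbT add0r; case: ifPn => //; rewrite -leNgt => Cr; exfalso.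
apply: nW; apply: (near_wball c1 r1 k1 zc) => //; first exact: fb.
by apply: le_trans Cr; exact: ltW.
Qed.

End full_decomposition.

(** * Orbital integrals *)

Section torus_side.
Context {R : realType} {F : naLocalFieldType R}.
Variables (s n : F) (T : set (SL2 F)).
Local Notation nf := (nform s n).
Hypothesis torusP : forall t, T t <-> exists x y, nf x y = 1 /\ slmx t = mx2 x (- (n * y)) y (x + s * y).
Implicit Types (q : coset_space T) (f : SL2 F -> R[i]) (x : SL2 F).

Definition tconj (t : SL2 F) q : SL2 F := ((coset_repr q)^-1 * t * coset_repr q)%g.

Lemma torus_comm t t' : T t -> T t' -> (t * t' = t' * t)%g.
Proof.
move=> /torusP[x [y [_ te]]] /torusP[x' [y' [_ te']]].
by apply: SL2P; rewrite !SL2_mulE te te' !mx2E; ring.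
Qed.

Lemma tconj_act t g q : T t -> tconj t (coset_act g q) = (g^-1 * tconj t q * g)%g.
Proof.
move=> Tt; rewrite /tconj; have [t' Tt' ->] := coset_repr_pi torusP (coset_repr q * g)%g.
rewrite !invMg !mulgA; congr (_ * _ * _)%g.
by rewrite -[LHS]mulgA (torus_comm Tt Tt') mulgA mulgKV.
Qed.

Lemma tconjE t (a b : F) q : slmx t = mx2 a (- (n * b)) b (a + s * b) ->
  [/\ tconj t q 0 0 = a + b * Aq s n q, tconj t q 0 1 = b * Bq s n q,
      tconj t q 1 0 = b * Cq s n q & tconj t q 1 1 = a + b * (s - Aq s n q)].
Proof.
move=> te; rewrite /tconj /Aq /Bq /Cq /Ac /Bc /Cc /nform.
rewrite !SL2_mulE !SL2_invE te !mx2E; set x := coset_repr q.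
have det0 u v w : u - v = w * (x 0 0 * x 1 1 - x 0 1 * x 1 0 - 1) -> u = v.
  by rewrite SL2_det subrr mulr0 => /eqP; rewrite subr_eq0 => /eqP.
by split; [apply: (det0 _ _ a)|idtac|idtac|apply: (det0 _ _ (a + s * b))]; ring.
Qed.

End torus_side.

(** * The orbital integral of a torus element as a finite sum *)

Section orbital_integral.
Context {R : realType} {F : naLocalFieldType R}.
Variables (s n : F) (T : set (SL2 F)).
Local Notation nf := (nform s n).
Hypothesis nform_eq0 : forall x y, nf x y = 0 -> x = 0 /\ y = 0.
Hypothesis torusP : forall t, T t <-> exists x y, nf x y = 1 /\ slmx t = mx2 x (- (n * y)) y (x + s * y).
Variable mu : {measure set (borel (coset_space T)) -> \bar R}.
Hypothesis haarT : haar_coset mu.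
Implicit Types (q : coset_space T) (f : SL2 F -> R[i]) (x : SL2 F) (l : bool * (F * F)).

Lemma sl_cts_mulr (f : SL2 F -> F) (g : SL2 F) :
  sl_cts f -> sl_cts (fun x => f (x * g)%g).
Proof.
move=> cf x e e0; have [d d0 hd] := cf (x * g)%g e e0.
have c i j : sl_cts (fun x => (x * g)%g i j).
  have -> : (fun x => (x * g)%g i j) = (fun x => x i 0 * g 0 j + x i 1 * g 1 j).
    by apply/funext=> y; rewrite SL2_mulE.
  by apply: sl_ctsD; apply: sl_ctsM; do ?[exact: sl_cts_entry|exact: sl_cts_cst].
have [d1 d10 h1] := c 0 0 x d d0; have [d2 d20 h2] := c 0 1 x d d0.
have [d3 d30 h3] := c 1 0 x d d0; have [d4 d40 h4] := c 1 1 x d d0.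
exists (Num.min (Num.min d1 d2) (Num.min d3 d4)); first by rewrite !lt_min d10 d20 d30.
move=> y xy; apply: hd; do 2 apply: ord2P; [apply: h1|apply: h2|apply: h3|apply: h4] => i j;
  by apply: lt_le_trans (xy i j) _; rewrite !ge_min lexx ?orbT.
Qed.

Lemma open_coset_act_qbox (g : SL2 F) (a r b e : F) : r != 0 -> e != 0 ->
  open (coset_act g @^-1` qbox s n a r b e : set (coset_space T)).
Proof.
move=> r0 e0; apply: open_coset_space; have [cA cB _] := sl_cts_coords s n.
have -> : [set x | (coset_act g @^-1` qbox s n a r b e) (coset_pi T x)] =
    [set x | absv (Ac s n (x * g)%g - a) <= absv r] `&`
    [set x | absv (Bc s n (x * g)%g - b) <= absv e].
  have E x : coset_act g (coset_pi T x) = coset_pi T (coset_repr (coset_pi T x) * g)%g by [].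
  apply/seteqP; split=> x; rewrite /qbox /preimage /=;
    have [t Tt e1] := coset_repr_pi torusP x; rewrite E e1 -mulgA;
    have [-> -> _] := coords_pi torusP (t * (x * g))%g;
    have [-> -> _] := torus_coords torusP (x * g)%g Tt => //.
by apply: openI; apply: sl_cts_open_ball => //; exact: sl_cts_mulr.
Qed.

Section fixed_torus_element.
Variables (t : SL2 F) (a b : F).
Hypotheses (Tt : T t) (te : slmx t = mx2 a (- (n * b)) b (a + s * b)) (b0 : b != 0).

(** Left unevaluated: it multiplies [f 1] and ends up in the first germ. *)
Definition ball_mass (r : F) : R := fine (mu [set q | wball r (tconj t q)]).

Lemma wbox_tconj (a0 x0 r : F) q :
  wbox a0 x0 r (tconj t q) <-> qbox s n ((1 + a0 - a) / b) (r / b) (x0 / b) (r / b) q.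
Proof.
have [e1 e2 _ _] := tconjE q te; rewrite /wbox /qbox /= e1 e2 !absv_div.
have -> : a + b * Aq s n q - 1 - a0 = b * (Aq s n q - (1 + a0 - a) / b) by field.
have -> : b * Bq s n q - x0 = b * (Bq s n q - x0 / b) by field.
by rewrite !absvM !ler_pdivlMr ?absv_gt0// ![absv b * _]mulrC.
Qed.

Lemma open_wball_tconj (r : F) : r != 0 ->
  open ([set q | wball r (tconj t q)] : set (coset_space T)).
Proof.
move=> r0; apply: open_coset_space; have [cA cB cC] := sl_cts_coords s n.
have -> : [set x | [set q | wball r (tconj t q)] (coset_pi T x)] =
    [set x | absv (a + b * Ac s n x - 1) <= absv r] `&`
    ([set x | absv (b * Bc s n x - 0) <= absv r] `&`
    ([set x | absv (b * Cc s n x - 0) <= absv r] `&`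
     [set x | absv (a + b * (s + - Ac s n x) - 1) <= absv r])).
  apply/seteqP; split=> x; rewrite /wball /=; have [e1 e2 e3 e4] := tconjE (coset_pi T x) te;
    have [cA' cB' cC'] := coords_pi torusP x; rewrite cA' cB' cC' in e1 e2 e3 e4.
    move=> h; have := h 0 0; have := h 0 1; have := h 1 0; have := h 1 1.
    by rewrite !SL2_oneE e1 e2 e3 e4.
  by move=> [h1 [h2 [h3 h4]]]; do 2 apply: ord2P; rewrite !SL2_oneE ?e1 ?e2 ?e3 ?e4.
have c0 (u : F) : sl_cts (fun=> u) by exact: sl_cts_cst.
by do ?apply: openI; apply: sl_cts_open_ball => //; do ?[exact: c0|exact: cA|exact: cB|exact: cC|apply: sl_ctsN|apply: sl_ctsD|apply: sl_ctsM].
Qed.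

Lemma wball_tconj_fin (r : F) : r != 0 -> (mu [set q | wball r (tconj t q)] < +oo)%E.
Proof.
move=> r0; have [c c0] := @absv_ex_big R F (Num.max (absv r) (absv (a - 1)) / absv b).
rewrite ler_pdivrMr ?absv_gt0// ge_max => /andP[cr ca].
apply: (qbounded_sub_fin nform_eq0 torusP haarT c0).
  by apply: open_measurable; exact: open_wball_tconj.
move=> q /= W; have [e1 e2 e3 e4] := tconjE q te.
have := W 0 0; have := W 0 1; have := W 1 0.
rewrite !SL2_oneE e1 e2 e3 !subr0 => h3 h2 h1.
have key (u : F) : absv (b * u) <= absv c * absv b -> absv u <= absv c.
  by rewrite absvM mulrC ler_pM2r ?absv_gt0.
split; apply: key; [|exact: le_trans cr|exact: le_trans cr].
have -> : b * Aq s n q = (a + b * Aq s n q - 1) - (a - 1) by ring.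
by apply: absvB_le; [exact: le_trans cr|].
Qed.

Variables (cX : R) (z0 : F).
Hypothesis z01 : absv z0 < 1.
Hypothesis qbox_massE : forall a r b e, r != 0 -> e != 0 -> b != 0 ->
  absv e <= absv (z0 * b) -> fine (mu (qbox s n a r b e)) =
    if `[< is_norm s n (- b) >] then cX * (absv r * absv e / absv b) else 0.

(** The value of [qbox_massE] for the center [x / b] and both radii [r / b]; the center in [A] has
    no influence. *)
Definition box_mass (x r : F) : R :=
  if `[< is_norm s n (- (x / b)) >] then cX * (absv r ^+ 2 / (absv b * absv x)) else 0.

Lemma orbint_decomposition f (r k : F) (L : seq (bool * (F * F))) :
  r != 0 -> k != 0 -> absv k <= absv z0 -> (forall l, l \in L -> absv r < absv l.2.2) ->
  (forall q, f (tconj t q) = f 1%g * (`[< wball r (tconj t q) >]%:R : R)%:C +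
      \sum_(l <- L) wcoef f l * (`[< wbox l.2.1 l.2.2 (k * r)
        (SL2_incl (conj_rep l.1) * tconj t q * (SL2_incl (conj_rep l.1))^-1)%g >]%:R : R)%:C) ->
  orbint mu t f = f 1%g * (ball_mass r)%:C +
    \sum_(l <- L) wcoef f l * (box_mass l.2.2 (k * r))%:C.
Proof.
move=> r0 k0 kz Lr fE.
pose g l : SL2 F := ((SL2_incl (conj_rep l.1))^-1)%g.
pose Q l : set (coset_space T) :=
  qbox s n ((1 + l.2.1 - a) / b) (k * r / b) (l.2.2 / b) (k * r / b).
pose A (i : option (bool * (F * F))) : set (borel (coset_space T)) :=
  if i is Some l then coset_act (g l) @^-1` Q l else [set q | wball r (tconj t q)].
pose C i := if i is Some l then wcoef f l else f 1%g.
have krb0 : k * r / b != 0 by rewrite !mulf_neq0 ?invr_neq0.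
have small l : l \in L -> absv (k * r / b) <= absv (z0 * (l.2.2 / b)).
  move=> lL; rewrite mulrA !absv_div ler_wpM2r ?invr_ge0 ?absv_ge0// !absvM.
  by rewrite ler_pM ?absv_ge0// ltW// Lr.
have x0 l : l \in L -> l.2.2 != 0.
  by move=> lL; rewrite -absv_gt0 (le_lt_trans _ (Lr l lL))// absv_ge0.
have mQ l : measurable (Q l : set (borel (coset_space T))).
  exact: (measurable_qbox torusP).
have [_ _ inv] := haarT.
have muA l : mu (A (Some l)) = mu (Q l) by exact: (inv (g l) _ (mQ l)).
rewrite /orbint (@cintegral_simple _ _ _ _ _ (None :: map Some L) C A).
- rewrite big_cons big_map; congr (_ + _).
  rewrite big_seq [RHS]big_seq; apply: eq_bigr => l lL.
  rewrite muA qbox_massE ?mulf_neq0 ?invr_neq0 ?x0 ?small// /C /box_mass.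
  case: ifP => // _; congr (_ * (cX * _)%:C); rewrite !absv_div; field.
  by rewrite !absv_eq0E b0 x0.
- move=> q /=; rewrite -/(tconj t q) fE big_cons big_map; congr (_ * _%:C + _).
  apply: eq_bigr => l _; congr (_ * _%:C); rewrite indicE; congr (_%:R).
  congr (nat_of_bool _); apply/idP/idP => [/asboolP h|]; last rewrite inE => h; rewrite ?inE.
    by apply/wbox_tconj; rewrite (tconj_act torusP)// /g invgK.
  have := (wbox_tconj _ _ _ _).2 h.
  by rewrite (tconj_act torusP)// /g invgK.
- move=> [l|] iL; last first.
    split; [apply: open_measurable; exact: open_wball_tconj|exact: wball_tconj_fin].
  have /mapP[l' l'L [ll']] : Some l \in map Some L by move: iL; rewrite in_cons.
  rewrite -ll' in l'L; rewrite muA; split.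
    by apply: open_measurable; exact: open_coset_act_qbox.
  apply: (qbox_fin nform_eq0 torusP haarT) => //; apply: le_lt_trans (small _ l'L) _.
  by rewrite absvM gtr_pMl// absv_gt0 mulf_neq0 ?invr_neq0// x0.
Qed.

End fixed_torus_element.
End orbital_integral.

(** * Unipotent orbital integrals *)

Section unipotent_conjugates.
Context {R : realType} {F : naLocalFieldType R}.
Implicit Types (k : SL2 (valring F)) (a x e r n : F).

Lemma SL2_incl_row k : absv (SL2_incl k 1 1) < 1 -> absv (SL2_incl k 1 0) = 1.
Proof.
move=> p1; apply/eqP; rewrite eq_le SL2_incl_le1 leNgt; apply/negP => r1.
have : absv (1 : F) < 1; last by rewrite absv1 ltxx.
rewrite -(SL2_det (SL2_incl k)); apply: absvB_lt.
  by rewrite absvM mulrC; apply: le_lt_trans p1; rewrite ler_piMr ?absv_ge0 ?SL2_incl_le1.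
by rewrite absvM mulrC; apply: le_lt_trans r1; rewrite ler_piMr ?absv_ge0 ?SL2_incl_le1.
Qed.

Lemma unip_conjE (p : SL2 F) n (z := (p^-1 * unip n * p)%g) :
  [/\ z 0 0 = 1 + n * (p 1 0 * p 1 1), z 0 1 = n * p 1 1 ^+ 2,
      z 1 0 = - (n * p 1 0 ^+ 2) & z 1 1 = 1 - n * (p 1 0 * p 1 1)].
Proof.
have d : p 0 0 * p 1 1 = 1 + p 0 1 * p 1 0 by rewrite -(SL2_det p) subrK.
rewrite /z !SL2_mulE !SL2_invE !unipE; split; try by ring.
  transitivity (p 0 0 * p 1 1 - p 0 1 * p 1 0 + n * (p 1 0 * p 1 1)); first by ring.
  by rewrite SL2_det.
transitivity (p 0 0 * p 1 1 - p 0 1 * p 1 0 - n * (p 1 0 * p 1 1)); first by ring.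
by rewrite SL2_det.
Qed.

(** One of the two entries in the bottom row of [p] is a unit, so [n] can be read off the
    off-diagonal entries. *)
Lemma wball_unip k n r (p := SL2_incl k) :
  wball r (p^-1 * unip n * p)%g <-> absv n <= absv r.
Proof.
have [e00 e01 e10 e11] := unip_conjE p n.
have le1 i j : absv (p i j) <= 1 by exact: SL2_incl_le1.
split=> [W|nr].
  have := W 0 1; have := W 1 0; rewrite e01 e10 !SL2_oneE !subr0 absvN => h10 h01.
  have [u1|u1] := ltP (absv (p 1 1)) 1.
    by move: h10; rewrite absvM absvX /p SL2_incl_row// expr1n mulr1.
  have u : absv (p 1 1) = 1 by apply/le_anti; rewrite le1.
  by move: h01; rewrite absvM absvX u expr1n mulr1.
have small (v : F) : absv v <= 1 -> absv (n * v) <= absv r.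
  by move=> v1; apply: le_trans nr; rewrite absvM ler_piMr ?absv_ge0.
have m2 (u v : F) : absv u <= 1 -> absv v <= 1 -> absv (u * v) <= 1.
  by move=> u1 v1; rewrite absvM mulr_ile1 ?absv_ge0.
do 2 apply: ord2P; rewrite ?e00 ?e01 ?e10 ?e11 !SL2_oneE ?subr0 ?absvN.
- by rewrite addrAC subrr add0r; apply/small/m2.
- by rewrite expr2; apply/small/m2.
- by rewrite expr2; apply/small/m2.
- by rewrite addrAC subrr add0r absvN; apply/small/m2.
Qed.

(** The box separates the variables: [k] is confined to a coset of a congruence subgroup, where
    [p 1 1] is a unit, and [n] to a ball whose radius does not depend on [k]. *)
Lemma wbox_unip k n a x e (p := SL2_incl k) :
  absv e < absv x -> absv a <= absv x ->
  wbox a x e (p^-1 * unip n * p)%g <->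
  [/\ absv (p 1 1) = 1, absv (p 1 0 - a / x * p 1 1) <= absv (e / x) &
      absv (n - x / p 1 1 ^+ 2) <= absv e].
Proof.
move=> ex ax; have [e00 e01 _ _] := unip_conjE p n.
have ax0 : 0 < absv x by exact: le_lt_trans (absv_ge0 _) ex.
have x0 : x != 0 by rewrite -absv_gt0.
have le1 i j : absv (p i j) <= 1 by exact: SL2_incl_le1.
have row : absv (p 1 1) < 1 -> absv (p 1 0) = 1 by exact: SL2_incl_row.
rewrite /wbox /= e00 e01; set u := p 1 1 in row *; set v := p 1 0 in row *.
have -> : 1 + n * (v * u) - 1 - a = n * (v * u) - a by ring.
have u1 : absv u <= 1 by exact: le1.
have axle : absv (a / x) <= 1 by rewrite absv_div ler_pdivrMr// mul1r.
split=> [[h1 h2]|[u_1 h1 h2]].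
  have nu : absv (n * u ^+ 2) = absv x by exact: absv_close_le h2 ex.
  have uE : absv u = 1.
    apply/eqP; rewrite eq_le u1 leNgt; apply/negP => ult.
    have au0 : 0 < absv u.
      by rewrite absv_gt0; apply: contraTneq ax0 => u0; rewrite -nu u0 expr0n mulr0 absv0 ltxx.
    have : absv (n * (v * u)) <= absv x.
      rewrite -(subrK a (n * _)); apply: absvD_le => //.
      exact: le_trans h1 (ltW ex).
    rewrite leNgt => /negP; apply; rewrite -nu [absv (n * u ^+ 2)]absvM absvX !absvM row// mul1r expr2 mulrA.
    rewrite gtr_pMr// mulr_gt0// absv_gt0; apply: contraTneq ax0 => n0.
    by rewrite -nu n0 mul0r absv0 ltxx.
  have u0 : u != 0 by rewrite -absv_gt0 uE.
  have nx : absv n = absv x by rewrite -nu absvM absvX uE expr1n mulr1.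
  have n0 : n != 0 by rewrite -absv_gt0 nx.
  split=> //.
    have -> : v - a / x * u = ((n * (v * u) - a) - a / x * (n * u ^+ 2 - x)) / (n * u).
      by field; rewrite x0 n0 u0.
    rewrite [leLHS]absv_div [absv (n * u)]absvM nx uE mulr1 absv_div ler_pM2r ?invr_gt0//.
    apply: absvB_le => //; rewrite absvM -[leRHS]mul1r.
    by rewrite ler_pM ?absv_ge0.
  have -> : n - x / u ^+ 2 = (n * u ^+ 2 - x) / u ^+ 2 by field.
  by rewrite absv_div absvX uE expr1n divr1.
have u0 : u != 0 by rewrite -absv_gt0 u_1.
have hn : absv (n * u ^+ 2 - x) <= absv e.
  have -> : n * u ^+ 2 - x = (n - x / u ^+ 2) * u ^+ 2 by field.
  by rewrite absvM absvX u_1 expr1n mulr1.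
have nx : absv n = absv x.
  have := absv_close_le hn ex.
  by rewrite absvM absvX u_1 expr1n mulr1.
split=> //.
have -> : n * (v * u) - a = n * u * (v - a / x * u) + a / x * (n * u ^+ 2 - x) by field.
apply: absvD_le; rewrite absvM.
  rewrite [absv (n * u)]absvM nx u_1 mulr1 mulrC.
  by apply: le_trans (ler_wpM2r _ h1) _; rewrite ?absv_ge0// -absvM divfK.
by rewrite -[leRHS]mul1r ler_pM ?absv_ge0.
Qed.

End unipotent_conjugates.

Section unipotent_orbital_integral.
Context {R : realType} {F : naLocalFieldType R}.
Variable muF : {measure set (borel F) -> \bar R}.
Hypothesis haarF : haar_add muF.
Variable muK : {measure set (borel (SL2 (valring F))) -> \bar R}.
Hypothesis haarK : haar_SL2 muK.
Implicit Types (k : SL2 (valring F)) (f : SL2 F -> R[i]) (l : bool * (F * F)) (r e n : F).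

Definition mass_ringF : R := fine (muF (fball 0 1)).
(** The mass of a [hecke_coset] divided by [|e|], that is [q] times the mass of the Iwahori
    subgroup. *)
Definition mass_iwahori : R := fine (muK setT) / (1 + absv (unif F)).

Definition box_coset l (e : F) : set (SL2 (valring F)) :=
  hecke_coset (lowu (to_valring (l.2.1 / l.2.2)%R) * conj_rep l.1)%g (e / l.2.2).

Lemma box_cosetE l e k (p := SL2_incl (k * (conj_rep l.1)^-1)%g) :
  absv l.2.1 <= absv l.2.2 -> l.2.2 != 0 ->
  box_coset l e k <-> absv (p 1 0 - l.2.1 / l.2.2 * p 1 1) <= absv (e / l.2.2).
Proof.
move=> ax x0; set y := l.2.1 / l.2.2.
have <- : SL2_incl (k * (lowu (to_valring y) * conj_rep l.1)^-1)%g 1 0 = p 1 0 - y * p 1 1.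
  rewrite invgM mulgA SL2_inclM SL2_mulE SL2_inclV !SL2_invE.
  rewrite -/p !(SL2_inclE (lowu _)) !lowuE rmorph1 mulr1 mulrN [y * _]mulrC to_valringK//.
  by rewrite absv_div ler_pdivrMr ?absv_gt0// mul1r.
by [].
Qed.

Lemma box_coset_unit l e k (p := SL2_incl (k * (conj_rep l.1)^-1)%g) :
  absv l.2.1 <= absv l.2.2 -> absv e < absv l.2.2 -> box_coset l e k -> absv (p 1 1) = 1.
Proof.
move=> ax ex; have ax0 : 0 < absv l.2.2 by exact: le_lt_trans (absv_ge0 _) ex.
have x0 : l.2.2 != 0 by rewrite -absv_gt0.
move/(box_cosetE _ _ ax x0); rewrite -/p => h.
apply/eqP; rewrite eq_le SL2_incl_le1 leNgt; apply/negP => u1.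
suff : absv (p 1 0) < 1 by rewrite SL2_incl_row// ltxx.
rewrite -(subrK (l.2.1 / l.2.2 * p 1 1) (p 1 0)); apply: absvD_lt.
  by apply: le_lt_trans h _; rewrite absv_div ltr_pdivrMr// mul1r.
apply: le_lt_trans u1; rewrite absvM ler_piMl ?absv_ge0//.
by rewrite absv_div ler_pdivrMr// mul1r.
Qed.

Variable chi : F -> R[i].

(** In the term of a box the inner integral contributes the ball of radius [|e|], the outer one a
    coset of level [e / x]; whence [|e|^2 / |x|]. The data [D], [d], [B] write [chi] on the ball of
    radius [|r|] as a combination of indicators. *)
Lemma unip_orbint_decomposition f (r z0 : F) (L : seq (bool * (F * F)))
    (D : seq bool) (d : bool -> R[i]) (B : bool -> set F) :
  r != 0 -> z0 != 0 -> absv z0 < 1 ->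
  (forall x y, x != 0 -> absv (y - x) <= absv (z0 * x) -> chi y = chi x) ->
  (forall x y, y != 0 -> chi (x / y ^+ 2) = chi x) ->
  (forall n, chi n * (`[< absv n <= absv r >]%:R : R)%:C = \sum_(i <- D) d i * (\1_(B i) n)%:C) ->
  (forall i, i \in D -> measurable (B i : set (borel F)) /\ (muF (B i) < +oo)%E) ->
  (forall l, l \in L -> absv r < absv l.2.2 /\ absv l.2.1 <= absv l.2.2) ->
  (forall z : SL2 F, z 0 0 + z 1 1 = 2%:R ->
    f z = f 1%g * (`[< wball r z >]%:R : R)%:C +
      \sum_(l <- L) wcoef f l * (`[< wbox l.2.1 l.2.2 (z0 * r)
        (SL2_incl (conj_rep l.1) * z * (SL2_incl (conj_rep l.1))^-1)%g >]%:R : R)%:C) ->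
  unip_orbint muK muF chi f =
    f 1%g * (cintegral muF (fun n => chi n * (`[< absv n <= absv r >]%:R : R)%:C)
             * (fine (muK setT))%:C) +
    \sum_(l <- L) wcoef f l * chi l.2.2 *
      (mass_ringF * mass_iwahori * (absv (z0 * r) ^+ 2 / absv l.2.2))%:C.
Proof.
move=> r0 z00 z01 chi_close chi_sqr chiD mB Lr fE.
set e := z0 * r; have e0 : e != 0 by rewrite mulf_neq0.
have er : absv e < absv r by rewrite absvM gtr_pMl ?absv_gt0.
have ex l : l \in L -> absv e < absv l.2.2.
  by move=> /Lr[rx _]; exact: lt_trans rx.
have x0 l : l \in L -> l.2.2 != 0.
  by move=> /ex; rewrite -absv_gt0; apply: le_lt_trans; exact: absv_ge0.
set I := cintegral muF _.
pose u l k : F := SL2_incl (k * (conj_rep l.1)^-1)%g 1 1.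
have inner k : cintegral muF (fun n => let x := SL2_incl k in
    chi n * f (x^-1 * unip n * x)%g) = f 1%g * I +
    \sum_(l <- L) wcoef f l * chi l.2.2 * (mass_ringF * absv e)%:C *
      (\1_(box_coset l e) k)%:C.
  pose A (i : bool + bool * (F * F)) : set (borel F) :=
    match i with inl j => B j | inr l => fball (l.2.2 / u l k ^+ 2) e end.
  pose C (i : bool + bool * (F * F)) : R[i] :=
    match i with inl j => f 1%g * d j
    | inr l => wcoef f l * chi l.2.2 * (\1_(box_coset l e) k)%:C end.
  rewrite (@cintegral_simple _ _ _ _ _ (map inl D ++ map inr L) C A); first last.
  - move=> i; rewrite mem_cat => /orP[/mapP[j jD ->]|/mapP[l lL ->]]; first exact: mB.
    by split; [exact: measurable_fball|exact: haar_fball_fin].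
  - move=> n /=; have [z00E z01E z10E z11E] := unip_conjE (SL2_incl k) n.
    rewrite fE; last by rewrite z00E z11E; ring.
    rewrite mulrDr big_cat !big_map /=; congr (_ + _).
      rewrite mulrCA; under [RHS]eq_bigr do rewrite -mulrA.
      rewrite -mulr_sumr -chiD.
      by rewrite (asbool_equiv_eq (wball_unip k n r)).
    rewrite mulr_sumr big_seq [RHS]big_seq; apply: eq_bigr => l lL.
    have [rx ax] := Lr l lL.
    have -> : (SL2_incl (conj_rep l.1) * ((SL2_incl k)^-1 * unip n * SL2_incl k) *
        (SL2_incl (conj_rep l.1))^-1)%g =
        ((SL2_incl (k * (conj_rep l.1)^-1))^-1 * unip n * SL2_incl (k * (conj_rep l.1)^-1))%g.
      by rewrite SL2_inclM SL2_inclV invMg invgK !mulgA.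
    have H := wbox_unip (k * (conj_rep l.1)^-1)%g n (ex l lL) ax.
    have H' := @box_cosetE l e k ax (x0 l lL).
    rewrite !indicE; case: asboolP => [/H[u1 h1 h2]|W].
      rewrite mem_set; last exact/H'.
      rewrite mem_set// !mulr1 mulrC; congr (_ * _).
      (* The ball for [n] is centered at [x / u^2], where [chi] takes the same value as at [x], and
         its relative radius is small enough for [chi] to be constant. *)
      rewrite -(chi_sqr l.2.2 (u l k)); last by rewrite -absv_gt0 u1.
      apply: chi_close; first by rewrite mulf_neq0 ?x0 ?invr_neq0 ?expf_neq0// -absv_gt0 u1.
      apply: le_trans h2 _; rewrite /e absvM [leRHS]absvM ler_wpM2l ?absv_ge0//.
      by rewrite absv_div absvX u1 expr1n divr1 ltW.
    rewrite !mulr0 -mulrA -rmorphM -natrM mulnb.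
    suff -> : (k \in box_coset l e) && (n \in fball (l.2.2 / u l k ^+ 2) e) = false.
      by rewrite mulr0.
    apply/negP => /andP[/set_mem kb /set_mem nb]; apply: W; apply/H; split=> //.
      exact: box_coset_unit (ex l lL) kb.
    exact/H'.
  rewrite big_cat !big_map /=; congr (_ + _).
    under eq_bigr do rewrite -mulrA.
    rewrite -mulr_sumr /I.
    by rewrite (@cintegral_simple _ _ _ muF _ D d (B : bool -> set (borel F)) _ chiD mB).
  apply: eq_bigr => l _; rewrite haar_fball// -/mass_ringF mulrAC; congr (_ * _%:C * _).
  by rewrite mulrC.
pose A (i : option (bool * (F * F))) : set (borel (SL2 (valring F))) :=
  if i is Some l then box_coset l e else setT.
pose C (i : option (bool * (F * F))) : R[i] :=
  if i is Some l then wcoef f l * chi l.2.2 * (mass_ringF * absv e)%:C else f 1%g * I.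
have exx l : l \in L -> e / l.2.2 != 0 /\ absv (e / l.2.2) < 1.
  move=> lL; split; first by rewrite mulf_neq0 ?invr_neq0 ?x0.
  by rewrite absv_div ltr_pdivrMr ?absv_gt0 ?x0// mul1r ex.
rewrite /unip_orbint (@cintegral_simple _ _ _ _ _ (None :: map Some L) C A).
- rewrite big_cons big_map /= mulrA; congr (_ + _).
  rewrite big_seq [RHS]big_seq; apply: eq_bigr => l lL; have [h1 h2] := exx l lL.
  rewrite measure_hecke_coset// -/mass_iwahori absv_div /C -[LHS]mulrA -rmorphM; congr (_ * _%:C).
  by field; rewrite absv_eq0E x0.
- by move=> k; rewrite inner big_cons big_map /= indicT mulr1.
- move=> [l|] iL; last by split; [exact: measurableT|exact: muK_fin measurableT].
  have /mapP[l' l'L [ll']] : Some l \in map Some L by move: iL; rewrite in_cons.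
  have [h1 h2] := exx l' l'L; rewrite ll'.
  by split; [|apply: muK_fin => //]; exact: measurable_hecke_coset.
Qed.

End unipotent_orbital_integral.

(** * The quadratic extension *)

Section quadratic_extension.
Context {R : realType} {F : naLocalFieldType R} {E : splittingFieldType F}.
Variables (sigma : gal_of {:E}) (tau : E).
Hypothesis dimE : \dim {:E} = 2%N.
Hypothesis sepE : separable 1%VS {:E}.
Hypothesis sigmaG : sigma \in ('Gal({:E} / 1%VS))%g.
Hypothesis sigma1 : sigma != 1%g.
Hypothesis tauF : tau \notin 1%VS.
Implicit Types (x y a b : F) (z g : E).

Lemma galois_full : galois 1%VS {:E}.
Proof. by apply/and3P; split; [exact: subvf|exact: sepE|exact: normalFieldf]. Qed.

Lemma Gal_quadratic : ('Gal({:E} / 1%VS))%g = [set 1%g; sigma]%SET :> {set _}.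
Proof.
apply/esym/eqP; rewrite eqEcard; apply/andP; split.
  by apply/fintype.subsetP => u; rewrite !inE => /orP[]/eqP ->.
by rewrite -(galois_dim galois_full) dimv1 divn1 dimE cards2 eq_sym sigma1.
Qed.

Lemma normEF_mul z : normEF z = z * sigma z.
Proof.
rewrite /normEF /galNorm Gal_quadratic (bigD1 1%g) ?inE ?eqxx//= gal_id; congr (_ * _).
rewrite (big_pred1 sigma)// => u; rewrite !inE.
by case: (eqVneq u 1%g) => [->|]; rewrite ?andbF ?andbT//= eq_sym (negbTE sigma1).
Qed.

Lemma algZ_inj a b : a%:A = b%:A :> E -> a = b.
Proof. exact: (fmorph_inj (in_alg E)). Qed.

Lemma descendE a : descend (a%:A : E) = a.
Proof.
have /= := @xgetPex _ 0 [set b : F | b%:A = a%:A :> E] (ex_intro _ a erefl).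
exact: algZ_inj.
Qed.

Lemma trace_norm_in_base : exists s n : F, tau + sigma tau = s%:A /\ tau * sigma tau = n%:A.
Proof.
have fix1 : fixedField ('Gal({:E} / 1%VS))%g = 1%VS by apply/galois_fixedField/galois_full.
have : galTrace 1%VS {:E} tau \in 1%VS by rewrite -{2}fix1 galTrace_fixedField ?memvf.
have : galNorm 1%VS {:E} tau \in 1%VS by rewrite -{2}fix1 galNorm_fixedField ?memvf.
rewrite -/(normEF tau) normEF_mul => /vlineP[n nE] /vlineP[s sE]; exists s, n.
split=> //; rewrite -sE /galTrace Gal_quadratic (bigD1 1%g) ?inE ?eqxx//= gal_id; congr (_ + _).
rewrite (big_pred1 sigma)// => u; rewrite !inE.
by case: (eqVneq u 1%g) => [->|]; rewrite ?andbF ?andbT//= eq_sym (negbTE sigma1).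
Qed.

Variables (s n : F).
Hypothesis traceE : tau + sigma tau = s%:A.
Hypothesis normE : tau * sigma tau = n%:A.

Definition ecoord x y : E := x%:A + y *: tau.

Lemma sigma_tau : sigma tau = s%:A - tau.
Proof. by rewrite -traceE addrAC subrr add0r. Qed.

Lemma tau_sqr : tau * tau = s *: tau - n%:A.
Proof.
have := normE; rewrite sigma_tau mulrBr => <-.
by rewrite opprB addrC -scalerAr mulr1 subrK.
Qed.

Lemma basis_tau : basis_of {:E} [tuple 1; tau].
Proof.
rewrite basisEfree dimE subvf leqnn !andbT.
rewrite (perm_free (_ : perm_eq _ [:: tau; 1])); last by rewrite (perm_catC [:: 1]).
by rewrite free_cons seq1_free oner_neq0 andbT span_seq1.
Qed.

Lemma ecoord_ex z : exists x y, z = ecoord x y.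
Proof.
exists (coord [tuple 1; tau] 0 z), (coord [tuple 1; tau] 1 z).
by rewrite [LHS](coord_basis basis_tau (memvf z)) sum_ord2.
Qed.

Lemma coord_ecoord x y :
  coord [tuple 1; tau] 0 (ecoord x y) = x /\ coord [tuple 1; tau] 1 (ecoord x y) = y.
Proof.
have fr := basis_free basis_tau.
pose k (i : 'I_2) := if i == 0 then x else y.
have -> : ecoord x y = \sum_(i < 2) k i *: [tuple 1; tau]`_i by rewrite sum_ord2.
by rewrite !coord_sum_free.
Qed.

Lemma sigma_ecoord x y : sigma (ecoord x y) = ecoord (x + s * y) (- y).
Proof.
rewrite /ecoord linearD linearZ /= linearZ /= rmorph1 sigma_tau.
by rewrite scalerBr scalerDl scalerA [y * s]mulrC scaleNr addrA.
Qed.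

Lemma ecoord_mul x y u v :
  ecoord x y * ecoord u v = ecoord (x * u - n * (y * v)) (x * v + y * u + s * (y * v)).
Proof.
rewrite /ecoord mulrDl !mulrDr -!scalerAl -!scalerAr !mul1r mulr1 tau_sqr.
rewrite !scalerBr !scalerA !scalerDl !scaleNr.
rewrite [y * v * s]mulrC [y * v * n]mulrC.
move: ((x * u)%:A) ((n * (y * v))%:A) ((x * v) *: tau) ((y * u) *: tau)
  ((s * (y * v)) *: tau) => p1 p2 p3 p4 p5; ring.
Qed.

Lemma normEF_ecoord x y : normEF (ecoord x y) = (nform s n x y)%:A.
Proof.
rewrite normEF_mul sigma_ecoord ecoord_mul /nform.
have -> : x * - y + y * (x + s * y) + s * (y * - y) = 0 by ring.
by rewrite /ecoord scale0r addr0; congr (_ *: _); ring.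
Qed.

Lemma ecoord_eq0 x y : ecoord x y = 0 -> x = 0 /\ y = 0.
Proof. by move=> e; have := coord_ecoord x y; rewrite e !linear0 => -[-> ->]. Qed.

Lemma nform_anisotropic x y : nform s n x y = 0 -> x = 0 /\ y = 0.
Proof.
move=> e; apply: ecoord_eq0; apply/eqP; rewrite -(galNorm_eq0 1%VS {:E}).
by rewrite -/(normEF _) normEF_ecoord e scale0r.
Qed.

(** If both vanished, then [sigma tau = - tau = tau] and [sigma] would be trivial. *)
Lemma trace_separable : s != 0 \/ (2%:R : F) != 0.
Proof.
have [s0|] := eqVneq s 0; last by left.
right; apply: contra sigma1 => /eqP two0; apply/gal_eqP => z _; rewrite gal_id.
have [x [y ->]] := ecoord_ex z; rewrite sigma_ecoord s0 mul0r addr0.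
congr (ecoord _ _); apply/eqP; rewrite eq_sym -addr_eq0; apply/eqP.
by rewrite -mulr2n -mulr_natl two0 mul0r.
Qed.

Lemma mulE_mx_ecoord x y : mulE_mx tau (ecoord x y) = mx2 x (- (n * y)) y (x + s * y).
Proof.
have [c1 c1'] := coord_ecoord x y.
have e : ecoord x y * tau = ecoord (- (n * y)) (x + s * y).
  have -> : tau = ecoord 0 1 by rewrite /ecoord scale0r add0r scale1r.
  by rewrite ecoord_mul; congr ecoord; ring.
have [c2 c2'] := coord_ecoord (- (n * y)) (x + s * y).
by apply: mx2P; rewrite !mxE /= ?mulr1 ?e ?c1 ?c1' ?c2 ?c2'.
Qed.

Lemma torusE t : torus tau t <->
  exists x y, nform s n x y = 1 /\ slmx t = mx2 x (- (n * y)) y (x + s * y).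
Proof.
split=> [[g g1 tg]|[x [y [xy txy]]]].
  have [x [y gE]] := ecoord_ex g; exists x, y; rewrite tg gE mulE_mx_ecoord; split=> //.
  by apply: algZ_inj; rewrite -normEF_ecoord -gE g1 scale1r.
exists (ecoord x y); first by rewrite normEF_ecoord xy scale1r.
by rewrite mulE_mx_ecoord.
Qed.

Lemma epsEF_is_norm a :
  @epsEF R F E a = if a == 0 then 0 else if `[< is_norm s n a >] then 1 else -1.
Proof.
rewrite /epsEF; case: ifP => // _; congr (if _ then _ else _); apply: asbool_equiv_eq.
split=> [[z]|[x [y <-]]]; last by exists (ecoord x y); rewrite normEF_ecoord.
by have [x [y ->]] := ecoord_ex z; rewrite normEF_ecoord => /algZ_inj; exists x, y.
Qed.

(** The square root of [|N(tau - sigma tau)|], whose argument is minus the discriminant of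
    [X^2 - s X + n]. *)
Definition tau_diff := Num.sqrt (absv (4%:R * n - s ^+ 2)).

Lemma tau_sub_sigma : tau - sigma tau = ecoord (- s) 2%:R.
Proof. by rewrite sigma_tau /ecoord scaleNr scaler_nat mulr2n opprB addrA addrC. Qed.

(** For [g = a + b tau] one has [g - sigma g = b (tau - sigma tau)]. *)
Lemma transfer_factorE (lambda : R[i]) a b :
  transfer_factor lambda sigma tau (ecoord a b) =
    lambda * @epsEF R F E b * (absv b * tau_diff)%:C.
Proof.
have e : ecoord a b - sigma (ecoord a b) = ecoord (- (s * b)) (2%:R * b).
  rewrite sigma_ecoord /ecoord opprD addrACA -!scalerBl.
  by congr (_ *: _ + _ *: _); ring.
have bE : ecoord (- (s * b)) (2%:R * b) = b%:A * (tau - sigma tau).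
  rewrite tau_sub_sigma -scalerAl mul1r /ecoord scalerDr !scalerA; congr (_ *: _ + _ *: _); ring.
have tn0 : tau - sigma tau != 0.
  rewrite tau_sub_sigma; apply/eqP => /ecoord_eq0[s0 two0].
  case: trace_separable; first by rewrite -oppr_eq0 s0 eqxx.
  by rewrite two0 eqxx.
rewrite /transfer_factor e {1}bE mulfK// descendE normEF_ecoord descendE; congr (_ * _%:C).
have -> : nform s n (- (s * b)) (2%:R * b) = b ^+ 2 * (4%:R * n - s ^+ 2).
  by rewrite /nform; ring.
rewrite absvM absvX sqrtrM ?exprn_ge0 ?absv_ge0// sqrtr_sqr ger0_norm ?absv_ge0//.
Qed.

Lemma tau_diff_neq0 : tau_diff != 0.
Proof.
rewrite sqrtr_eq0 -ltNge absv_gt0; apply/eqP => D0.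
have : nform s n (- s) 2%:R = 0 by rewrite -[RHS]D0 /nform; ring.
move=> /nform_anisotropic[s0 two0]; case: trace_separable.
  by rewrite -oppr_eq0 s0 eqxx.
by rewrite two0 eqxx.
Qed.

End quadratic_extension.

(** * The germ expansion *)

Section norm_character.
Context {R : realType} {F : naLocalFieldType R}.
Variables (s n : F).
Local Notation nf := (nform s n).
Hypothesis nform_eq0 : forall x y, nf x y = 0 -> x = 0 /\ y = 0.
Hypothesis separable_form : s != 0 \/ (2%:R : F) != 0.
Implicit Types (x y b r : F).

Definition norm_character (x : F) : R[i] :=
  if x == 0 then 0 else if `[< is_norm s n x >] then 1 else -1.
Local Notation eps := norm_character.

Lemma norm_character_norm x : x != 0 -> is_norm s n x -> eps x = 1.
Proof. by move=> x0 nx; rewrite /eps (negbTE x0) asboolT. Qed.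

Lemma norm_character_nonnorm x : x != 0 -> ~ is_norm s n x -> eps x = -1.
Proof. by move=> x0 nx; rewrite /eps (negbTE x0) asboolF. Qed.

Lemma norm_character_sqr x : x != 0 -> eps x * eps x = 1.
Proof.
by move=> x0; rewrite /eps (negbTE x0); case: ifP => _; rewrite ?mulrNN mulr1.
Qed.

(** The product of two non-norms is where [norm_index] enters. *)
Lemma norm_characterM x y : x != 0 -> y != 0 -> eps (x * y) = eps x * eps y.
Proof.
move=> x0 y0; have xy0 : x * y != 0 by rewrite mulf_neq0.
have [nx|nx] := pselect (is_norm s n x).
  rewrite (norm_character_norm x0 nx) mul1r.
  have [ny|ny] := pselect (is_norm s n y).
    by rewrite !norm_character_norm//; exact: is_normM.
  rewrite !norm_character_nonnorm// => nxy; apply: ny; apply: (is_norm_mulr x0 nx).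
  by rewrite mulrC.
rewrite (norm_character_nonnorm x0 nx).
have [ny|ny] := pselect (is_norm s n y).
  rewrite (norm_character_norm y0 ny) mulr1 norm_character_nonnorm// => nxy.
  by apply: nx; apply: (is_norm_mulr y0 ny).
rewrite (norm_character_nonnorm y0 ny) mulrNN mulr1 norm_character_norm//.
by case: (norm_index nform_eq0 separable_form x0 y0).
Qed.

Lemma norm_character1 : eps 1 = 1.
Proof. by apply: norm_character_norm (oner_neq0 _) _; exact: is_norm1. Qed.

Lemma norm_characterV x : x != 0 -> eps x^-1 = eps x.
Proof.
move=> x0; rewrite -[RHS]mulr1 -norm_character1 -(mulfV x0).
by rewrite norm_characterM ?invr_neq0// mulrA norm_character_sqr// mul1r.
Qed.

Lemma norm_character_div_sqr x y : y != 0 -> eps (x / y ^+ 2) = eps x.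
Proof.
move=> y0; have [->|x0] := eqVneq x 0; first by rewrite mul0r.
rewrite norm_characterM ?invr_neq0 ?expf_neq0// norm_characterV ?expf_neq0//.
by rewrite expr2 norm_characterM// norm_character_sqr// mulr1.
Qed.

(* This identity is how the kappa-orbital integral enters. *)
Lemma is_norm_indic x b : x != 0 -> b != 0 ->
  ((`[< is_norm s n (- (x / b)) >]%:R : R)%:C : R[i]) = (1 + eps (-1) * eps b * eps x) / 2%:R.
Proof.
move=> x0 b0; have m0 : (-1 : F) != 0 by rewrite oppr_eq0 oner_neq0.
have xb0 : - (x / b) != 0 by rewrite oppr_eq0 mulf_neq0 ?invr_neq0.
have -> : eps (-1) * eps b * eps x = eps (- (x / b)).
  have bV0 : b^-1 != 0 by rewrite invr_neq0.
  rewrite -[- (x / b)]mulN1r norm_characterM// ?mulf_neq0// (norm_characterM x0 bV0) norm_characterV//.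
  by rewrite mulrA mulrAC.
rewrite /eps (negbTE xb0); case: asboolP => _.
  by rewrite -mulr2n divff// pnatr_eq0.
by rewrite subrr mul0r.
Qed.

Lemma norm_character_close : exists2 e : R, 0 < e & forall z x y, absv z < e -> x != 0 ->
  absv (y - x) <= absv (z * x) -> eps y = eps x.
Proof.
have [e e0 he] := is_norm_near1 nform_eq0 separable_form.
exists (Num.min e 1); first by rewrite lt_min e0 ltr01.
move=> z x y; rewrite lt_min => /andP[ze z1] x0 yx.
have ax0 : 0 < absv x by rewrite absv_gt0.
have y0 : y != 0.
  rewrite -absv_gt0 (@absv_close_le _ _ _ _ (absv (z * x)) yx) ?absv_gt0//.
  by rewrite absvM gtr_pMl.
have xy : is_norm s n (y / x).
  apply: he; have -> : 1 - y / x = (x - y) / x by field.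
  rewrite absv_div ltr_pdivrMr// absv_distC; apply: le_lt_trans yx _.
  by rewrite absvM ltr_pM2r.
rewrite -[y](divfK x0) norm_characterM//; last by rewrite mulf_neq0 ?invr_neq0.
by rewrite (norm_character_norm _ xy) ?mul1r// mulf_neq0 ?invr_neq0.
Qed.

Lemma norm_character_open (u : R[i]) r : r != 0 -> u != 0 ->
  open [set x : F | eps x = u /\ absv x <= absv r].
Proof.
move=> r0 u0; have [e e0 he] := norm_character_close.
have [|z z0] := @absv_ex_small R F (Num.min e 1); first by rewrite lt_min e0 ltr01.
rewrite lt_min => /andP[ze z1].
apply/open_absvP => x /= [xu xr].
have x0 : x != 0 by apply: contraNneq u0 => x0; rewrite -xu /eps x0 eqxx.
exists (absv (z * x)); first by rewrite absv_gt0 mulf_neq0.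
move=> y; rewrite absv_distC => yx /=; split; first by rewrite (he z x) ?ltW.
by rewrite (@absv_close _ _ y x)// (lt_trans yx)// absvM gtr_pMl ?absv_gt0.
Qed.

Definition character_set r (i : bool) : set F :=
  [set x | eps x = (if i then 1 else -1) /\ absv x <= absv r].

Lemma norm_character_indic r x : eps x * (`[< absv x <= absv r >]%:R : R)%:C =
  \sum_(i <- [:: true; false]) (if i then 1 else -1) * (\1_(character_set r i) x)%:C.
Proof.
have ne : ((1 : R[i]) == -1) = false by rewrite -subr_eq0 opprK -mulr2n pnatr_eq0.
rewrite !big_cons big_nil addr0 !indicE.
case: asboolP => xr; last by rewrite !memNset ?mulr0 ?addr0// => -[_].
have mem i : (x \in character_set r i) = (eps x == if i then 1 else -1).
  by apply/idP/idP => [/set_mem[-> _]|/eqP e]; [|apply/mem_set].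
rewrite !mem /= mulr1; rewrite /eps; case: ifP => _.
  by rewrite eq_sym oner_eq0 eq_sym oppr_eq0 oner_eq0 !mulr0 addr0.
case: ifP => _; first by rewrite eqxx ne mulr1 mulr0 addr0.
by rewrite eqxx eq_sym ne mulr1 mulr0 add0r.
Qed.

End norm_character.

(** * Comparison of the two sides at a given radius *)

Section germ_expansion.
Context {R : realType} {F : naLocalFieldType R}.
Variables (s n : F) (T : set (SL2 F)).
Local Notation nf := (nform s n).
Hypothesis nform_eq0 : forall x y, nf x y = 0 -> x = 0 /\ y = 0.
Hypothesis separable_form : s != 0 \/ (2%:R : F) != 0.
Hypothesis torusP : forall t, T t <-> exists x y, nf x y = 1 /\ slmx t = mx2 x (- (n * y)) y (x + s * y).
Variable mu : {measure set (borel (coset_space T)) -> \bar R}.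
Hypothesis haarT : haar_coset mu.
Variable muF : {measure set (borel F) -> \bar R}.
Hypothesis haarF : haar_add muF.
Variable muK : {measure set (borel (SL2 (valring F))) -> \bar R}.
Hypothesis haarK : haar_SL2 muK.
Implicit Types (f : SL2 F -> R[i]) (t : SL2 F) (r z : F).
Local Notation eps := (norm_character s n).

Lemma mass_gt0 : 0 < mass_ringF muF * mass_iwahori muK.
Proof.
rewrite mulr_gt0 ?haar_fball1_gt0// divr_gt0 ?haar_SL2_valring_gt0//.
by rewrite ltr_wpDr ?absv_ge0.
Qed.

(** The constants [g], [z] and the function [ball_germ] are chosen before [f]; but [ball_germ] still
    takes the radius [r], which is adapted to [f]. The final theorem removes this dependence. *)
Lemma germ_expansion : exists (g : R) (z : F) (ball_germ : F -> SL2 F -> R[i]), z != 0 /\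
  forall f d c r, unif_locconst f d c -> r != 0 -> absv r < d -> absv r <= 1 ->
  forall t, T t -> t 1 0 != 0 ->
    absv (t 0 0 + t 1 1 - 2%:R) * absv c <= absv (z * r) ^+ 2 ->
  orbint mu t f = f 1%g * ball_germ r t
    + (g / absv (t 1 0))%:C * unip_orbint muK muF (fun=> 1) f
    + (g / absv (t 1 0))%:C * eps (-1) * eps (t 1 0) * unip_orbint muK muF eps f.
Proof.
have [cX [z0 [z00 z01 massE]]] := qbox_measure nform_eq0 separable_form torusP haarT.
have [e e0 he] := norm_character_close nform_eq0 separable_form.
(* The relative radius of the boxes must suit both sides: below [z0] for the measure formula, below
   [e] for the norm character to be constant on them. *)
have [|z zn0] := @absv_ex_small R F (Num.min e (absv z0)).
  by rewrite lt_min e0 absv_gt0.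
rewrite lt_min => /andP[ze zz0].
have z1 : absv z < 1 by exact: lt_trans z01.
pose V := mass_ringF muF * mass_iwahori muK.
have V0 : V != 0 by rewrite gt_eqF// mass_gt0.
(* The 2 comes from [is_norm_indic], and [V] is the constant of the box terms in the unipotent
   integrals. *)
pose g := cX / (2%:R * V).
pose I chi r := cintegral muF (fun x => chi x * (`[< absv (x : F) <= absv r >]%:R : R)%:C)
  * (fine (muK setT))%:C.
(* The mass of the ball, minus the multiples of [f 1] contained in the two unipotent orbital
   integrals. *)
pose G r t := (ball_mass mu t r)%:C - (g / absv (t 1 0))%:C * I (fun=> 1) r
    - (g / absv (t 1 0))%:C * eps (-1) * eps (t 1 0) * I eps r.
exists g, z, G; split=> // f d c r uf r0 rd r1 t Tt b0 tc.
have [a [b [_ te]]] := (torusP t).1 Tt.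
have bE : t 1 0 = b by rewrite te mx2E.
rewrite bE in b0.
have [L [Lr fL]] := orbital_decomposition uf r0 zn0 rd r1 z1.
have Lr1 l : l \in L -> absv r < absv l.2.2 by move=> /Lr[].
have x0 l : l \in L -> l.2.2 != 0.
  by move=> /Lr1; rewrite -absv_gt0; apply: le_lt_trans; exact: absv_ge0.
have O : orbint mu t f = f 1%g * (ball_mass mu t r)%:C +
    \sum_(l <- L) wcoef f l * (box_mass s n b cX l.2.2 (z * r))%:C.
  apply: (orbint_decomposition nform_eq0 torusP haarT Tt te b0 z01 massE) => //.
    exact: ltW.
  move=> q; apply: fL; have [-> _ _ ->] := tconjE q te.
  rewrite te !mx2E in tc; apply: le_trans tc; rewrite le_eqVlt; apply/orP; left; apply/eqP.
  by congr (absv _ * _); ring.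
(* Conjugates of unipotents have trace exactly 2, so the same list of boxes applies on both
   sides. *)
have fU (y : SL2 F) : y 0 0 + y 1 1 = 2%:R -> f y = f 1%g * (`[< wball r y >]%:R : R)%:C +
      \sum_(l <- L) wcoef f l * (`[< wbox l.2.1 l.2.2 (z * r)
        (SL2_incl (conj_rep l.1) * y * (SL2_incl (conj_rep l.1))^-1)%g >]%:R : R)%:C.
  by move=> yE; apply: fL; rewrite yE subrr absv0 mul0r exprn_ge0 ?absv_ge0.
have U1 : unip_orbint muK muF (fun=> 1) f = f 1%g * I (fun=> 1) r +
    \sum_(l <- L) wcoef f l * 1 * (V * (absv (z * r) ^+ 2 / absv l.2.2))%:C.
  apply: (@unip_orbint_decomposition R F muF haarF muK haarK (fun=> 1) f r z L
    [:: true] (fun=> 1) (fun=> fball 0 r)) => //.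
    move=> x; rewrite big_seq1 !mul1r indicE; congr (_%:R)%:C; congr (nat_of_bool _).
    by rewrite /fball /= ; apply/idP/idP; rewrite inE /= subr0 => /asboolP.
  by move=> i _; split; [exact: measurable_fball|exact: haar_fball_fin].
have Ue : unip_orbint muK muF eps f = f 1%g * I eps r +
    \sum_(l <- L) wcoef f l * eps l.2.2 * (V * (absv (z * r) ^+ 2 / absv l.2.2))%:C.
  apply: (@unip_orbint_decomposition R F muF haarF muK haarK eps f r z L
    [:: true; false] (fun i => if i then 1 else -1) (character_set s n r)) => //.
  - by move=> x y y0 xy; apply: he xy.
  - by move=> x y; exact: norm_character_div_sqr.
  - by move=> x; exact: norm_character_indic.
  - move=> i _; have mi : measurable (character_set s n r i : set (borel F)).
      apply: open_measurable; apply: norm_character_open => //.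
      by case: i; rewrite ?oppr_eq0 oner_eq0.
    split=> //; apply: le_lt_trans (haar_fball_fin haarF 0 r).
    apply: le_measure; rewrite ?inE//; first exact: measurable_fball.
    by move=> x [_]; rewrite /fball /= subr0.
rewrite O U1 Ue bE {}/G bE.
have sumE : \sum_(l <- L) wcoef f l * (box_mass s n b cX l.2.2 (z * r))%:C =
    (g / absv b)%:C * (\sum_(l <- L) wcoef f l * 1 * (V * (absv (z * r) ^+ 2 / absv l.2.2))%:C) +
    (g / absv b)%:C * eps (-1) * eps b *
    (\sum_(l <- L) wcoef f l * eps l.2.2 * (V * (absv (z * r) ^+ 2 / absv l.2.2))%:C).
  rewrite !mulr_sumr -big_split big_seq [RHS]big_seq; apply: eq_bigr => l lL.
  have -> : (box_mass s n b cX l.2.2 (z * r))%:C = (g / absv b)%:C * 2%:R *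
      (V * (absv (z * r) ^+ 2 / absv l.2.2))%:C *
      ((`[< is_norm s n (- (l.2.2 / b)) >]%:R : R)%:C : R[i]).
    rewrite -[2%:R](rmorph_nat (real_complex R)) -!rmorphM; congr _%:C.
    rewrite /box_mass; case: ifP => _; last by rewrite mulr0.
    by rewrite mulr1 /g; field; rewrite !absv_eq0E b0 x0// V0.
  rewrite is_norm_indic ?x0//.
  move: (g / absv b)%:C (V * (absv (z * r) ^+ 2 / absv l.2.2))%:C => p q /=; by field.
rewrite sumE; ring.
Qed.

End germ_expansion.

Section integral_indicator.
Context {R : realType} {F : naLocalFieldType R}.

Definition integral_indicator (x : SL2 F) : R[i] :=
  (`[< forall i j, absv (x i j) <= 1 >]%:R : R)%:C.

Lemma integral_indicator1 : integral_indicator 1%g = 1.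
Proof.
rewrite /integral_indicator asboolT//.
by do 2 apply: ord2P; rewrite SL2_oneE ?absv0 ?absv1 ?ler01.
Qed.

Lemma Ccinf_integral_indicator : Ccinf integral_indicator.
Proof.
have stable (x y : SL2 F) : sl_close 1 x y ->
    (forall i j, absv (x i j) <= 1) -> forall i j, absv (y i j) <= 1.
  move=> xy x1 i j; rewrite -[y i j](subKr (x i j)); apply: absvB_le => //.
  exact/ltW/xy.
have sym (x y : SL2 F) : sl_close 1 x y -> sl_close 1 y x.
  by move=> xy i j; rewrite absv_distC.
split=> [x|].
  apply/nbhs_SL2P; exists 1 => // y xy; rewrite /integral_indicator.
  congr (_%:R)%:C; congr (nat_of_bool _); apply: asbool_equiv_eq; split; apply: stable => //.
  exact: sym.
apply: (@compact_SL2_bounded _ _ 1); last exact: closed_closure.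
move=> x clx; rewrite absv1.
have [|y [y1 xy]] := clx [set y | sl_close 1 x y]; first by apply/nbhs_SL2P; exists 1.
apply: (stable y); first exact: sym.
by move: y1; rewrite /integral_indicator /=; case: asboolP => // _; rewrite eqxx.
Qed.

End integral_indicator.

Unset Implicit Arguments.
Set Strict Implicit.
Set Printing Implicit Defensive.

Theorem mainTheorem3 (R : realType) (F : naLocalFieldType R)
  (E : splittingFieldType F)
  (dimE : \dim {:E} = 2%N) (sepE : separable 1%VS {:E})
  (sigma : gal_of {:E}) (sigmaG : sigma \in ('Gal({:E} / 1%VS))%g)
  (sigma1 : sigma != 1%g)
  (tau : E) (tauF : tau \notin 1%VS)
  (lambda : R[i]) (lambda4 : lambda ^+ 4 = 1)
  (muF : {measure set (borel F) -> \bar R}) (haarF : haar_add muF)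
  (muK : {measure set (borel (SL2 (valring F))) -> \bar R})
  (haarK : haar_SL2 muK)
  (muTG : {measure set (borel (coset_space (torus tau))) -> \bar R})
  (haarTG : haar_coset muTG) :
  exists (Gamma1 Gammanu : torus_reg tau -> R[i]) (c : R[i]),
  forall f : SL2 F -> R[i], Ccinf f ->
  exists2 V : set (SL2 F), within (torus tau) (nbhs (1%g : SL2 F)) V &
  forall (t : torus_reg tau) (g : E),
    V (set_val t) -> normEF g = 1 -> slmx (set_val t) = mulE_mx tau g ->
    orbint muTG (set_val t) f =
      Gamma1 t * f 1%g
      + Gammanu t * unip_orbint muK muF (fun=> 1) f
      + c * (transfer_factor lambda sigma tau g)^-1
        * unip_orbint muK muF (@epsEF R F E) f.
Proof.
have [s [n [trE nrE]]] := trace_norm_in_base tau dimE sepE sigmaG sigma1.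
have aniso x y : nform s n x y = 0 -> x = 0 /\ y = 0.
  exact: (nform_anisotropic dimE sepE sigmaG sigma1 tauF trE nrE).
have sep := trace_separable dimE sigma1 tauF trE.
have TP := torusE dimE sepE sigmaG sigma1 tauF trE nrE.
have epsE : @epsEF R F E = norm_character s n.
  by apply/funext => a; exact: (epsEF_is_norm dimE sepE sigmaG sigma1 tauF trE nrE).
have [h [z [G [z0 germ]]]] := germ_expansion aniso sep TP haarTG haarF haarK.
pose b (t : torus_reg tau) : F := slmx (set_val t) 1 0.
(* If [b t] vanishes, the norm condition reads [x^2 = 1] and [t] is 1 or -1, which regularity
   excludes. *)
have b0 t : b t != 0.
  have [Tt t1 tN1] : torus_reg tau (set_val t) by apply: set_valP.
  have [x [y [xy te]]] := (TP _).1 Tt; rewrite /b te mx2E; apply/eqP => y0.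
  move: xy; rewrite y0 /nform mulr0 addr0 expr0n mulr0 addr0 => /eqP.
  rewrite sqrf_eq1 => /orP[]/eqP xE; [apply: t1|apply: tN1].
    by apply: mx2P; rewrite te y0 xE !mxE /= ?mulr0 ?oppr0 ?addr0.
  by apply: mx2P; rewrite te y0 xE !mxE /= ?mulr0 ?oppr0 ?addr0.
pose d0 := tau_diff s n.
pose eps := norm_character s n.
(* Chosen so that [c] divided by the transfer factor is [Gk t]: [lambda] and [d0] cancel those of
   the transfer factor, and [eps (b t)] is its own inverse. *)
pose c : R[i] := lambda * eps (-1) * (h * d0)%:C.
pose Gnu (t : torus_reg tau) : R[i] := (h / absv (b t))%:C.
pose Gk (t : torus_reg tau) : R[i] := (h / absv (b t))%:C * eps (-1) * eps (b t).
pose f1 : SL2 F -> R[i] := integral_indicator.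
(* The expansion solved for the first germ with [f1] as test function, for which [f1 1 = 1]; no
   radius appears. *)
pose G1 (t : torus_reg tau) : R[i] := orbint muTG (set_val t) f1
  - Gnu t * unip_orbint muK muF (fun=> 1) f1 - Gk t * unip_orbint muK muF eps f1.
exists G1, Gnu, c => f cf.
have [d d_gt0 [u uf]] := Ccinf_unif cf.
have [d1 d1_gt0 [u1 uf1]] := Ccinf_unif (@Ccinf_integral_indicator R F).
have [_ u_ge1 _] := uf; have [_ u1_ge1 _] := uf1.
(* One radius for both [f] and [f1]; likewise [M] below yields a neighbourhood in which both
   expansions hold. *)
have [|r r0] := @absv_ex_small R F (Num.min 1 (Num.min d d1)).
  by rewrite !lt_min ltr01 d_gt0.
rewrite !lt_min => /and3P[r1 rd rd1].
pose M := Num.max (absv u) (absv u1).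
have M0 : 0 < M by rewrite lt_max (lt_le_trans ltr01 u_ge1).
pose e := absv (z * r) ^+ 2 / M.
have e0 : 0 < e by rewrite divr_gt0 ?exprn_gt0 ?absv_gt0 ?mulf_neq0.
exists [set t | absv (slmx t 0 0 + slmx t 1 1 - 2%:R) <= e].
  apply/nbhs_SL2P; exists e => // t te _ /=.
  have -> : slmx t 0 0 + slmx t 1 1 - 2%:R = (slmx t 0 0 - 1) + (slmx t 1 1 - 1) by ring.
  by apply: absvD_le; rewrite absv_distC; have := te 0 0; have := te 1 1; rewrite !SL2_oneE => /ltW + /ltW.
move=> t g Vt g1 tg; rewrite epsE.
have [Tt _ _] : torus_reg tau (set_val t) by apply: set_valP.
have trace_le (v : F) : absv v <= M ->
    absv (slmx (set_val t) 0 0 + slmx (set_val t) 1 1 - 2%:R) * absv v <= absv (z * r) ^+ 2.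
  move=> vM; rewrite -[leRHS](divfK (lt0r_neq0 M0)).
  by rewrite ler_pM ?absv_ge0.
have fE := germ f d u r uf r0 rd (ltW r1) (set_val t) Tt (b0 t) (trace_le u _).
have f1E := germ f1 d1 u1 r uf1 r0 rd1 (ltW r1) (set_val t) Tt (b0 t) (trace_le u1 _).
have cD : c * (transfer_factor lambda sigma tau g)^-1 = Gk t.
  have [x [y gE]] := ecoord_ex dimE tauF g.
  have bE : b t = y by rewrite /b tg gE (mulE_mx_ecoord dimE tauF trE nrE) mx2E.
  rewrite gE (transfer_factorE dimE sepE sigmaG sigma1 tauF trE nrE) epsE -bE /Gk /c -/d0 -/eps.
  have l0 : lambda != 0.
    by apply/eqP => l0; move: lambda4; rewrite l0 expr0n => /esym/eqP; rewrite oner_eq0.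
  have e2 : eps (b t) * eps (b t) = 1 by apply: norm_character_sqr; exact: b0.
  have eb0 : eps (b t) != 0.
    by apply/eqP => eb; move: e2; rewrite eb mulr0 => /esym/eqP; rewrite oner_eq0.
  have ab0 : (absv (b t))%:C != 0 :> R[i] by rewrite fmorph_eq0 absv_eq0E b0.
  have d00 : d0%:C != 0 :> R[i].
    by rewrite fmorph_eq0 (tau_diff_neq0 dimE sepE sigmaG sigma1 tauF trE nrE).
  have -> : (h / absv (b t))%:C * eps (-1) * eps (b t) =
      (h / absv (b t))%:C * eps (-1) / eps (b t).
    by rewrite -[in RHS](mulr1 (_ * eps (-1))) -e2 mulrA mulfK.
  rewrite !rmorphM fmorphV /=; field; by rewrite l0 eb0 ab0 d00.
have f11 : f1 1%g = 1 by exact: integral_indicator1.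
rewrite cD /G1 f1E ?le_max ?lexx ?orbT// fE ?le_max ?lexx// f11.
(* Here [g0] is the ball germ at the common radius: solving the expansion of [f1] for it and
   inserting it in that of [f] eliminates it. *)
have cancel (a g0 p q x y x' y' : R[i]) : a * g0 + p * x + q * y =
    (1 * g0 + p * x' + q * y' - p * x' - q * y') * a + p * x + q * y by ring.
exact: cancel.
Qed.
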